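(* Suppose that there are constants $c_1>0$, $C_1>0$, $\sigma^2>0$ and a sequence $B_n\ge 1$ of constants such that for all $1\le i\le n$ and $1\le j\le p$: (i) $|z_{ij}|\le B_n$; (ii) $\mathbb E_n[z_{ij}^2]=1$; (iii) $\mathrm E[\varepsilon_i^2]=\sigma^2$; (iv) $\mathrm E[\varepsilon_i^4]\le C_1$; and (v) $B_n^4(\log(pn))^7/n\le C_1n^{-c_1}$. Let $\alpha\in(0,1)$, and let $\hat\beta^{(0)}$ and $\hat\beta^{(1)}$ be the Dantzig selectors with penalty levels $\lambda^{(0)}:=c_0(1-\alpha)$ and $\lambda^{(1)}:=c_{Z_0}(1-\alpha)$, respectively. Let $\|\cdot\|_I$ be any semi-norm on $\mathbb R^p$. Then there exist constants $c>0$ and $C>0$ depending only on $c_1$, $C_1$ and $\sigma^2$ such that, for either $k=0$ or $k=1$, with probability at least $1-\alpha-Cn^{-c}$, $$\|\hat\beta^{(k)}-\beta\|_I\le\frac{2\lambda^{(k)}}{\sqrt n\,\kappa_I(\beta)} .$$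
   Context: Let $n\ge1$, $p\ge 3$ be integers ($p$ may exceed $n$). Model: $y_i=z_i'\beta+\varepsilon_i$, $i=1,\dots,n$, where $z_i=(z_{i1},\dots,z_{ip})'\in\mathbb R^p$ are non-stochastic, $\beta\in\mathbb R^p$ is the true parameter, and $\varepsilon_1,\dots,\varepsilon_n$ are independent real random variables with $\mathrm E[\varepsilon_i]=0$. $\mathbb E_n[\cdot]=n^{-1}\sum_{i=1}^n[\cdot]$; $\sigma=\sqrt{\sigma^2}$. The Dantzig selector with penalty level $\lambda$ is any $$\hat\beta\in\arg\min_{b\in\mathbb R^p}\|b\|_{\ell_1}\ \text{ subject to }\ \sqrt n\max_{1\le j\le p}|\mathbb E_n[z_{ij}(y_i-z_i'b)]|\le\lambda,$$ where $\|b\|_{\ell_1}=\sum_{j=1}^p|b_j|$. Penalty levels: $c_{Z_0}(1-\alpha)$ is the $(1-\alpha)$-quantile of $Z_0:=\sigma\sqrt n\max_{1\le j\le p}|\mathbb E_n[z_{ij}e_i]|$, where $e_1,\dots,e_n$ are i.i.d. $N(0,1)$ independent of the data; $c_0(1-\alpha):=\sigma\Phi^{-1}(1-\alpha/(2p))$, with $\Phi$ the standard normal distribution function. Identifiability factor: $$\kappa_I(\beta):=\inf_{\delta\in\mathbb R^p}\left\{\max_{1\le j\le p}\frac{|\mathbb E_n[z_{ij}(z_i'\delta)]|}{\|\delta\|_I}:\ \delta\in\mathcal R(\beta),\ \|\delta\|_I\ne0\right\},\quad \mathcal R(\beta):=\{\delta\in\mathbb R^p:\|\beta+\delta\|_{\ell_1}\le\|\beta\|_{\ell_1}\},$$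 with $\kappa_I(\beta):=\infty$ if $\mathcal R(\beta)=\{0\}$ (and the infimum of the empty set is $\infty$). The bound is read as $0$ when $\kappa_I(\beta)=\infty$ and as $+\infty$ when $\kappa_I(\beta)=0$. *)

(* Defs.v *)
From HB Require Import structures.
From mathcomp Require Import all_boot all_order all_algebra.
From mathcomp Require Import all_classical all_reals all_analysis.

Set Implicit Arguments.
Unset Strict Implicit.
Unset Printing Implicit Defensive.

Import Order.TTheory GRing.Theory Num.Theory.
Import numFieldNormedType.Exports.

Local Open Scope classical_set_scope.
Local Open Scope ring_scope.

Section Probability.
Context {R : realType}.

Definition mutually_independent d (T : measurableType d) (P : probability T R)
    (n : nat) (X : 'I_n -> {RV P >-> R}) : Prop :=
  forall (J : {set 'I_n}) (A : 'I_n -> set R), (forall i, measurable (A i)) ->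
    P (\bigcap_(i in [set` J]) (X i @^-1` A i)) =
    (\prod_(i in J) P (X i @^-1` A i))%E.

(* Equality of laws is only required on Borel sets: outside of them the values
   of [normal_prob] (an integral) are meaningless. *)
Definition standard_normal d (T : measurableType d) (P : probability T R)
    (X : {RV P >-> R}) : Prop :=
  forall A : set R, measurable A -> distribution P X A = normal_prob 0 1 A.

Definition quantile d (T : measurableType d) (P : probability T R)
    (X : T -> R) (u : R) : R :=
  inf [set t : R | (u%:E <= P [set w | (X w <= t)%R])%E].

(* Inner probability, so that [E] need not be measurable; for a measurable [E]
   this is [q <= P E]. *)
Definition probability_at_least d (T : measurableType d) (P : probability T R)
    (q : R) (E : set T) : Prop :=
  exists A : set T, [/\ measurable A, A `<=` E & (q%:E <= P A)%E].

Definition Phi (x : R) : R := fine (normal_prob 0 1 `]-oo, x]).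

(* The inverse function of [Phi]; the default 0 is only used outside ]0, 1[. *)
Definition Phi_inv : R -> R := 'pinv_(fun=> 0) setT Phi.

End Probability.

Section Dantzig.
Context {R : realType}.

Definition En n (a : 'I_n -> R) : R := n%:R^-1 * \sum_(i < n) a i.

(* Starting the maximum from 0 is harmless: all the terms are nonnegative. *)
Definition max_score n p (z : 'M[R]_(n, p)) (r : 'I_n -> R) : R :=
  \big[Num.max/0]_(j < p) `|En (fun i => z i j * r i)|.

Definition l1norm p (b : 'cV[R]_p) : R := \sum_(j < p) `|b j 0|.

Definition dantzig_feasible n p (z : 'M[R]_(n, p)) (y : 'I_n -> R)
    (lambda : R) (b : 'cV[R]_p) : Prop :=
  Num.sqrt n%:R * max_score z (fun i => y i - (z *m b) i 0) <= lambda.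

Definition dantzig_selector n p (z : 'M[R]_(n, p)) (y : 'I_n -> R)
    (lambda : R) (bhat : 'cV[R]_p) : Prop :=
  dantzig_feasible z y lambda bhat /\
  forall b, dantzig_feasible z y lambda b -> l1norm bhat <= l1norm b.

Definition Z0 n p (z : 'M[R]_(n, p)) (sigma : R) (e : 'I_n -> R) : R :=
  sigma * Num.sqrt n%:R * max_score z e.

Definition c_Z0 d (T : measurableType d) (Q : probability T R)
    n p (z : 'M[R]_(n, p)) (sigma : R) (e : 'I_n -> {RV Q >-> R}) (u : R) : R :=
  quantile Q (fun w => Z0 z sigma (fun i => e i w)) u.

(* The value at level [1 - alpha]. *)
Definition c_0 (p : nat) (sigma alpha : R) : R :=
  sigma * Phi_inv (1 - alpha / (2 * p%:R)).

Definition seminorm p (N : 'cV[R]_p -> R) : Prop :=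
  (forall x y, N (x + y) <= N x + N y) /\
  (forall a x, N (a *: x) = `|a| * N x).

Definition restricted_set p (beta : 'cV[R]_p) : set 'cV[R]_p :=
  [set delta | l1norm (beta + delta) <= l1norm beta].

(* [ereal_inf set0 = +oo]; this includes the case [restricted_set beta = {0}]. *)
Definition kappa n p (z : 'M[R]_(n, p)) (N : 'cV[R]_p -> R)
    (beta : 'cV[R]_p) : \bar R :=
  ereal_inf [set (\big[Num.max/0]_(j < p)
                    (`|En (fun i => z i j * (z *m delta) i 0)| / N delta))%:E
            | delta in [set delta | restricted_set beta delta /\ N delta != 0]].

(* [+oo^-1 = 0] in [\bar R], so the bound is 0 when [k = +oo]. *)
Definition error_bound (n : nat) (lambda : R) (k : \bar R) : \bar R :=
  if k == 0%E then +oo%E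
  else ((2 * lambda)%:E / ((Num.sqrt n%:R)%:E * k))%E.

End Dantzig.

(* Main.v *)
(* If the true score satisfies sqrt n * max_score z eps <= lambda, then beta is
   feasible, so delta = bhat - beta is a restricted direction whose Gram image is
   at most 2 lambda / sqrt n, and the definition of kappa bounds N delta.  It
   remains to show P(max_j S_j <= t) >= Q(max_j Y_j <= t) - C n^-c for every t, where
   S_j = \sum_i a_ij eps_i / sigma over the 2 p signed columns, and Y_j is its Gaussian
   analogue; for both penalty levels the Gaussian probability is at least 1 - alpha,
   by a union bound and exact normality of Y_j, or by definition of a quantile.

   The indicator of {max <= t} is replaced by a logistic function of the soft
   maximum.  On the product space P x Q the Gaussian variables are replaced one by
   one, at each step choosing the index whose mean influence
   E \sum_j pi_j a_ij^2 (pi the Gibbs weights) is smallest.  These influences sum to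
   at most 1, so the total third order error is O(L beta^2 b (1 + ln n)), with
   b = B / sqrt n.  Smoothing is undone by an anti-concentration bound for
   max_j Y_j: by the Cameron-Martin formula, translating by s a_j the part of
   {u < max <= v} where j is the maximiser gives disjoint parts of
   {u + s < max <= v + s}, so that about 1 / (delta (t + 1)) windows of width delta
   have masses comparable to that of the window at t. *)

Require Import Defs.
From HB Require Import structures.
From mathcomp Require Import all_boot all_order all_algebra.
From mathcomp Require Import all_classical all_reals all_analysis.
From mathcomp Require Import measurable_realfun ring lra.

Set Implicit Arguments.
Unset Strict Implicit.
Unset Printing Implicit Defensive.

Import Order.TTheory GRing.Theory Num.Theory.
Import numFieldNormedType.Exports.

Local Open Scope classical_set_scope.
Local Open Scope ring_scope.

(** * Densities, translations and independence *)

(** Only fourth moments of the errors are available, so the Taylor remainder of the smoothed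
    indicator is cut at [beta * b * |xi| = 1]. Below the cut, Gibbs weights move by a bounded factor
    and the third derivative keeps a factor [gibbs_mean] of [a ^+ 2]; above it, a second order bound
    is traded for a fourth moment. Keeping that mean, rather than [b ^+ 2], makes the errors
    summable over the indices. Independence forces an expansion around the sum without the exchanged
    term, whereas the influences sum to one only at a common point; [4 * beta * b <= 1] links the
    two at the price of a factor 2. The scales come from anti-concentration. For t up to order q =
    sqrt (ln (p n)), windows of width delta = 1 / (N q) have mass O(1 / N); L = N / delta makes the
    logistic tails negligible, and beta of order q^2 N / delta makes the soft maximum bias at most
    delta. Hence L beta^2 b is of order N^6 q^7 b, whose square is N^12 B^2 (ln (p n))^7 / n: the
    origin of the seventh power. The fourth power of B serves the fourth order term n L beta^3
    b^4. *)

Section Density.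
Context d (T : measurableType d) (R : realType).
Variables (mu nu : {measure set T -> \bar R}) (g : T -> R).
Hypothesis mg : measurable_fun setT g.
Hypothesis g_ge0 : forall x, 0 <= g x.
Hypothesis nuE : forall A, measurable A -> nu A = (\int[mu]_(x in A) (g x)%:E)%E.

Import HBNNSimple.

Lemma density_nnsfun (f : {nnsfun T >-> R}) :
  (\int[nu]_x (f x)%:E = \int[mu]_x ((f x)%:E * (g x)%:E))%E.
Proof.
under [LHS]eq_integral do rewrite fimfunE -fsumEFin//.
rewrite [LHS]ge0_integral_fsum//; last 2 first.
  - by move=> r; exact/measurable_EFinP/measurableT_comp.
  - by move=> n x _; rewrite EFinM nnfun_muleindic_ge0.
under [RHS]eq_integral.
  move=> x xD; rewrite fimfunE -fsumEFin// ge0_mule_fsuml; last first.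
    by move=> r; rewrite EFinM nnfun_muleindic_ge0.
  over.
rewrite [RHS]ge0_integral_fsum//; last 2 first.
  - move=> r; apply/measurable_EFinP; apply: measurable_funM => //.
    by apply: measurable_funM => //; exact: measurable_indic.
  - move=> n x _; rewrite EFinM mule_ge0//; first by rewrite nnfun_muleindic_ge0.
    by rewrite lee_fin.
apply: eq_fsbigr => r _.
rewrite integralZl_indic_nnsfun//= integral_indic// setIT nuE; last first.
  exact: measurable_funPTI.
rewrite integral_mkcond/=.
have [r0|r0] := ltP r 0.
  rewrite preimage_nnfun0// -[X in (_ * X)%E]integral_mkcond integral_set0 mule0.
  by apply/esym/integral0_eq => x _; rewrite /= indic0 mulr0 mul0e.
rewrite -ge0_integralZl//=.
- apply: eq_integral => x _; rewrite patchE.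
  by case: ifPn => xE; rewrite indicE ?xE ?(negbTE xE) ?mulr1 ?mulr0 ?mul0e ?mule0.
- apply/(measurable_restrictT _ _).1; first exact: measurable_funPTI.
  by apply/measurable_funTS/measurable_EFinP.
- by move=> x _; rewrite erestrict_ge0// => y _; rewrite lee_fin.
Qed.

(** Simple functions, then monotone convergence on both sides, the density multiplying the
    approximating sequence. *)
Lemma ge0_integral_density (f : T -> \bar R) :
  measurable_fun setT f -> (forall x, 0 <= f x)%E ->
  (\int[nu]_x f x = \int[mu]_x (f x * (g x)%:E))%E.
Proof.
move=> mf f0.
pose f_ := nnsfun_approx measurableT mf.
transitivity (lim (\int[nu]_x (f_ n x)%:E @[n --> \oo])%E).
  rewrite -monotone_convergence//=.
  - apply: eq_integral => ? /[!inE] xD; apply/esym/cvg_lim => //=.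
    exact: cvg_nnsfun_approx.
  - by move=> n; exact/measurable_EFinP/measurable_funTS.
  - by move=> n ? _; rewrite lee_fin.
  - by move=> ? _ ? ? mn; rewrite lee_fin; exact/lefP/nd_nnsfun_approx.
rewrite [RHS](_ : _ = lim
    (\int[mu]_x ((f_ n x)%:E * (g x)%:E) @[n --> \oo])%E); last first.
  rewrite -monotone_convergence//=.
  - apply: eq_integral => x /[!inE] xD; apply/esym/cvg_lim => //.
    apply: cvgeZr => //; exact: cvg_nnsfun_approx.
  - by move=> n; apply/measurable_EFinP/measurable_funM.
  - by move=> n ? _; rewrite lee_fin mulr_ge0.
  - move=> ? _ ? ? ?; rewrite lee_fin ler_wpM2r//.
    exact/lefP/nd_nnsfun_approx.
by apply: congr_lim; apply/funext => n /=; exact: density_nnsfun.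
Qed.

End Density.

(** Lebesgue measure is determined by its values on half-open intervals, and a translation preserves
    their length. *)
Lemma lebesgue_measure_translation (R : realType) (s : R) (A : set R) : measurable A ->
  pushforward (@lebesgue_measure R)
    (fun x : measurableTypeR R => (x + s : measurableTypeR R)) A =
  @lebesgue_measure R A.
Proof.
move=> mA; apply/esym.
have mS : measurable_fun setT (fun x : measurableTypeR R => (x + s : measurableTypeR R)).
  exact: measurable_funD.
apply: (@lebesgue_measure_unique R (pushforward (@lebesgue_measure R) (fun x : measurableTypeR R => (x + s : measurableTypeR R)))) => //.
move=> _ [[a b]] _ <-.
rewrite /=.
have E : (fun x : R => x + s) @^-1` `]a, b] = `]a - s, b - s]%classic.
  by apply/seteqP; split => x /=; rewrite !in_itv/= ltrBlDr lerBrDr.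
transitivity (@lebesgue_measure R `]a - s, b - s]%classic); last first.
  by rewrite -E.
rewrite !lebesgue_measure_itv/= !lte_fin ltrD2r; case: ifP => // _.
by rewrite -!EFinB; congr EFin; ring.
Qed.

Lemma ge0_integral_translation (R : realType) (s : R) (f : R -> \bar R) :
  measurable_fun setT f -> (forall x, 0 <= f x)%E ->
  (\int[@lebesgue_measure R]_x f (x + s)%R = \int[@lebesgue_measure R]_x f x)%E.
Proof.
move=> mf f0.
have mS : measurable_fun setT (fun x : measurableTypeR R => (x + s : measurableTypeR R)).
  exact: measurable_funD.
rewrite -(@ge0_integral_pushforward _ _ _ (measurableTypeR R) _ _ mS (@lebesgue_measure R) setT f)//.
by apply: eq_measure_integral => A mA _; exact: lebesgue_measure_translation.
Qed.

Section Independence.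
Context d (T : measurableType d) (R : realType) (P : probability T R).

Definition indep2 (U V : T -> R) : Prop := forall A B : set R,
  measurable A -> measurable B ->
  P (U @^-1` A `&` V @^-1` B) = (P (U @^-1` A) * P (V @^-1` B))%E.

(** Independence says that the joint law agrees with the product of the marginal laws on rectangles,
    hence everywhere; the iterated integral is then Tonelli. *)
Lemma indep2_integral (U V : T -> R) (f : R * R -> \bar R) :
  measurable_fun setT U -> measurable_fun setT V -> indep2 U V ->
  measurable_fun setT f -> (forall x, 0 <= f x)%E ->
  (\int[P]_w f (U w, V w) = \int[P]_w \int[P]_w' f (U w, V w'))%E.
Proof.
move=> mU mV UV mf f0.
have mUV : measurable_fun setT (fun w => (U w, V w)) by exact: measurable_fun_pair.
pose U' : {mfun T >-> R} := HB.pack U (isMeasurableFun.Build _ _ _ _ U mU).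
pose V' : {mfun T >-> R} := HB.pack V (isMeasurableFun.Build _ _ _ _ V mV).
pose W' : {mfun T >-> (R * R)%type} := HB.pack (fun w => (U w, V w)) (isMeasurableFun.Build _ _ _ _ _ mUV).
have E : forall X, measurable X -> (distribution P U' \x distribution P V')%E X = distribution P W' X.
  apply: product_measure_unique => A B mA mB /=.
  by rewrite /distribution /pushforward /= -UV.
transitivity (\int[distribution P W']_z f z)%E.
  by rewrite ge0_integral_distribution.
transitivity (\int[distribution P U' \x distribution P V']_z f z)%E.
  by apply: eq_measure_integral => A mA _; exact/esym/E.
rewrite fubini_tonelli1//= /fubini_F ge0_integral_distribution//=.
- by apply: eq_integral => w _; rewrite ge0_integral_distribution//; apply: measurableT_comp.
- exact: measurable_fun_fubini_tonelli_F.
- by move=> x; apply: integral_ge0.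
Qed.

Lemma indep2_ge0_integralM (U V : T -> R) :
  measurable_fun setT U -> measurable_fun setT V -> indep2 U V ->
  (forall w, 0 <= U w) -> (forall w, 0 <= V w) ->
  (\int[P]_w (U w * V w)%:E = \int[P]_w (U w)%:E * \int[P]_w (V w)%:E)%E.
Proof.
move=> mU mV UV U0 V0.
pose f (z : R * R) : \bar R := (`|z.1| * `|z.2|)%:E.
transitivity (\int[P]_w f (U w, V w))%E.
  by apply: eq_integral => w _; rewrite /f/= !ger0_norm.
rewrite indep2_integral//; last 2 first.
- apply/measurable_EFinP/measurable_funM; apply: measurableT_comp => //.
- by move=> x; rewrite lee_fin mulr_ge0.
rewrite -ge0_integralZr//=.
- apply: eq_integral => w _; rewrite /f/= -ge0_integralZl//=.
  + by apply: eq_integral => w' _; rewrite !ger0_norm.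
  + exact/measurable_EFinP.
  + by move=> x _; rewrite lee_fin.
  + by rewrite lee_fin.
- exact/measurable_EFinP.
- by move=> x _; rewrite lee_fin.
- by apply: integral_ge0 => w _; rewrite lee_fin.
Qed.

Lemma indep2_comp (U V : T -> R) (f g : R -> R) : indep2 U V ->
  measurable_fun setT f -> measurable_fun setT g -> indep2 (f \o U) (g \o V).
Proof.
move=> UV mf mg A B mA mB; apply: (UV (f @^-1` A) (g @^-1` B)).
- by rewrite -[f @^-1` A]setTI; exact: mf.
- by rewrite -[g @^-1` B]setTI; exact: mg.
Qed.

End Independence.

Section MutualIndependence.
Context d (T : measurableType d) (R : realType) (P : probability T R).

(** Only the full index set is tested: taking [setT] at some indices recovers every subfamily. *)
Definition indep_family (I : finType) (X : I -> T -> R) : Prop :=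
  forall A : I -> set R, (forall i, measurable (A i)) ->
    P [set w | forall i, A i (X i w)] = (\prod_i P (X i @^-1` A i))%E.

Variables (I : finType) (X : I -> T -> R).
Hypothesis mX : forall i, measurable_fun setT (X i).
Hypothesis indX : indep_family X.

(** The cylinders over [J]: a pi-system generating the sigma-algebra of the variables with index in
    [J]. *)
Definition rect (J : {pred I}) : set (set T) :=
  [set C | exists2 A : I -> set R, (forall i, measurable (A i)) &
     C = [set w | forall i, i \in J -> A i (X i w)]].

(* [U] is a measurable function of the variables [X i], [i \in J]. *)
Definition measurable_wrt (J : {pred I}) (U : T -> R) : Prop :=
  measurable_fun (setT : set (g_sigma_algebraType (rect J))) U.

Lemma measurable_forall (J : {pred I}) (A : I -> set R) :
  (forall i, measurable (A i)) ->
  measurable [set w | forall i, i \in J -> A i (X i w)].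
Proof.
move=> mA.
rewrite (_ : [set _ | _] = \bigcap_(i in [set i | i \in J]) (X i @^-1` A i)).
  apply: fin_bigcap_measurable => // i _.
  by rewrite -[X in measurable X]setTI; exact: mX.
by apply/seteqP; split=> w H i => [/H//|Ji]; exact: (H i Ji).
Qed.

Lemma measurable_rect (J : {pred I}) : rect J `<=` measurable.
Proof. by move=> _ [A mA ->]; exact: measurable_forall. Qed.

Lemma measurable_wrtW (J : {pred I}) (U : T -> R) :
  measurable_wrt J U -> measurable_fun setT U.
Proof.
move=> mU _ A mA; have := mU measurableT A mA.
move=> /=; apply: (smallest_sub (@sigma_algebra_measurable _ T)).
exact: measurable_rect.
Qed.

Lemma measurable_wrt_proj (J : {pred I}) i : i \in J -> measurable_wrt J (X i).
Proof.
move=> iJ _ A mA; rewrite setTI; apply: sub_sigma_algebra.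
exists (fun k => if k == i then A else setT); first by move=> k; case: ifP.
apply/seteqP; split=> w /=; first by move=> Aw k kJ; case: eqP => // ->.
by move=> /(_ i iJ); rewrite eqxx.
Qed.

Lemma rect_setI (J : {pred I}) : setI_closed (rect J).
Proof.
move=> _ _ [A mA ->] [B mB ->]; exists (fun i => A i `&` B i).
  by move=> i; exact: measurableI.
apply/seteqP; split=> w /=; first by move=> [H1 H2] i iJ; split; [exact: H1|exact: H2].
by move=> H; split=> i iJ; have [] := H i iJ.
Qed.

Lemma indep_family_rect (J : {pred I}) (i : I) (A : I -> set R) (B : set R) :
  i \notin J -> (forall i, measurable (A i)) -> measurable B ->
  P ([set w | forall k, k \in J -> A k (X k w)] `&` X i @^-1` B) =
  (P [set w | forall k, k \in J -> A k (X k w)] * P (X i @^-1` B))%E.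
Proof.
move=> iJ mA mB.
pose A1 k := if k \in J then A k else if k == i then B else setT.
pose A2 k := if k \in J then A k else setT.
have mA1 k : measurable (A1 k) by rewrite /A1; case: ifP => // _; case: ifP.
have mA2 k : measurable (A2 k) by rewrite /A2; case: ifP.
have -> : [set w | forall k, k \in J -> A k (X k w)] `&` X i @^-1` B =
          [set w | forall k, A1 k (X k w)].
  apply/seteqP; split=> w /=.
    move=> [H1 H2] k; rewrite /A1; case: ifP => kJ; first exact: H1.
    by case: eqP => // ->.
  move=> H; split=> [k kJ|]; first by have := H k; rewrite /A1 kJ.
  by have := H i; rewrite /A1 (negbTE iJ) eqxx.
have -> : [set w | forall k, k \in J -> A k (X k w)] =
          [set w | forall k, A2 k (X k w)].
  apply/seteqP; split=> w /=.
    by move=> H k; rewrite /A2; case: ifP => // kJ; exact: H.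
  by move=> H k kJ; have := H k; rewrite /A2 kJ.
rewrite !indX// (bigD1 i)//= [in RHS](bigD1 i)//= /A1 /A2 (negbTE iJ) eqxx.
rewrite preimage_setT probability_setT mul1e muleC; congr (_ * _)%E.
by apply: eq_bigr => k ki; rewrite (negbTE ki).
Qed.

(** For fixed [B], restricting [P] to the event that [X i] lies in [B] and scaling [P] by the
    probability of that event give two finite measures. They agree on [rect J], hence on the
    sigma-algebra it generates. *)
Lemma indep_family_block (J : {pred I}) (i : I) (U : T -> R) :
  i \notin J -> measurable_wrt J U -> indep2 P U (X i).
Proof.
move=> iJ mU A B mA mB.
have mXB : measurable (X i @^-1` B).
  by rewrite -[X in measurable X]setTI; exact: mX.
pose p : {nonneg R} := NngNum (fine_ge0 (measure_ge0 P (X i @^-1` B))).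
have pE : p%:num%:E = P (X i @^-1` B) by rewrite /= fineK// fin_num_measure.
rewrite muleC -pE.
have mU' : <<s rect J >> (U @^-1` A).
  by have := mU measurableT A mA; rewrite setTI.
pose m1 := [the {measure set T -> \bar R} of mrestr P mXB].
pose m2 := [the {measure set T -> \bar R} of mscale p P].
apply: (@g_sigma_algebra_measure_unique _ _ _ (rect J) _ (fun=> setT) _ _ m1 m2) => //.
- exact: measurable_rect.
- move=> _; exists (fun=> setT) => //.
  by apply/seteqP; split.
- by rewrite bigcup_const.
- exact: rect_setI.
- move=> _ [C mC ->]; rewrite /m1 /m2 /= /mrestr /mscale/= pE muleC.
  exact: indep_family_rect.
- by move=> _; rewrite /m1/= /mrestr setTI (le_lt_trans (probability_le1 _ _))// ltry.
Qed.

End MutualIndependence.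

Section Expectation.
Context d (T : measurableType d) (R : realType) (P : probability T R).

Lemma integrable_bounded (f : T -> R) (M : R) : measurable_fun setT f ->
  (forall w, `|f w| <= M) -> P.-integrable setT (EFin \o f).
Proof.
move=> mf fM; apply: (@le_integrable _ _ _ P setT _ (EFin \o f) (EFin \o cst M)) => //.
- exact/measurable_EFinP.
- by move=> w _ /=; rewrite lee_fin (le_trans (fM w))// ler_norm.
- exact: finite_measure_integrable_cst.
Qed.

Lemma integrable_dominated (f g : T -> R) : measurable_fun setT f ->
  (forall w, `|f w| <= g w) -> P.-integrable setT (EFin \o g) ->
  P.-integrable setT (EFin \o f).
Proof.
move=> mf fg ig; apply: (@le_integrable _ _ _ P setT _ (EFin \o f) (EFin \o g)) => //.
- exact/measurable_EFinP.
- by move=> w _ /=; rewrite lee_fin (le_trans (fg w))// ler_norm.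
Qed.

Lemma integrable_EFin_measurable (f : T -> R) :
  P.-integrable setT (EFin \o f) -> measurable_fun setT f.
Proof. by move=> /measurable_int/measurable_EFinP. Qed.

Lemma integrable_boundedM (f g : T -> R) (M : R) : measurable_fun setT f ->
  (forall w, `|f w| <= M) -> P.-integrable setT (EFin \o g) ->
  P.-integrable setT (EFin \o (fun w => f w * g w)).
Proof.
move=> mf fM ig; apply: (@integrable_dominated _ (fun w => M * `|g w|)).
- by apply: measurable_funM => //; exact: integrable_EFin_measurable.
- by move=> w; rewrite normrM ler_wpM2r.
- apply: (@integrableZl _ _ _ P setT measurableT M (fun w => `|g w|%:E)).
  by have := integrable_abse ig.
Qed.

Lemma integrable_EFinD (f g : T -> R) : P.-integrable setT (EFin \o f) ->
  P.-integrable setT (EFin \o g) -> P.-integrable setT (EFin \o (fun w => f w + g w)).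
Proof. by move=> i1 i2; have := integrableD measurableT i1 i2. Qed.

Lemma integrable_EFinB (f g : T -> R) : P.-integrable setT (EFin \o f) ->
  P.-integrable setT (EFin \o g) -> P.-integrable setT (EFin \o (fun w => f w - g w)).
Proof. by move=> i1 i2; have := integrableB measurableT i1 i2. Qed.

Lemma integrable_EFinZ (f : T -> R) (k : R) : P.-integrable setT (EFin \o f) ->
  P.-integrable setT (EFin \o (fun w => k * f w)).
Proof. by move=> i1; have := integrableZl measurableT k i1. Qed.

Lemma integral_EFin (f : T -> R) : P.-integrable setT (EFin \o f) ->
  (\int[P]_w (f w)%:E)%E = (\int[P]_w f w)%:E.
Proof. by move=> fi; rewrite /Rintegral fineK//; exact: integrable_fin_num. Qed.

Lemma integral_prob1 : (\int[P]_w 1 = 1)%E.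
Proof. by rewrite integral_cst// mul1e; exact: probability_setT. Qed.

Lemma Rintegral_prob_cst (k : R) : \int[P]_w k = k.
Proof.
transitivity (k * fine (P setT)); first exact: Rintegral_cst.
by rewrite probability_setT mulr1.
Qed.

Lemma Rintegral_sum_seq (I : Type) (s : seq I) (f : I -> T -> R) :
  (forall i, P.-integrable setT (EFin \o f i)) ->
  P.-integrable setT (EFin \o (fun w => \sum_(i <- s) f i w)) /\
  \int[P]_w (\sum_(i <- s) f i w) = \sum_(i <- s) \int[P]_w f i w.
Proof.
move=> fi; elim: s => [|i s [IH1 IH2]].
  split; last by under eq_Rintegral do rewrite big_nil; rewrite Rintegral_prob_cst big_nil.
  apply: (@integrable_bounded _ 0) => [|w]; last by rewrite big_nil normr0.
  by apply: measurable_sum => i; exact: integrable_EFin_measurable.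
split.
  rewrite (_ : (fun w => _) = (fun w => f i w + \sum_(j <- s) f j w)).
    exact: integrable_EFinD.
  by apply/funext => w; rewrite big_cons.
by under eq_Rintegral do rewrite big_cons; rewrite RintegralD// IH2 big_cons.
Qed.

Lemma Rintegral_indicator (A : set T) : measurable A ->
  \int[P]_w (\1_A w : R) = fine (P A).
Proof. by move=> mA; rewrite /Rintegral integral_indic// setIT. Qed.

Lemma indep2_ge0_RintegralM (U V : T -> R) :
  P.-integrable setT (EFin \o U) -> P.-integrable setT (EFin \o V) ->
  indep2 P U V -> (forall w, 0 <= U w) -> (forall w, 0 <= V w) ->
  \int[P]_w (U w * V w) = (\int[P]_w U w) * (\int[P]_w V w).
Proof.
move=> iU iV UV U0 V0.
have mU := integrable_EFin_measurable iU; have mV := integrable_EFin_measurable iV.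
apply: EFin_inj; rewrite EFinM -!integral_EFin//; last first.
  apply/integrableP; split; first by apply/measurable_EFinP/measurable_funM.
  under eq_integral do rewrite /= ger0_norm ?mulr_ge0//.
  rewrite indep2_ge0_integralM// !integral_EFin// -EFinM ltry//.
exact: indep2_ge0_integralM.
Qed.

(** Reduced to the nonnegative case: [U + M] is nonnegative because [U] is bounded, and [V] is the
    difference of its positive and negative parts. *)
Lemma indep2_RintegralM (U V : T -> R) (M : R) : measurable_fun setT U ->
  (forall w, `|U w| <= M) -> P.-integrable setT (EFin \o V) -> indep2 P U V ->
  \int[P]_w (U w * V w) = (\int[P]_w U w) * (\int[P]_w V w).
Proof.
move=> mU UM iV UV.
have mV := integrable_EFin_measurable iV.
have iU := integrable_bounded mU UM.
pose U' w := U w + M; pose Vp w := Num.max (V w) 0; pose Vn w := Num.max (- V w) 0.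
have iU' : P.-integrable setT (EFin \o U').
  by apply: integrable_EFinD => //; exact: finite_measure_integrable_cst.
have U'0 w : 0 <= U' w.
  by rewrite /U' -lerBlDr sub0r; have := UM w; rewrite ler_norml => /andP[].
have mVp : measurable_fun setT Vp by apply: measurable_maxr.
have mVn : measurable_fun setT Vn.
  by apply: measurable_maxr => //; apply: measurableT_comp.
have inV : P.-integrable setT (EFin \o (fun w => `|V w|)).
  by have := integrable_abse iV.
have iVp : P.-integrable setT (EFin \o Vp).
  apply: integrable_dominated inV => // w; rewrite /Vp.
  by case: (lerP (V w) 0) => ?; rewrite ?normr0.
have iVn : P.-integrable setT (EFin \o Vn).
  apply: integrable_dominated inV => // w; rewrite /Vn.
  by case: (lerP (- V w) 0) => ?; rewrite ?normr0// normrN.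
have VE w : V w = Vp w - Vn w.
  rewrite /Vp /Vn; case: (lerP (V w) 0) => h; case: (lerP (- V w) 0) => h'; lra.
have mUm : measurable_fun setT (fun x : R => x + M) by exact: measurable_funD.
have mpos : measurable_fun setT (fun x : R => Num.max x 0) by exact: measurable_maxr.
have mneg : measurable_fun setT (fun x : R => Num.max (- x) 0).
  by apply: measurable_maxr => //; exact: measurable_oppr.
have E1 := indep2_ge0_RintegralM iU' iVp (indep2_comp UV mUm mpos) U'0 _.
have E2 := indep2_ge0_RintegralM iU' iVn (indep2_comp UV mUm mneg) U'0 _.
have {}E1 : \int[P]_w (U' w * Vp w) = \int[P]_w U' w * \int[P]_w Vp w.
  by apply: E1 => w; rewrite /Vp le_max lexx orbT.
have {}E2 : \int[P]_w (U' w * Vn w) = \int[P]_w U' w * \int[P]_w Vn w.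
  by apply: E2 => w; rewrite /Vn le_max lexx orbT.
have U'M w : `|U' w| <= M + M.
  by rewrite (le_trans (ler_normD _ _))// lerD// ger0_norm// (le_trans _ (UM w)).
have mU' := integrable_EFin_measurable iU'.
have iUVp := integrable_boundedM mU' U'M iVp.
have iUVn := integrable_boundedM mU' U'M iVn.
have EV : \int[P]_w V w = \int[P]_w Vp w - \int[P]_w Vn w.
  by rewrite -RintegralB//; apply: eq_Rintegral => w _; exact: VE.
have EU : \int[P]_w U' w = \int[P]_w U w + M.
  rewrite /U' RintegralD//; last exact: finite_measure_integrable_cst.
  by rewrite Rintegral_prob_cst.
transitivity (\int[P]_w (U' w * Vp w) - \int[P]_w (U' w * Vn w) - M * \int[P]_w V w).
  rewrite -RintegralB// -RintegralZl// -RintegralB//; last 2 first.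
    exact: integrable_EFinB.
    exact: integrable_EFinZ.
  by apply: eq_Rintegral => w _; rewrite -mulrBr -VE /U'; ring.
by rewrite E1 E2 EU EV; ring.
Qed.

(** Factors are peeled off one at a time; the product of the remaining ones only involves other
    indices, so [indep_family_block] applies. *)
Lemma integral_prod_indep (I : finType) (X : I -> T -> R) (h : I -> R -> R) :
  (forall i, measurable_fun setT (X i)) -> indep_family P X ->
  (forall i, measurable_fun setT (h i)) -> (forall i x, 0 <= h i x) ->
  (\int[P]_w (\prod_i h i (X i w))%:E = \prod_i \int[P]_w (h i (X i w))%:E)%E.
Proof.
move=> mX indX mh h0; 
elim: (index_enum I) (index_enum_uniq I) => [|i s IH] /=.
  move=> _; under eq_integral do rewrite big_nil.
  by rewrite big_nil integral_prob1.
move=> /andP[iNs us]; under eq_integral do rewrite big_cons.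
rewrite big_cons -IH//.
pose U w := \prod_(j <- s) h j (X j w).
have mU : measurable_wrt X (mem s) U.
  apply: measurable_prod => j js; apply: measurableT_comp => //.
  exact: measurable_wrt_proj.
rewrite muleC -(@indep2_ge0_integralM _ _ _ P U (h i \o X i)).
- by apply: eq_integral => w _; rewrite mulrC.
- exact: measurable_wrtW mU.
- exact: measurableT_comp.
- apply: (@indep2_comp _ _ _ P U (X i) id) => //.
  exact: indep_family_block mU.
- by move=> w; apply: prodr_ge0.
- by move=> w; exact: h0.
Qed.

End Expectation.

Section DensityMeasure.
Context d (T : measurableType d) (R : realType) (mu : {measure set T -> \bar R}).
Variable g : T -> R.
Hypothesis mg : measurable_fun setT g.
Hypothesis g_ge0 : forall x, 0 <= g x.

Lemma exists_density_measure : exists nu : {measure set T -> \bar R},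
  forall A, nu A = (\int[mu]_(x in A) (g x)%:E)%E.
Proof.
pose nu A := (\int[mu]_(x in A) (g x)%:E)%E.
have nu0 : nu set0 = 0%E by rewrite /nu integral_set0.
have nu_ge0 A : (0 <= nu A)%E by apply: integral_ge0 => x _; rewrite lee_fin.
have nuU : semi_sigma_additive nu.
  move=> F mF tF mUF; rewrite /nu ge0_integral_bigcup//.
  - by apply: is_cvg_ereal_nneg_natsum_cond => n _ _; exact: nu_ge0.
  - exact/measurable_funTS/measurable_EFinP.
  - by move=> x _; rewrite lee_fin.
pose nu' : {measure set T -> \bar R} := HB.pack nu
  (isMeasure.Build _ _ _ nu nu0 nu_ge0 nuU).
by exists nu'.
Qed.

End DensityMeasure.

Lemma exists_pushforward d d' (T : measurableType d) (T' : measurableType d')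
    (R : realType) (mu : {measure set T -> \bar R}) (f : T -> T') :
  measurable_fun setT f ->
  exists nu : {measure set T' -> \bar R}, (forall A, nu A = mu (f @^-1` A)) /\
    forall h : T' -> \bar R, measurable_fun setT h -> (forall x, 0 <= h x)%E ->
      (\int[nu]_x h x = \int[mu]_w h (f w))%E.
Proof.
move=> mf.
pose f' : {mfun T >-> T'} := HB.pack f (isMeasurableFun.Build _ _ _ _ f mf).
pose nu := [the measure _ _ of pushforward mu f'].
exists (nu mf); split => // h mh h0.
by rewrite /nu/= ge0_integral_pushforward.
Qed.

(** * Taylor bounds *)

Section Calculus.
Context {R : realType}.
Implicit Types (f g : R -> R) (x K : R).

Lemma is_derive_addf x f g df dg : is_derive x 1 f df -> is_derive x 1 g dg ->
  is_derive x 1 (fun y => f y + g y) (df + dg).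
Proof. by move=> hf hg; exact: is_deriveD. Qed.

Lemma is_derive_subf x f g df dg : is_derive x 1 f df -> is_derive x 1 g dg ->
  is_derive x 1 (fun y => f y - g y) (df - dg).
Proof. by move=> hf hg; exact: is_deriveB. Qed.

Lemma is_derive_mulf x f g df dg : is_derive x 1 f df -> is_derive x 1 g dg ->
  is_derive x 1 (fun y => f y * g y) (df * g x + f x * dg).
Proof.
move=> hf hg; have := is_deriveM hf hg.
by rewrite addrC /GRing.scale/= [g x * df]mulrC.
Qed.

Lemma is_derive_cstf x (k : R) : is_derive x 1 (fun=> k) 0.
Proof. exact: is_derive_cst. Qed.

Lemma is_derive_scalef x (k : R) f df : is_derive x 1 f df ->
  is_derive x 1 (fun y => k * f y) (k * df).
Proof.
by move=> hf; have := is_derive_mulf (is_derive_cstf x k) hf; rewrite mul0r add0r.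
Qed.

Lemma is_derive_compf x f g df dg : is_derive x 1 g dg -> is_derive (g x) 1 f df ->
  is_derive x 1 (fun y => f (g y)) (df * dg).
Proof. by move=> hg hf; have := is_derive1_comp hf hg. Qed.

Lemma is_derive_expf x g dg : is_derive x 1 g dg ->
  is_derive x 1 (fun y => expR (g y)) (expR (g x) * dg).
Proof. by move=> hg; apply: (is_derive_compf hg); exact: is_derive_expR. Qed.

Lemma is_derive_lnf x g dg : 0 < g x -> is_derive x 1 g dg ->
  is_derive x 1 (fun y => ln (g y)) ((g x)^-1 * dg).
Proof. by move=> g0 hg; apply: (is_derive_compf hg); exact: is_derive1_ln. Qed.

Lemma is_derive_invf x g dg : g x != 0 -> is_derive x 1 g dg ->
  is_derive x 1 (fun y => (g y)^-1) (- (g x) ^- 2 * dg).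
Proof. by move=> g0 hg; have := is_deriveV g0 hg. Qed.

Lemma is_derive_sum_seq x (I : Type) (s : seq I) (h : I -> R -> R) (dh : I -> R) :
  (forall i, is_derive x 1 (h i) (dh i)) ->
  is_derive x 1 (fun y => \sum_(i <- s) h i y) (\sum_(i <- s) dh i).
Proof.
move=> hd; elim: s => [|i s IH].
  rewrite big_nil (_ : (fun _ => _) = (fun=> 0)); first exact: is_derive_cstf.
  by apply/funext => y; rewrite big_nil.
rewrite big_cons (_ : (fun _ => _) = (fun y => h i y + \sum_(j <- s) h j y)).
  exact: is_derive_addf.
by apply/funext => y; rewrite big_cons.
Qed.

Lemma mvt_le f df x K : (forall s : R, is_derive s 1 f (df s)) ->
  (forall s, `|s| <= `|x| -> `|df s| <= K) -> `|f x - f 0| <= K * `|x|.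
Proof.
move=> hf hK.
have cf : continuous f.
  by move=> s; apply: differentiable_continuous; apply/derivable1_diffP; have [] := hf s.
have [x0|x0|->] := ltgtP x 0; last by rewrite subrr normr0 mulr0.
- have [|c] := MVT_segment (ltW x0) (fun s _ => hf s).
    exact: continuous_subspaceT.
  rewrite in_itv/= => /andP[c1 c2] E.
  rewrite distrC E normrM sub0r normrN ler_wpM2r// hK//.
  by rewrite !ler0_norm// ?lerN2// ltW.
- have [|c] := MVT_segment (ltW x0) (fun s _ => hf s).
    exact: continuous_subspaceT.
  rewrite in_itv/= => /andP[c1 c2] E.
  rewrite E normrM subr0 ler_wpM2r// hK//.
  by rewrite !ger0_norm// ltW.
Qed.

(** The mean value bound is iterated on the remainder; the factorials are lost, which is harmless
    here. The second derivative is controlled only for [|s| <= |x|], since Gibbs weights are stable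
    only near the base point. *)
Lemma taylor2 f f1 f2 x K : (forall s : R, is_derive s 1 f (f1 s)) ->
  (forall s : R, is_derive s 1 f1 (f2 s)) ->
  (forall s, `|s| <= `|x| -> `|f2 s| <= K) ->
  `|f x - f 0 - f1 0 * x| <= K * `|x| ^+ 2.
Proof.
move=> h1 h2 hK.
pose g s := f s - f1 0 * s; pose dg s := f1 s - f1 0.
have hg (s : R) : is_derive s 1 g (dg s).
  rewrite /dg (_ : f1 s - f1 0 = f1 s - f1 0 * 1); last by rewrite mulr1.
  exact: (is_derive_subf (h1 s) (is_derive_scalef _ (is_derive_id s 1))).
have -> : f x - f 0 - f1 0 * x = g x - g 0 by rewrite /g; ring.
rewrite expr2 mulrA; apply: (mvt_le hg) => s sx; rewrite /dg.
apply: (le_trans (mvt_le h2 (fun u us => hK u (le_trans us sx)))).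
by rewrite ler_wpM2l// (le_trans _ (hK 0 _)) ?normr0.
Qed.

Lemma taylor3 f f1 f2 f3 x K : (forall s : R, is_derive s 1 f (f1 s)) ->
  (forall s : R, is_derive s 1 f1 (f2 s)) ->
  (forall s : R, is_derive s 1 f2 (f3 s)) ->
  (forall s, `|s| <= `|x| -> `|f3 s| <= K) ->
  `|f x - f 0 - f1 0 * x - f2 0 / 2 * x ^+ 2| <= K * `|x| ^+ 3.
Proof.
move=> h1 h2 h3 hK.
pose g s := f s - f1 0 * s - f2 0 / 2 * (s * s).
pose dg s := f1 s - f1 0 - f2 0 * s.
have hid (s : R) : is_derive s 1 (fun y : R => y) 1 by exact: is_derive_id.
have hg (s : R) : is_derive s 1 g (dg s).
  rewrite (_ : dg s = f1 s - f1 0 * 1 - f2 0 / 2 * (1 * s + s * 1)); last by rewrite /dg; field.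
  exact: (is_derive_subf (is_derive_subf (h1 s) (is_derive_scalef _ (hid s)))
    (is_derive_scalef _ (is_derive_mulf (hid s) (hid s)))).
have -> : f x - f 0 - f1 0 * x - f2 0 / 2 * x ^+ 2 = g x - g 0 by rewrite /g; ring.
rewrite exprSr mulrA; apply: (mvt_le hg) => s sx; rewrite /dg.
apply: (le_trans (taylor2 h2 h3 (fun u us => hK u (le_trans us sx)))).
by rewrite ler_wpM2l ?lerXn2r ?nnegrE// (le_trans _ (hK 0 _)) ?normr0.
Qed.

Lemma expR_taylor3 (y : R) :
  `|expR y - 1 - y - y ^+ 2 / 2| <= expR `|y| * `|y| ^+ 3.
Proof.
have h (s : R) : is_derive s 1 (@expR R) (expR s) by exact: is_derive_expR.
have := taylor3 h h h (x := y) (K := expR `|y|).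
rewrite expR0 mul1r mul1r [y ^+ 2 / 2]mulrC; apply => s sy.
by rewrite ger0_norm ?expR_ge0// ler_expR (le_trans (ler_norm _) sy).
Qed.

End Calculus.

(** * Soft maxima *)

Section Gibbs.
Context (R : realType) (J : finType).
Implicit Types (w a : J -> R).
Variables (L beta t0 : R).

(* A smooth substitute for the indicator of [max x <= t0]: a logistic function
   of the soft maximum [ln (\sum_j expR (beta * x j)) / beta]. *)
Definition soft_step (x : J -> R) : R :=
  (1 + expR (L * (ln (\sum_j expR (beta * x j)) / beta - t0)))^-1.

(** The mean of [f] under the softmax weights at [x], which is also the derivative of the soft
    maximum in direction [f]. *)
Definition gibbs_mean (x : J -> R) (f : J -> R) : R :=
  (\sum_j f j * expR (beta * x j)) / (\sum_j expR (beta * x j)).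

Hypothesis J0 : (0 < #|J|)%N.
Hypotheses (L0 : 0 < L) (beta0 : 0 < beta) (Lbeta : L <= beta).

Lemma sum_expR_gt0 (x : J -> R) : 0 < \sum_j expR (beta * x j).
Proof.
have [j0 _] : exists j, j \in J by apply/existsP/existsP; move/card_gt0P: J0 => [j]; exists j.
rewrite (bigD1 j0)//= ltr_pwDl ?expR_gt0//.
by apply: sumr_ge0 => j _; exact: expR_ge0.
Qed.

Lemma gibbs_mean_le x f g : (forall j, f j <= g j) -> gibbs_mean x f <= gibbs_mean x g.
Proof.
move=> fg; rewrite /gibbs_mean ler_wpM2r ?invr_ge0 ?(ltW (sum_expR_gt0 _))//.
by apply: ler_sum => j _; rewrite ler_wpM2r ?expR_ge0.
Qed.

Lemma gibbs_mean_cst x (c : R) : gibbs_mean x (fun=> c) = c.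
Proof.
by rewrite /gibbs_mean -mulr_sumr mulfK// gt_eqF// sum_expR_gt0.
Qed.

Lemma gibbs_meanZ x c f : gibbs_mean x (fun j => c * f j) = c * gibbs_mean x f.
Proof.
by rewrite /gibbs_mean mulrA mulr_sumr; congr (_ / _); apply: eq_bigr => j _; rewrite mulrA.
Qed.

Lemma gibbs_meanD x f g : gibbs_mean x (fun j => f j + g j) = gibbs_mean x f + gibbs_mean x g.
Proof.
rewrite /gibbs_mean -mulrDl -big_split/=; congr (_ / _).
by apply: eq_bigr => j _; rewrite mulrDl.
Qed.

Lemma gibbs_mean_sum (I : Type) (s : seq I) x (f : I -> J -> R) :
  gibbs_mean x (fun j => \sum_(i <- s) f i j) = \sum_(i <- s) gibbs_mean x (f i).
Proof.
rewrite /gibbs_mean -mulr_suml; congr (_ / _).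
by rewrite exchange_big; apply: eq_bigr => j _; rewrite mulr_suml.
Qed.

Lemma gibbs_mean_norm x f : `|gibbs_mean x f| <= gibbs_mean x (fun j => `|f j|).
Proof.
rewrite ler_norml -[X in - X]mul1r -mulNr -gibbs_meanZ; apply/andP; split; apply: gibbs_mean_le => j.
  by rewrite mulN1r lerNl -normrN ler_norm.
exact: ler_norm.
Qed.

(** The Gibbs variance of [f] is nonnegative. *)
Lemma gibbs_mean_sqr x f : gibbs_mean x f ^+ 2 <= gibbs_mean x (fun j => f j ^+ 2).
Proof.
pose m := gibbs_mean x f.
have : 0 <= gibbs_mean x (fun j => (f j - m) ^+ 2).
  by rewrite -[leLHS](gibbs_mean_cst x); apply: gibbs_mean_le => j; exact: sqr_ge0.
rewrite (_ : gibbs_mean _ _ = gibbs_mean x (fun j => f j ^+ 2) - m ^+ 2) ?subr_ge0//.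
rewrite (_ : (fun j => _) = (fun j => (f j ^+ 2 + (- 2 * m) * f j) + m ^+ 2)).
  by rewrite !gibbs_meanD gibbs_meanZ gibbs_mean_cst -/m; ring.
by apply/funext => j; ring.
Qed.

(* Moving every coordinate by at most [c] changes the Gibbs weights by a factor
   in [exp (- 2 beta c), exp (2 beta c)]. *)
Lemma gibbs_mean_stable x y f (c : R) : (forall j, `|y j - x j| <= c) ->
  (forall j, 0 <= f j) -> gibbs_mean y f <= expR (2 * beta * c) * gibbs_mean x f.
Proof.
move=> xy f0.
have up j : expR (beta * y j) <= expR (beta * c) * expR (beta * x j).
  rewrite -expRD ler_expR -mulrDr ler_pM2l//.
  by have := xy j; rewrite ler_norml => /andP[_]; lra.
have dn j : expR (- (beta * c)) * expR (beta * x j) <= expR (beta * y j).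
  rewrite -expRD ler_expR -mulrN -mulrDr ler_pM2l//.
  by have := xy j; rewrite ler_norml => /andP[]; lra.
rewrite /gibbs_mean ler_pdivrMr ?sum_expR_gt0//.
have h1 : \sum_j f j * expR (beta * y j) <= expR (beta * c) * \sum_j f j * expR (beta * x j).
  by rewrite mulr_sumr; apply: ler_sum => j _; rewrite mulrCA ler_wpM2l.
have h2 : expR (- (beta * c)) * \sum_j expR (beta * x j) <= \sum_j expR (beta * y j).
  by rewrite mulr_sumr; apply: ler_sum => j _.
apply: (le_trans h1).
have -> : expR (2 * beta * c) = expR (beta * c) * expR (beta * c).
  by rewrite -expRD; congr expR; ring.
rewrite -!mulrA ler_wpM2l ?expR_ge0//.
set S := \sum_j f j * _; set Z := \sum_j expR (beta * x j) in h2 *.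
have Z0 : 0 < Z by exact: sum_expR_gt0.
have S0 : 0 <= S by apply: sumr_ge0 => j _; rewrite mulr_ge0// expR_ge0.
have h3 : Z <= expR (beta * c) * \sum_j expR (beta * y j).
  rewrite -ler_pdivrMl ?expR_gt0// -expRN//.
have -> : expR (beta * c) * (S * (Z^-1 * \sum_j expR (beta * y j))) =
   S * ((expR (beta * c) * \sum_j expR (beta * y j)) / Z) by ring.
by rewrite ler_peMr// ler_pdivlMr// mul1r.
Qed.

(** With [soft_step2], the first two derivatives at 0 of [soft_step] along the line through [w] with
    direction [a]: the logistic function [h] has derivative [- h (1 - h)], and the Gibbs mean of [a]
    varies at rate [beta] times its variance. Closed formulas in [w] can be integrated over a random
    [w]. *)
Definition soft_step1 (w a : J -> R) : R :=
  - L * (gibbs_mean w a * (soft_step w * (1 - soft_step w))).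

Definition soft_step2 (w a : J -> R) : R :=
  - L * (beta * (gibbs_mean w (fun j => a j ^+ 2) - gibbs_mean w a ^+ 2) *
           (soft_step w * (1 - soft_step w)) +
         gibbs_mean w a * (soft_step1 w a * (1 - 2 * soft_step w))).

Section Direction.
Variables (w a : J -> R) (b : R).

(* Along the line [w + s * a], [M k] is the [k]-th Gibbs moment of [a], [V] its
   variance, and [H1], [H2], [H3], [G1], [V1] are derivatives in [s]. *)
Let x (s : R) (j : J) := w j + s * a j.
Let Z (k : nat) (s : R) := \sum_j a j ^+ k * expR (beta * x s j).
Let M (k : nat) (s : R) := Z k s / Z 0 s.
Let H (s : R) := soft_step (x s).
Let G (s : R) := H s * (1 - H s).
Let V (s : R) := M 2 s - M 1 s ^+ 2.
Let H1 (s : R) := - L * (M 1 s * G s).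
Let G1 (s : R) := H1 s * (1 - 2 * H s).
Let V1 (s : R) := beta * (M 3 s - M 2 s * M 1 s) - 2 * M 1 s * (beta * V s).
Let H2 (s : R) := - L * (beta * V s * G s + M 1 s * G1 s).
Let G2 (s : R) := H2 s * (1 - 2 * H s) - 2 * H1 s ^+ 2.
Let H3 (s : R) := - L * (beta * V1 s * G s + beta * V s * G1 s +
  (beta * V s * G1 s + M 1 s * G2 s)).

Lemma Z0E s : Z 0 s = \sum_j expR (beta * x s j).
Proof. by apply: eq_bigr => j _; rewrite expr0 mul1r. Qed.

Lemma ME k s : M k s = gibbs_mean (x s) (fun j => a j ^+ k).
Proof. by rewrite /M Z0E. Qed.

Lemma Z0_gt0 s : 0 < Z 0 s. Proof. by rewrite Z0E sum_expR_gt0. Qed.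

Lemma is_derive_Z k (s : R) : is_derive s 1 (Z k) (beta * Z k.+1 s).
Proof.
rewrite /Z mulr_sumr; apply: is_derive_sum_seq => j.
have h1 := is_derive_addf (is_derive_cstf s (w j))
  (is_derive_mulf (is_derive_id s 1) (is_derive_cstf s (a j))).
have := is_derive_scalef (a j ^+ k) (is_derive_expf (is_derive_scalef beta h1)).
by congr is_derive; rewrite exprS /x; ring.
Qed.

(** Differentiating the Gibbs weights produces a centred factor: the [k]-th moment moves at rate
    [beta] times the covariance of [a ^+ k] and [a]. *)
Lemma is_derive_M k (s : R) : is_derive s 1 (M k) (beta * (M k.+1 s - M k s * M 1 s)).
Proof.
have Z0n : Z 0 s != 0 by rewrite gt_eqF// Z0_gt0.
have := is_derive_mulf (is_derive_Z k s) (is_derive_invf Z0n (is_derive_Z 0 s)).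
by congr is_derive; rewrite /M; field.
Qed.

Lemma is_derive_H (s : R) : is_derive s 1 H (H1 s).
Proof.
pose U s := expR (L * (ln (Z 0 s) / beta - t0)).
have HE u : H u = (1 + U u)^-1 by rewrite /H /soft_step /U Z0E.
have dU : is_derive s 1 U (U s * (L * (M 1 s))).
  have := is_derive_expf (is_derive_scalef L (is_derive_subf (is_derive_mulf
    (is_derive_lnf (Z0_gt0 s) (is_derive_Z 0 s)) (is_derive_cstf s beta^-1)) (is_derive_cstf s t0))).
  congr is_derive; rewrite -/(U s) /M; field.
  by rewrite !gt_eqF// Z0_gt0.
have U0 : 0 < U s by exact: expR_gt0.
have U1 : 1 + U s != 0 by rewrite gt_eqF// addr_gt0.
have -> : H1 s = - (1 + U s) ^- 2 * (0 + U s * (L * M 1 s)).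
  by rewrite /H1 /G HE; field.
rewrite (_ : H = fun u => (1 + U u)^-1); last by apply/funext.
apply: is_derive_invf => //; apply: is_derive_addf => //; exact: is_derive_cstf.
Qed.

Lemma is_derive_G (s : R) : is_derive s 1 G (G1 s).
Proof.
have := is_derive_mulf (is_derive_H s) (is_derive_subf (is_derive_cstf s 1) (is_derive_H s)).
by congr is_derive; rewrite /G1; ring.
Qed.

Lemma is_derive_V (s : R) : is_derive s 1 V (V1 s).
Proof.
have := is_derive_subf (is_derive_M 2 s) (is_derive_mulf (is_derive_M 1 s) (is_derive_M 1 s)).
rewrite (_ : (fun y => M 2 y - M 1 y * M 1 y) = V).
  by congr is_derive; rewrite /V1 /V; ring.
by apply/funext => u; rewrite /V expr2.
Qed.

Lemma is_derive_H1 (s : R) : is_derive s 1 H1 (H2 s).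
Proof.
have := is_derive_scalef (- L) (is_derive_mulf (is_derive_M 1 s) (is_derive_G s)).
by congr is_derive; rewrite /H2 /V; ring.
Qed.

Lemma is_derive_G1 (s : R) : is_derive s 1 G1 (G2 s).
Proof.
have := is_derive_mulf (is_derive_H1 s) (is_derive_subf (is_derive_cstf s 1)
  (is_derive_scalef 2 (is_derive_H s))).
by congr is_derive; rewrite /G2; ring.
Qed.

Lemma is_derive_H2 (s : R) : is_derive s 1 H2 (H3 s).
Proof.
have := is_derive_scalef (- L) (is_derive_addf
  (is_derive_mulf (is_derive_scalef beta (is_derive_V s)) (is_derive_G s))
  (is_derive_mulf (is_derive_M 1 s) (is_derive_G1 s))).
by congr is_derive; rewrite /H3 /V; ring.
Qed.

Hypothesis b0 : 0 < b.
Hypothesis ab : forall j, `|a j| <= b.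

Lemma soft_step_gt0 y : 0 < soft_step y.
Proof. by rewrite invr_gt0 addr_gt0// expR_gt0. Qed.

Lemma soft_step_le1 y : soft_step y <= 1.
Proof. by rewrite invf_le1 ?addr_gt0 ?expR_gt0// lerDl expR_ge0. Qed.

Lemma M1_le s : `|M 1 s| <= b.
Proof.
rewrite ME (le_trans (gibbs_mean_norm _ _))//.
by rewrite -[leRHS](gibbs_mean_cst (x s)); apply: gibbs_mean_le => j; rewrite expr1.
Qed.

Lemma M2_ge s : M 1 s ^+ 2 <= M 2 s.
Proof.
rewrite !ME; apply: (le_trans (gibbs_mean_sqr _ _)).
by apply: gibbs_mean_le => j; rewrite expr1.
Qed.

Lemma M2_le s : M 2 s <= b ^+ 2.
Proof.
rewrite ME -[leRHS](gibbs_mean_cst (x s)); apply: gibbs_mean_le => j.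
by rewrite -(real_normK (num_real (a j))) lerXn2r ?nnegrE// ltW.
Qed.

Lemma M3_le s : `|M 3 s| <= b * M 2 s.
Proof.
rewrite !ME (le_trans (gibbs_mean_norm _ _))// -gibbs_meanZ; apply: gibbs_mean_le => j.
by rewrite normrX exprS -(real_normK (num_real (a j))) ler_wpM2r// exprn_ge0.
Qed.

Lemma norm_mul_le (u v U W : R) : `|u| <= U -> `|v| <= W -> `|u * v| <= U * W.
Proof. by move=> uU vW; rewrite normrM ler_pM. Qed.

Lemma norm_add_le (u v U W : R) : `|u| <= U -> `|v| <= W -> `|u + v| <= U + W.
Proof. by move=> uU vW; rewrite (le_trans (ler_normD _ _))// lerD. Qed.

Lemma G_le s : `|G s| <= 1.
Proof.
have h0 := soft_step_gt0 (x s); have h1 := soft_step_le1 (x s).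
by rewrite /G /H ler_norml; apply/andP; split; nra.
Qed.

Lemma H_le s : `|1 - 2 * H s| <= 1.
Proof.
have h0 := soft_step_gt0 (x s); have h1 := soft_step_le1 (x s).
by rewrite /H ler_norml; apply/andP; split; nra.
Qed.

Lemma M2_ge0 s : 0 <= M 2 s.
Proof. exact: le_trans (sqr_ge0 _) (M2_ge s). Qed.

Lemma V_le s : `|V s| <= M 2 s.
Proof.
have := M2_ge s; have := sqr_ge0 (M 1 s) => h1 h2.
by rewrite /V ler_norml; apply/andP; split; lra.
Qed.

Lemma normL : `|- L| <= L. Proof. by rewrite normrN gtr0_norm. Qed.

Lemma normbeta : `|beta| <= beta. Proof. by rewrite gtr0_norm. Qed.

Lemma H1_le s : `|H1 s| <= L * b.
Proof.
have := norm_mul_le normL (norm_mul_le (M1_le s) (G_le s)).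
by rewrite mulr1.
Qed.

Lemma G1_le s : `|G1 s| <= L * b.
Proof. by have := norm_mul_le (H1_le s) (H_le s); rewrite mulr1. Qed.

(** The squared Gibbs mean is dominated by the second moment; this keeps a factor [M 2 s], where
    squaring [H1_le] would only leave [b ^+ 2]. *)
Lemma H1_sqr_le s : `|H1 s ^+ 2| <= L ^+ 2 * M 2 s.
Proof.
rewrite /H1 exprMn sqrrN normrM (ger0_norm (sqr_ge0 _)) ler_wpM2l ?sqr_ge0//.
rewrite exprMn -[leRHS]mulr1; apply: norm_mul_le.
  by rewrite ger0_norm ?sqr_ge0// M2_ge.
by rewrite normrX exprn_ile1 ?G_le.
Qed.

Lemma H2_le s : `|H2 s| <= 2 * L * beta * M 2 s.
Proof.
have E : M 1 s * G1 s = - L * (M 1 s ^+ 2 * (G s * (1 - 2 * H s))) by rewrite /G1 /H1; ring.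
have h1 : `|M 1 s * G1 s| <= L * (M 2 s * (1 * 1)).
  rewrite E; apply: norm_mul_le normL _; apply: norm_mul_le.
    by rewrite ger0_norm ?sqr_ge0// M2_ge.
  exact: norm_mul_le (G_le s) (H_le s).
have := norm_mul_le normL (norm_add_le (norm_mul_le (norm_mul_le normbeta (V_le s)) (G_le s)) h1).
move=> /le_trans; apply; rewrite !mulr1 -mulrDl mulrA ler_wpM2r ?M2_ge0//.
have : L * L <= L * beta by rewrite ler_pM2l.
lra.
Qed.

(** Every term is linear in [M 2 s], one factor [b] covering the leftover odd moment. Up to the
    common factor [L * b * M 2 s] the terms add up to [4 * beta ^+ 2 + 6 * beta * L], and
    [L <= beta] turns this into the 10. *)
Lemma H3_le s : `|H3 s| <= 10 * L * beta ^+ 2 * b * M 2 s.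
Proof.
have L0' := ltW L0; have b0' := ltW b0; have beta0' := ltW beta0.
have m20 := M2_ge0 s.
have hV1 : `|V1 s| <= 4 * beta * b * M 2 s.
  have M2n : `|M 2 s| <= M 2 s by rewrite ger0_norm.
  have n2 : `|2 : R| <= 2 by rewrite ger0_norm.
  have := norm_add_le (norm_mul_le normbeta (norm_add_le (M3_le s)
     (_ : `|- (M 2 s * M 1 s)| <= M 2 s * b)))
     (_ : `|- (2 * M 1 s * (beta * V s))| <= 2 * b * (beta * M 2 s)).
  rewrite !normrN => /(_ (norm_mul_le M2n (M1_le s))
    (norm_mul_le (norm_mul_le n2 (M1_le s)) (norm_mul_le normbeta (V_le s)))).
  by move=> /le_trans; apply; rewrite le_eqVlt; apply/orP; left; apply/eqP; ring.
have hG2 : `|G2 s| <= 4 * L * beta * M 2 s.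
  have := norm_add_le (norm_mul_le (H2_le s) (H_le s))
    (_ : `|- (2 * H1 s ^+ 2)| <= 2 * (L ^+ 2 * M 2 s)).
  rewrite normrN normrM gtr0_norm// ler_pM2l// => /(_ (H1_sqr_le s)) /le_trans; apply.
  rewrite mulr1 mulrA -mulrDl ler_wpM2r//.
  have : L * L <= L * beta by rewrite ler_pM2l.
  rewrite expr2; lra.
have hb := norm_mul_le (norm_mul_le normbeta (V_le s)) (G1_le s).
have := norm_mul_le normL (norm_add_le (norm_add_le
   (norm_mul_le (norm_mul_le normbeta hV1) (G_le s)) hb)
   (norm_add_le hb (norm_mul_le (M1_le s) hG2))).
move=> /le_trans; apply.
have e0 : 0 <= L * b * M 2 s by apply: mulr_ge0 => //; exact: mulr_ge0.
have e1 : (L * b * M 2 s) * (beta * L) <= (L * b * M 2 s) * (beta * beta).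
  by rewrite ler_wpM2l// ler_pM2l.
have e2 : (L * b * M 2 s) * beta * beta = (L * b * M 2 s) * (beta * beta) by rewrite mulrA.
rewrite (_ : L * _ = 4 * ((L * b * M 2 s) * (beta * beta)) + 6 * ((L * b * M 2 s) * (beta * L))); last by ring.
rewrite (_ : 10 * _ * _ * _ * _ = 10 * ((L * b * M 2 s) * (beta * beta))); last by ring.
lra.
Qed.

Lemma x0E : x 0 = w. Proof. by apply/funext => j; rewrite /x mul0r addr0. Qed.

(** Each of the two regimes uses one of the two error terms; no moment of [xi] beyond the fourth
    will be required. *)
Lemma soft_step_taylor_dir (xi : R) :
  `|H xi - H 0 - H1 0 * xi - H2 0 / 2 * xi ^+ 2| <=
  10 * expR 2 * L * beta ^+ 2 * b * M 2 0 * `|xi| ^+ 3 + 3 * L * beta ^+ 3 * b ^+ 4 * xi ^+ 4.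
Proof.
have L0' := ltW L0; have b0' := ltW b0; have beta0' := ltW beta0.
have bb0 : 0 < beta * b by rewrite mulr_gt0.
have p1 : 0 <= 10 * expR 2 * L * beta ^+ 2 * b * M 2 0 * `|xi| ^+ 3.
  apply: mulr_ge0; last exact: exprn_ge0.
  by apply: mulr_ge0 (M2_ge0 _); rewrite !mulr_ge0 ?expR_ge0 ?exprn_ge0.
have p2 : 0 <= 3 * L * beta ^+ 3 * b ^+ 4 * xi ^+ 4.
  by apply: mulr_ge0; [rewrite !mulr_ge0 ?exprn_ge0|exact: exprn_even_ge0].
have [small|large] := lerP (beta * b * `|xi|) 1.
  apply: (@le_trans _ _ (10 * expR 2 * L * beta ^+ 2 * b * M 2 0 * `|xi| ^+ 3)); last by rewrite lerDl.
  apply: (taylor3 is_derive_H is_derive_H1 is_derive_H2) => s sxi.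
  apply: (le_trans (H3_le s)).
  (* For [|s| <= |xi|] the coordinates move by at most [|s| * b], and [2 * beta * (|s| * b) <= 2],
     so the Gibbs weights change by a factor at most [expR 2]. *)
  have st : M 2 s <= expR 2 * M 2 0.
    rewrite !ME; apply: (@le_trans _ _ (expR (2 * beta * (`|s| * b)) * gibbs_mean (x 0) (fun j => a j ^+ 2))).
      apply: gibbs_mean_stable => [j|j]; last exact: sqr_ge0.
      by rewrite /x mul0r addr0 addrC addKr normrM ler_wpM2l.
    rewrite ler_wpM2r ?ler_expR//; first by rewrite -ME M2_ge0.
    rewrite -mulrA ler_piMr// mulrCA mulrA mulrC (le_trans _ small)// ?mulrA.
    by rewrite mulrC mulrA ler_wpM2l// ltW.
  apply: (@le_trans _ _ (10 * L * beta ^+ 2 * b * (expR 2 * M 2 0))).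
    by rewrite ler_wpM2l// !mulr_ge0 ?exprn_ge0//.
  by rewrite le_eqVlt; apply/orP; left; apply/eqP; ring.
apply: (@le_trans _ _ (3 * L * beta ^+ 3 * b ^+ 4 * xi ^+ 4)); last by rewrite lerDr.
have H2b s : `|H2 s| <= 2 * L * beta * b ^+ 2.
  by rewrite (le_trans (H2_le s))// ler_wpM2l ?M2_le// !mulr_ge0//.
have t2 := taylor2 (x := xi) is_derive_H is_derive_H1 (fun s _ => H2b s).
have t1 : `|- (H2 0 / 2 * xi ^+ 2)| <= L * beta * b ^+ 2 * `|xi| ^+ 2.
  rewrite normrN; have hh : `|2^-1 : R| <= 2^-1 by rewrite gtr0_norm ?invr_gt0.
  have hx : `|xi ^+ 2| <= `|xi| ^+ 2 by rewrite normrX.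
  have := norm_mul_le (norm_mul_le (H2b 0) hh) hx.
  move=> /le_trans; apply; rewrite ler_wpM2r ?exprn_ge0//; lra.
apply: (le_trans (norm_add_le t2 t1)).
rewrite -mulrDl (_ : xi ^+ 4 = `|xi| ^+ 2 * `|xi| ^+ 2); last first.
  by rewrite real_normK ?num_real//; ring.
(* In this regime the crude quadratic bound may be multiplied by [(beta * b * |xi|) ^+ 2 >= 1],
   which makes it a multiple of [xi ^+ 4]. *)
have l2 : 1 <= (beta * b * `|xi|) ^+ 2 by rewrite exprn_ege1// ltW.
apply: (@le_trans _ _ ((3 * L * beta * b ^+ 2 * `|xi| ^+ 2) * (beta * b * `|xi|) ^+ 2)).
  rewrite (_ : 2 * L * beta * b ^+ 2 + _ = 3 * L * beta * b ^+ 2); last by ring.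
  by rewrite ler_peMr// !mulr_ge0 ?exprn_ge0//.
by rewrite le_eqVlt; apply/orP; left; apply/eqP; ring.
Qed.

Lemma M10E : M 1 0 = gibbs_mean w a.
Proof. by rewrite ME x0E; under [X in gibbs_mean w X]eq_fun do rewrite expr1. Qed.

Lemma H10E : H1 0 = soft_step1 w a.
Proof. by rewrite /H1 /G M10E /H x0E. Qed.

Lemma H20E : H2 0 = soft_step2 w a.
Proof. by rewrite /H2 /G1 H10E /G /V M10E ME /H x0E. Qed.

Lemma soft_step_taylor (xi : R) :
  `|soft_step (fun j => w j + xi * a j) - soft_step w - soft_step1 w a * xi
     - soft_step2 w a / 2 * xi ^+ 2| <=
  10 * expR 2 * L * beta ^+ 2 * b * gibbs_mean w (fun j => a j ^+ 2) * `|xi| ^+ 3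
  + 3 * L * beta ^+ 3 * b ^+ 4 * xi ^+ 4.
Proof. by have := soft_step_taylor_dir xi; rewrite ME H10E H20E /H x0E. Qed.

Lemma soft_step1_le : `|soft_step1 w a| <= L * b.
Proof. by rewrite -H10E; exact: H1_le. Qed.

Lemma soft_step2_le : `|soft_step2 w a| <= 2 * L * beta * b ^+ 2.
Proof.
rewrite -H20E (le_trans (H2_le _))// ler_wpM2l ?M2_le// !mulr_ge0// ltW//.
Qed.

End Direction.

(** The factor [expR (- u)] is weakened to [1 - u], so that integrating it over a random [xi] takes
    only a first absolute moment. *)
Lemma gibbs_mean_sqr_stable (w a : J -> R) (b xi : R) : (forall j, `|a j| <= b) ->
  (1 - 2 * beta * b * `|xi|) * gibbs_mean w (fun j => a j ^+ 2) <=
  gibbs_mean (fun j => w j + xi * a j) (fun j => a j ^+ 2).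
Proof.
move=> ab; pose y := fun j => w j + xi * a j; rewrite -/y.
have h1 : gibbs_mean w (fun j => a j ^+ 2) <=
    expR (2 * beta * (b * `|xi|)) * gibbs_mean y (fun j => a j ^+ 2).
  apply: gibbs_mean_stable => j; last exact: sqr_ge0.
  by rewrite /y opprD addrA subrr sub0r normrN normrM mulrC ler_wpM2r.
have h2 : 1 - 2 * beta * b * `|xi| <= expR (- (2 * beta * (b * `|xi|))).
  by apply: le_trans (expR_ge1Dx _); rewrite !mulrA.
have g0 : 0 <= gibbs_mean w (fun j => a j ^+ 2).
  by rewrite -[leLHS](gibbs_mean_cst w); apply: gibbs_mean_le => j; exact: sqr_ge0.
apply: (@le_trans _ _ (expR (- (2 * beta * (b * `|xi|))) * gibbs_mean w (fun j => a j ^+ 2))).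
  by rewrite ler_wpM2r.
by rewrite expRN ler_pdivrMl ?expR_gt0.
Qed.

(** The soft maximum is at least every coordinate, and [1 / (1 + U) <= 1 / U]. *)
Lemma soft_step_small (x : J -> R) (j : J) (delta : R) : t0 + delta <= x j ->
  soft_step x <= expR (- (L * delta)).
Proof.
move=> xj; rewrite expRN lef_pV2 ?posrE ?addr_gt0 ?expR_gt0//.
apply: (@le_trans _ _ (expR (L * (ln (\sum_j0 expR (beta * x j0)) / beta - t0)))); last by rewrite lerDr.
rewrite ler_expR ler_pM2l// lerBrDr addrC (le_trans xj)//.
rewrite ler_pdivlMr// mulrC -[leLHS]expRK ler_ln ?posrE ?expR_gt0 ?sum_expR_gt0//.
rewrite (bigD1 j)//= lerDl; apply: sumr_ge0 => k _; exact: expR_ge0.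
Qed.

(** The soft maximum exceeds the maximum by at most [ln #|J| / beta], and [1 / (1 + U) >= 1 - U]. *)
Lemma soft_step_large (x : J -> R) (u delta : R) : (forall j, x j <= u) ->
  u + ln #|J|%:R / beta <= t0 - delta -> 1 - expR (- (L * delta)) <= soft_step x.
Proof.
move=> xu ut; set U := expR (L * (ln (\sum_j expR (beta * x j)) / beta - t0)).
have Ud : U <= expR (- (L * delta)).
  rewrite ler_expR -mulrN ler_pM2l// lerBlDr addrC (le_trans _ ut)//.
  rewrite ler_pdivrMr// mulrDl divfK ?gt_eqF//.
  have -> : u * beta + ln #|J|%:R = ln (expR (beta * u) * #|J|%:R).
    by rewrite lnM ?posrE ?expR_gt0 ?ltr0n// expRK mulrC.
  rewrite ler_ln ?posrE ?sum_expR_gt0 ?mulr_gt0 ?expR_gt0 ?ltr0n//.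
  rewrite mulr_natr -sumr_const; apply: ler_sum => j _.
  by rewrite ler_expR ler_pM2l.
rewrite /soft_step -/U (@le_trans _ _ (1 - U)) ?lerB//.
have U0 : 0 < U by exact: expR_gt0.
rewrite -div1r ler_pdivlMr ?addr_gt0//.
rewrite mulrDr mulr1 mulrBl mul1r -expr2; have := sqr_ge0 U; lra.
Qed.

End Gibbs.

(** * Gaussian translations and moments *)

Section CameronMartin.
Context (R : realType).

Lemma normal_pdf_shift (s x : R) :
  expR (s * x - s ^+ 2 / 2) * normal_pdf 0 1 x = normal_pdf 0 1 (x - s).
Proof.
rewrite !normal_pdfE//= mulrCA /normal_fun -expRD; congr (_ * expR _).
by rewrite !subr0; field.
Qed.

Context d (T : measurableType d) (Q : probability T R).

Lemma integral_standard_normal (X : {RV Q >-> R}) (f : R -> \bar R) :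
  standard_normal X -> measurable_fun setT f -> (forall x, 0 <= f x)%E ->
  (\int[Q]_w f (X w) = \int[lebesgue_measure]_x (f x * (normal_pdf 0 1 x)%:E))%E.
Proof.
move=> nX mf f0.
have mX : measurable_fun setT (X : T -> measurableTypeR R).
  by have mX := @measurable_funPT _ _ _ _ X; move=> A mA; exact: (mX A mA).
have [nu [nuE nuI]] := exists_pushforward Q mX.
rewrite -nuI//.
apply: (@ge0_integral_density _ (measurableTypeR R) R lebesgue_measure nu) => //.
- exact: measurable_normal_pdf.
- by move=> x; exact: normal_pdf_ge0.
- by move=> A mA; rewrite nuE; exact: nX.
Qed.

(** Completing the square, the exponential weight times the normal density is that density
    translated by [s]; translation invariance of Lebesgue measure does the rest. *)
Lemma standard_normal_shift (X : {RV Q >-> R}) (s : R) (h : R -> \bar R) :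
  standard_normal X -> measurable_fun setT h -> (forall x, 0 <= h x)%E ->
  (\int[Q]_w (h (X w) * (expR (s * X w - s ^+ 2 / 2))%:E) = \int[Q]_w h (X w + s)%R)%E.
Proof.
move=> nX mh h0.
have mS : measurable_fun setT (fun x : R => x + s) by exact: measurable_funD.
have mE : measurable_fun setT (fun x : R => (expR (s * x - s ^+ 2 / 2))%:E).
  apply/measurable_EFinP/measurableT_comp => //; apply: measurable_funB => //.
rewrite (integral_standard_normal (f := fun x => h x * (expR (s * x - s ^+ 2 / 2))%:E)%E nX) //; last 2 first.
- exact: emeasurable_funM.
- by move=> x; rewrite mule_ge0// lee_fin expR_ge0.
rewrite (integral_standard_normal (f := fun x : R => h (x + s)) nX) //; last first.
  exact: measurableT_comp.
pose f x := (h x * (expR (s * x - s ^+ 2 / 2))%:E * (normal_pdf 0 1 x)%:E)%E.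
transitivity (\int[@lebesgue_measure R]_x f (x + s)%R)%E; last first.
  by apply: eq_integral => x _; rewrite /f -muleA -EFinM normal_pdf_shift addrK.
apply/esym/(ge0_integral_translation s (f := f)).
- apply: emeasurable_funM; first exact: emeasurable_funM.
  by apply/measurable_EFinP; exact: measurable_normal_pdf.
- by move=> x; rewrite !mule_ge0// lee_fin ?expR_ge0// normal_pdf_ge0.
Qed.

Variables (n : nat) (e : 'I_n -> {RV Q >-> R}).
Hypothesis inde : indep_family Q e.
Hypothesis norme : forall i, standard_normal (e i).

Definition lin (v : 'I_n -> R) (w : T) : R := \sum_(i < n) v i * e i w.

(** Tuples carry the product sigma-algebra, in which events about the whole Gaussian vector are
    stated. *)
Definition vec (x : 'I_n -> R) : n.-tuple R := [tuple x i | i < n].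

Lemma measurable_vec (x : 'I_n -> T -> R) : (forall i, measurable_fun setT (x i)) ->
  measurable_fun setT (fun w => vec (x^~ w)).
Proof.
move=> mx; apply/measurable_fun_tnthP => i.
by rewrite (_ : _ \o _ = x i)//; apply/funext => w /=; rewrite tnth_mktuple.
Qed.

Lemma measurable_lin v : measurable_fun setT (lin v).
Proof. by apply: measurable_sum => i; exact: measurable_funM. Qed.

Definition boxes : set (set (n.-tuple R)) :=
  [set C | exists2 B : 'I_n -> set R, (forall i, measurable (B i)) &
     C = [set t | forall i, B i (tnth t i)]].

Lemma measurable_boxes : (measurable : set (set (n.-tuple R))) = <<s boxes >>.
Proof.
apply/seteqP; split.
  apply: smallest_sub; first exact: smallest_sigma_algebra.
  move=> A; rewrite -bigcup_seq => -[i _ [B mB <-]].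
  apply: sub_sigma_algebra; exists (fun k => if k == i then B else setT).
    by move=> k; case: ifP.
  apply/seteqP; split=> t /=; first by move=> [_ Bt] k; case: eqP => // ->.
  by move=> /(_ i); rewrite eqxx.
apply: smallest_sub; first exact: sigma_algebra_measurable.
move=> _ [B mB ->].
rewrite (_ : [set _ | _] = \bigcap_(i in setT) ((fun t : n.-tuple R => tnth t i) @^-1` B i)).
  apply: fin_bigcap_measurable => // i _.
  by rewrite -[X in measurable X]setTI; exact: measurable_tnth.
by apply/seteqP; split=> t H i => [_|]; exact: (H i).
Qed.

Lemma boxes_setI : setI_closed boxes.
Proof.
move=> _ _ [A mA ->] [B mB ->]; exists (fun i => A i `&` B i).
  by move=> i; exact: measurableI.
apply/seteqP; split=> w /=; first by move=> [H1 H2] i; split; [exact: H1|exact: H2].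
by move=> H; split=> i; have [] := H i.
Qed.

Lemma expR_lin (v : 'I_n -> R) w : expR (lin v w - (\sum_(i < n) v i ^+ 2) / 2) =
  \prod_(i < n) expR (v i * e i w - v i ^+ 2 / 2).
Proof. by rewrite mulr_suml /lin -sumrB expR_sum. Qed.

(** Both sides integrate [psi] against a measure on tuples: the law of the translated vector, and
    the law of the vector under the weighted probability. On a box each factors over the
    coordinates, where [standard_normal_shift] matches the factors, and boxes form a generating
    pi-system. *)
Lemma cameron_martin (v : 'I_n -> R) (psi : n.-tuple R -> \bar R) :
  measurable_fun setT psi -> (forall t, 0 <= psi t)%E ->
  (\int[Q]_w psi (vec (fun i => e i w + v i)%R) =
   \int[Q]_w (psi (vec (fun i => e i w)) *
      (expR (lin v w - (\sum_(i < n) v i ^+ 2) / 2))%:E))%E.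
Proof.
move=> mpsi psi0.
pose g w := expR (lin v w - (\sum_(i < n) v i ^+ 2) / 2).
have mg : measurable_fun setT g.
  apply: measurableT_comp => //; apply: measurable_funB => //; exact: measurable_lin.
have g0 w : 0 <= g w by exact: expR_ge0.
have [nu nuE] := exists_density_measure Q mg g0.
have mes : measurable_fun setT (fun w => vec (fun i => e i w + v i)).
  by apply: measurable_vec => i; exact: measurable_funD.
have me0 : measurable_fun setT (fun w => vec (fun i => e i w)) by exact: measurable_vec.
have [m1 [m1E m1I]] := exists_pushforward Q mes.
have [m2 [m2E m2I]] := exists_pushforward nu me0.
rewrite -m1I//.
transitivity (\int[m2]_t psi t)%E; last first.
  by rewrite m2I// (@ge0_integral_density _ _ _ Q nu g mg)//; exact: measurableT_comp.
apply: eq_measure_integral => A mA _.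
apply: (measure_unique boxes (fun=> setT)) => //.
- exact: measurable_boxes.
- exact: boxes_setI.
- by move=> _; exists (fun=> setT) => //; apply/seteqP; split.
- by rewrite bigcup_const.
- move=> _ [B mB ->]; rewrite m1E m2E.
  have mB' i : measurable ((fun x : R => x + v i) @^-1` B i).
    have mS : measurable_fun setT (fun x : R => x + v i) by exact: measurable_funD.
    by have := mS measurableT (B i) (mB i); rewrite setTI.
  have -> : (fun w => vec (fun i => e i w + v i)) @^-1` [set t | forall i, B i (tnth t i)] =
      [set w | forall i, ((fun x : R => x + v i) @^-1` B i) (e i w)].
    by apply/seteqP; split => w /= H i; have := H i; rewrite tnth_mktuple.
  transitivity (\prod_i Q (e i @^-1` ((fun x : R => (x + v i)%R) @^-1` B i)))%E.
    exact: inde mB'.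
  rewrite nuE integral_mkcond.
  pose h i (x : R) := \1_(B i) x * expR (v i * x - v i ^+ 2 / 2).
  have mh i : measurable_fun setT (h i).
    apply: measurable_funM => //; apply: measurableT_comp => //.
    by apply: measurable_funB => //; exact: measurable_funM.
  transitivity (\int[Q]_w (\prod_i h i (e i w))%:E)%E; last first.
    apply: eq_integral => w _; rewrite patchE /g expR_lin /h big_split/=.
    case: ifPn => [|].
      rewrite inE/= => H; rewrite big1 ?mul1r// => i _.
      by have := H i; rewrite tnth_mktuple => Bi; rewrite indicE mem_set.
    rewrite notin_setE => /existsNP[i]; rewrite tnth_mktuple => nB.
    by rewrite (bigD1 i)//= indicE memNset// !mul0r.
  rewrite integral_prod_indep//; last first.
    by move=> i x; rewrite mulr_ge0// expR_ge0.
  apply: eq_bigr => i _; rewrite /h.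
  under eq_integral do rewrite EFinM.
  rewrite (@standard_normal_shift _ _ (fun x => (\1_(B i) x)%:E))//; last first.
    by apply/measurable_EFinP; exact: measurable_indic.
  rewrite -[X in Q X]setIT -(integral_indic Q measurableT)//.
  by rewrite -[X in measurable X]setTI; apply: measurable_funPT.
- move=> _; rewrite m1E preimage_setT.
  have QT : (Q setT < +oo)%E by rewrite probability_setT ltry.
  exact: QT.
Qed.

Lemma measurable_vec_preimage (A : set (n.-tuple R)) : measurable A ->
  measurable [set w | A (vec (fun i => e i w))].
Proof.
move=> mA; have me0 : measurable_fun setT (fun w => vec (fun i => e i w)).
  exact: measurable_vec.
by have := me0 measurableT A mA; rewrite setTI.
Qed.

Lemma measurable_vec_preimageD (v : 'I_n -> R) (A : set (n.-tuple R)) : measurable A ->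
  measurable [set w | A (vec (fun i => e i w + v i))].
Proof.
move=> mA; have me0 : measurable_fun setT (fun w => vec (fun i => e i w + v i)).
  by apply: measurable_vec => i; exact: measurable_funD.
by have := me0 measurableT A mA; rewrite setTI.
Qed.

(** On [A] the Cameron-Martin density is at least [expR c]; off [A] the indicator vanishes. *)
Lemma gaussian_shift_lb (v : 'I_n -> R) (A : set (n.-tuple R)) (c : R) :
  measurable A ->
  (forall w, A (vec (fun i => e i w)) ->
     c <= lin v w - (\sum_(i < n) v i ^+ 2) / 2) ->
  (Q [set w | A (vec (fun i => e i w))] * (expR c)%:E <=
   Q [set w | A (vec (fun i => e i w + v i)%R)])%E.
Proof.
move=> mA cA.
have mA0 := measurable_vec_preimage mA; have mAv := measurable_vec_preimageD v mA.
rewrite -[X in (_ <= Q X)%E]setIT -(integral_indic Q measurableT)//.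
have := @cameron_martin v (EFin \o \1_A); rewrite /= => ->; last 2 first.
- by apply/measurable_EFinP; exact: measurable_indic.
- by move=> t; rewrite lee_fin.
rewrite -[X in (Q X * _)%E]setIT -(integral_indic Q measurableT)//.
rewrite -ge0_integralZr//; last first.
  by apply/measurable_EFinP; exact: measurable_indic.
apply: ge0_le_integral => //.
- apply: emeasurable_funM => //; apply/measurable_EFinP; exact: measurable_indic.
- apply: emeasurable_funM; apply/measurable_EFinP.
    by apply: measurableT_comp; [exact: measurable_indic|exact: measurable_vec].
  by apply: measurableT_comp => //; apply: measurable_funB => //; exact: measurable_lin.
- move=> w _; rewrite -!EFinM lee_fin !indicE.
  have [h|h] := pselect (A (vec (fun i => e i w))).
    by rewrite !mem_set// !mul1r ler_expR cA.
  by rewrite !memNset// !mul0r.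
Qed.

Lemma linZ s v w : lin (fun i => s * v i) w = s * lin v w.
Proof. by rewrite mulr_sumr; apply: eq_bigr => i _; rewrite mulrA. Qed.

Variable (a : 'I_n -> R).
Hypothesis a1 : \sum_(i < n) a i ^+ 2 = 1.

(** Since [a] is a unit vector, translating the Gaussian vector by [s * a] translates the form by
    exactly [s]. *)
Lemma lin_shift (s : R) (psi : R -> \bar R) : measurable_fun setT psi ->
  (forall x, 0 <= psi x)%E ->
  (\int[Q]_w psi (lin a w + s)%R =
   \int[Q]_w (psi (lin a w) * (expR (s * lin a w - s ^+ 2 / 2))%:E))%E.
Proof.
move=> mpsi psi0.
pose L (t : n.-tuple R) := \sum_(i < n) a i * tnth t i.
have mL : measurable_fun setT L.
  by apply: measurable_sum => i; apply: measurable_funM => //; exact: measurable_tnth.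
have := @cameron_martin (fun i => s * a i) (psi \o L) (measurableT_comp mpsi mL) _.
move=> /(_ (fun t => psi0 _)); rewrite /= => H.
transitivity (\int[Q]_w psi (L (vec (fun i => e i w + s * a i)%R)))%E.
  apply: eq_integral => w _; congr psi; rewrite /lin /L.
  under [RHS]eq_bigr do rewrite tnth_mktuple mulrDr mulrCA -expr2.
  by rewrite big_split/= -mulr_sumr a1 mulr1.
rewrite H; apply: eq_integral => w _; congr (psi _ * (expR _)%:E)%E.
- by rewrite /lin /L; apply: eq_bigr => i _; rewrite tnth_mktuple.
- rewrite linZ; under [X in _ - X / _ = _]eq_bigr do rewrite exprMn.
  by rewrite -mulr_sumr a1 mulr1.
Qed.

(** The identity [lin_shift] already determines the law. Apply it to the indicator of [B] times the
    normal density and integrate over all shifts [s]: by Tonelli one side is the normal mass of [B],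
    while on the other the translated density integrates to 1 and leaves the probability of [B]. *)
Lemma lin_standard_normal (B : set R) : measurable B ->
  Q (lin a @^-1` B) = normal_prob 0 1 B.
Proof.
move=> mB.
pose psi (x : R) : \bar R := (\1_B x * normal_pdf 0 1 x)%:E.
have mpsi : measurable_fun setT psi.
  apply/measurable_EFinP/measurable_funM; first exact: measurable_indic.
  exact: measurable_normal_pdf.
have psi0 x : (0 <= psi x)%E by rewrite lee_fin mulr_ge0// normal_pdf_ge0.
pose F (z : T * measurableTypeR R) : \bar R := psi (lin a z.1 + z.2).
have mF : measurable_fun setT F.
  apply: measurableT_comp => //; apply: measurable_funD => //.
  by apply: measurableT_comp => //; exact: measurable_lin.
have F0 z : (0 <= F z)%E by exact: psi0.
have := @fubini_tonelli _ _ _ _ R Q (@lebesgue_measure R) F mF F0.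
rewrite /F/=.
have -> : (\int[Q]_x \int[lebesgue_measure]_y psi (lin a x + y)%R = normal_prob 0 1 B)%E.
  under eq_integral do under eq_integral do rewrite addrC.
  under eq_integral do rewrite ge0_integral_translation//.
  rewrite integral_cst//= -[RHS]mule1; congr (_ * _)%E; last exact: probability_setT.
  rewrite /normal_prob [RHS]integral_mkcond/=; apply: eq_integral => x _.
  by rewrite patchE /psi indicE; case: ifP; rewrite ?mul1r ?mul0r.
move=> ->.
under eq_integral do rewrite lin_shift//.
pose G (z : T * measurableTypeR R) : \bar R :=
  (\1_B (lin a z.1) * normal_pdf 0 1 (lin a z.1 - z.2))%:E.
have mG : measurable_fun setT G.
  apply/measurable_EFinP/measurable_funM.
    by apply: measurableT_comp; [exact: measurable_indic|apply: measurableT_comp => //; exact: measurable_lin].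
  apply: measurableT_comp; first exact: measurable_normal_pdf.
  by apply: measurable_funB => //; apply: measurableT_comp => //; exact: measurable_lin.
have G0 z : (0 <= G z)%E by rewrite lee_fin mulr_ge0// normal_pdf_ge0.
transitivity (\int[@lebesgue_measure R]_y \int[Q]_x G (x, y))%E; last first.
  apply: eq_integral => s _; apply: eq_integral => w _.
  by rewrite /G /psi -EFinM -mulrA [normal_pdf _ _ _ * _]mulrC normal_pdf_shift.
rewrite -fubini_tonelli// /G/=.
transitivity (\int[Q]_w (\1_B (lin a w))%:E)%E.
  rewrite -[lin a @^-1` B]setIT -(integral_indic Q measurableT)//.
  by have := measurable_lin a measurableT mB; rewrite setTI.
apply: eq_integral => w _; under eq_integral do rewrite EFinM.
rewrite ge0_integralZl//; last 2 first.
- apply/measurable_EFinP; apply: measurableT_comp; first exact: measurable_normal_pdf.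
  exact: measurable_funB.
- by move=> y _; rewrite lee_fin normal_pdf_ge0.
rewrite -[LHS]mule1; congr (_ * _)%E.
rewrite -(integral_normal_pdf (lin a w) 1); apply: eq_integral => x _; congr EFin.
rewrite !normal_pdfE// /normal_fun; congr (_ * expR _); rewrite subr0.
by rewrite -sqrrN opprB.
Qed.

(** Chernoff bound: [expR (t * x - t ^+ 2)] dominates the indicator of [t < x], and its mean is
    computed by [lin_shift] applied to the constant 1. *)
Lemma lin_tail (t : R) : 0 <= t ->
  (Q [set w | (t < lin a w)%R] <= (expR (- (t ^+ 2 / 2)))%:E)%E.
Proof.
move=> t0.
have mA : measurable [set w | (t < lin a w)%R].
  have := measurable_lin a measurableT (measurable_itv `]t, +oo[%R).
  by rewrite setTI; congr measurable; apply/seteqP; split => w /=; rewrite in_itv/= andbT.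
rewrite -[X in (Q X <= _)%E]setIT -(integral_indic Q measurableT)//.
have H : (\int[Q]_w (expR (t * lin a w - t ^+ 2))%:E = (expR (- (t ^+ 2 / 2)))%:E)%E.
  have := @lin_shift t (fun=> 1%E) (measurable_cst _) (fun=> lee01).
  rewrite integral_prob1 => E.
  transitivity (\int[Q]_w (1 * (expR (t * lin a w - t ^+ 2 / 2))%:E * (expR (- (t ^+ 2 / 2)))%:E))%E.
    apply: eq_integral => w _; rewrite mul1e -EFinM -expRD; congr (expR _)%:E.
    by field.
  rewrite ge0_integralZr//.
  - by rewrite -E mul1e.
  - apply: emeasurable_funM => //; apply/measurable_EFinP/measurableT_comp => //.
    by apply: measurable_funB => //; apply: measurable_funM => //; exact: measurable_lin.
rewrite -H; apply: ge0_le_integral => //.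
- by apply/measurable_EFinP; exact: measurable_indic.
- apply/measurable_EFinP/measurableT_comp => //.
  by apply: measurable_funB => //; apply: measurable_funM => //; exact: measurable_lin.
- move=> w _; rewrite lee_fin indicE; have [h|h] := pselect (t < lin a w).
    rewrite mem_set// -[leLHS]expR0 ler_expR expr2 -mulrBr mulr_ge0// subr_ge0.
    exact: ltW.
  by rewrite memNset// expR_ge0.
Qed.

End CameronMartin.

Section NormalMoments.
Context (R : realType) d (T : measurableType d) (Q : probability T R).
Variable X : {RV Q >-> R}.
Hypothesis nX : standard_normal X.

Lemma normal_mgf (s : R) : Q.-integrable setT (EFin \o (fun w => expR (s * X w))) /\
  \int[Q]_w expR (s * X w) = expR (s ^+ 2 / 2).
Proof.
have H : (\int[Q]_w (expR (s * X w))%:E = (expR (s ^+ 2 / 2))%:E)%E.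
  have := @standard_normal_shift _ _ _ Q X s (fun=> 1%E) nX (measurable_cst _) (fun=> lee01).
  rewrite integral_prob1 => E.
  transitivity (\int[Q]_w (1 * (expR (s * X w - s ^+ 2 / 2))%:E * (expR (s ^+ 2 / 2))%:E))%E.
    by apply: eq_integral => w _; rewrite mul1e -EFinM -expRD subrK.
  rewrite ge0_integralZr//.
  - by rewrite E mul1e.
  - apply: emeasurable_funM => //; apply/measurable_EFinP/measurableT_comp => //.
    by apply: measurable_funB => //; apply: measurable_funM.
split; last by rewrite /Rintegral H.
apply/integrableP; split; first by apply/measurable_EFinP/measurableT_comp => //; exact: measurable_funM.
under eq_integral do rewrite /= ger0_norm ?expR_ge0//.
by rewrite H ltry.
Qed.

Lemma pow_le_expR (k : nat) (x : R) : 0 <= x -> x ^+ k.+1 <= k.+1%:R ^+ k.+1 * expR x.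
Proof.
move=> x0; rewrite -[x in expR x](@divfK _ (k.+1%:R)) ?pnatr_eq0//.
rewrite expRM_natr -exprMn lerXn2r ?nnegrE ?mulr_ge0 ?expR_ge0//.
rewrite -ler_pdivrMl ?ltr0n// mulrC (le_trans _ (expR_ge1Dx _))//.
by rewrite lerDr.
Qed.

Lemma integrable_normal_expabs (k : R) :
  Q.-integrable setT (EFin \o (fun w => expR (k * `|X w|))).
Proof.
have [i1 _] := normal_mgf k; have [i2 _] := normal_mgf (- k).
apply: (integrable_dominated _ _ (integrable_EFinD i1 i2)).
  apply: measurableT_comp => //; apply: measurable_funM => //; exact: measurableT_comp.
move=> w /=; rewrite ger0_norm ?expR_ge0//.
have [h|h] := lerP 0 (X w).
  by rewrite ger0_norm// lerDl expR_ge0.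
by rewrite ltr0_norm// mulrN mulNr lerDr expR_ge0.
Qed.

Lemma integrable_normal_pow (k : nat) : Q.-integrable setT (EFin \o (fun w => X w ^+ k)).
Proof.
case: k => [|k].
  apply: (@integrable_bounded _ _ _ _ _ 1) => [|w]; last by rewrite expr0 normr1.
  exact: measurable_funX.
apply: (integrable_dominated _ _ (integrable_EFinZ (k.+1%:R ^+ k.+1) (integrable_normal_expabs 1))).
  exact: measurable_funX.
by move=> w; rewrite normrX mul1r pow_le_expR.
Qed.

Lemma le0_of_small (x K : R) : (forall s, 0 < s -> s <= 1 -> x <= s * K) -> x <= 0.
Proof.
move=> H; rewrite leNgt; apply/negP => x0.
have K0 : 0 < K by have := H 1 ltr01 (lexx _); rewrite mul1r; exact: lt_le_trans.
have s0 : 0 < x / (2 * K) by rewrite divr_gt0// mulr_gt0.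
have [s1|s1] := lerP (x / (2 * K)) 1.
  have := H _ s0 s1; rewrite (_ : x / (2 * K) * K = x / 2); first lra.
  by field; rewrite gt_eqF.
have := H 1 ltr01 (lexx _); rewrite ltr_pdivlMr ?mulr_gt0// in s1.
by rewrite mul1r in s1 *; lra.
Qed.

(** The moments are read off the generating function: expanding [expR (s * X)] under the integral
    and comparing with [expR (s ^+ 2 / 2)] gives an identity up to O(s^3). Its odd part in [s]
    yields the mean, then the quadratic coefficient yields the variance. *)
Lemma normal_moments : \int[Q]_w X w = 0 /\ \int[Q]_w (X w ^+ 2) = 1.
Proof.
(* The 27 is [3 ^+ 3] from [pow_le_expR]: one factor [expR |X|] bounds the cube, the other the
   exponential in the Taylor remainder. *)
pose K := \int[Q]_w (27 * expR (2 * `|X w|)).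
have iK : Q.-integrable setT (EFin \o (fun w => 27 * expR (2 * `|X w|))).
  by apply: integrable_EFinZ; exact: integrable_normal_expabs.
pose m1 := \int[Q]_w X w; pose m2 := \int[Q]_w (X w ^+ 2).
have i1 : Q.-integrable setT (EFin \o X) by have := integrable_normal_pow 1.
have i2 := integrable_normal_pow 2.
have key (s : R) : `|s| <= 1 -> `|expR (s ^+ 2 / 2) - 1 - s * m1 - s ^+ 2 / 2 * m2| <= `|s| ^+ 3 * K.
  move=> s1; have [ie Es] := normal_mgf s.
  pose r w := expR (s * X w) - 1 - s * X w - s ^+ 2 / 2 * X w ^+ 2.
  have ic : Q.-integrable setT (EFin \o (fun _ : T => 1 : R)).
    exact: finite_measure_integrable_cst.
  have j1 := integrable_EFinB ie ic.
  have j2 := integrable_EFinB j1 (integrable_EFinZ s i1).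
  have j3 := integrable_EFinB j2 (integrable_EFinZ (s ^+ 2 / 2) i2).
  have -> : expR (s ^+ 2 / 2) - 1 - s * m1 - s ^+ 2 / 2 * m2 = \int[Q]_w r w.
    rewrite /r RintegralB//; last exact: integrable_EFinZ.
    rewrite RintegralB//; last exact: integrable_EFinZ.
    rewrite RintegralB// Es Rintegral_prob_cst RintegralZl// RintegralZl//.
  apply: (le_trans (le_normr_Rintegral _ j3)) => //.
  rewrite /K -RintegralZl//; apply: le_Rintegral => //.
  - by have := integrable_abse j3.
  - exact: integrable_EFinZ.
  move=> w _; rewrite (_ : s ^+ 2 / 2 * X w ^+ 2 = (s * X w) ^+ 2 / 2); last by field.
  apply: (le_trans (expR_taylor3 _)).
  rewrite normrM exprMn mulrCA ler_wpM2l ?exprn_ge0//.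
  have XX : `|s| * `|X w| <= `|X w| by rewrite ler_piMl.
  rewrite (_ : 2 * `|X w| = `|X w| + `|X w|); last by ring.
  rewrite expRD [leRHS]mulrCA; apply: ler_pM; rewrite ?expR_ge0 ?exprn_ge0//.
  - by rewrite ler_expR.
  - by have := pow_le_expR 2 (normr_ge0 (X w)); rewrite -natrX.
have K0 : 0 <= K by apply: Rintegral_ge0 => w _; rewrite mulr_ge0// expR_ge0.
(* The extra [1 + expR 1] pays for replacing [expR (s ^+ 2 / 2)] by [1 + s ^+ 2 / 2]. *)
pose K' := K + 1 + expR 1.
have key2 (s : R) : `|s| <= 1 -> `|s * m1 + s ^+ 2 / 2 * (m2 - 1)| <= `|s| ^+ 3 * K'.
  move=> s1; have h1 := key s s1; have s0 := normr_ge0 s.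
  rewrite -(real_normK (num_real s)) in h1 *.
  move: h1 s1 s0; set u := `|s| => h1 s1 s0.
  have u2 : u ^+ 2 / 2 <= 1 by nra.
  have y0 : 0 <= u ^+ 2 / 2 by nra.
  have h2 := expR_taylor3 (u ^+ 2 / 2).
  rewrite (ger0_norm y0) in h2.
  have h3 : expR (u ^+ 2 / 2) * (u ^+ 2 / 2) ^+ 3 <= expR 1 * u ^+ 3.
    apply: ler_pM; rewrite ?expR_ge0 ?exprn_ge0 ?ler_expR//.
    by rewrite lerXn2r ?nnegrE//; nra.
  have h4 : (u ^+ 2 / 2) ^+ 2 / 2 <= u ^+ 3.
    have e1 : u ^+ 4 <= u ^+ 3 by rewrite exprS ler_piMl ?exprn_ge0.
    have e2 : 0 <= u ^+ 3 by rewrite exprn_ge0.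
    by rewrite (_ : (u ^+ 2 / 2) ^+ 2 / 2 = u ^+ 4 / 8); [lra|field].
  have h5 : 0 <= (u ^+ 2 / 2) ^+ 2 / 2 by rewrite divr_ge0// exprn_ge0.
  move: h1 h2; rewrite !ler_norml => /andP[a1 a2] /andP[b1 b2].
  rewrite /K' !mulrDr mulr1 [u ^+ 3 * expR 1]mulrC; apply/andP; split; lra.
have m1E : m1 = 0.
  apply/eqP; rewrite -normr_le0; apply: (@le0_of_small _ K') => s s0 s1.
  have n1 : `|s| <= 1 by rewrite gtr0_norm.
  have := key2 s n1; have := key2 (- s); rewrite normrN => /(_ n1).
  rewrite sqrrN (gtr0_norm s0) !ler_norml => /andP[a1 a2] /andP[b1 b2].
  have c1 : `|s * m1| <= s ^+ 3 * K' by rewrite ler_norml; apply/andP; split; lra.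
  rewrite normrM gtr0_norm// in c1.
  have K'0 : 0 <= K' by rewrite /K' !addr_ge0// expR_ge0.
  have : `|m1| <= s ^+ 2 * K' by rewrite -(ler_pM2l s0) mulrA -exprS.
  rewrite -ler_norml => /le_trans; apply; rewrite ler_wpM2r// expr2 ler_piMl// ltW//.
split=> //.
apply/eqP; rewrite -subr_eq0 -normr_le0; apply: (@le0_of_small _ (2 * K')) => s s0 s1.
have n1 : `|s| <= 1 by rewrite gtr0_norm.
have p0 : 0 < s ^+ 2 / 2 by rewrite divr_gt0 ?exprn_gt0.
have := key2 s n1; rewrite m1E mulr0 add0r (gtr0_norm s0) normrM (gtr0_norm p0).
move=> c1; rewrite -(ler_pM2l p0) (le_trans c1)//.
by rewrite le_eqVlt; apply/orP; left; apply/eqP; field.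
Qed.

End NormalMoments.

(** * Anti-concentration of Gaussian maxima *)

Section AntiConcentration.
Context (R : realType) d (T : measurableType d) (Q : probability T R).
Variables (n : nat) (e : 'I_n -> {RV Q >-> R}).
Hypothesis inde : indep_family Q e.
Hypothesis norme : forall i, standard_normal (e i).
Variables (J : finType) (a : J -> 'I_n -> R).
Hypothesis a1 : forall j, \sum_(i < n) a j i ^+ 2 = 1.

Definition below (t : R) : set T := [set w | forall j, lin e (a j) w <= t].

Lemma measurable_below t : measurable (below t).
Proof.
rewrite (_ : below t = \bigcap_(j in setT) (lin e (a j) @^-1` `]-oo, t])).
  apply: fin_bigcap_measurable => // j _.
  by have := measurable_lin e (a j) measurableT (measurable_itv `]-oo, t]%R); rewrite setTI.
by apply/seteqP; split=> w H j; have := H j; rewrite /= in_itv/=; [move=> h _|move=> h; exact: h].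
Qed.

Definition cdf_max (t : R) : R := fine (Q (below t)).

Lemma cdf_max_ge0 t : 0 <= cdf_max t.
Proof. exact: fine_ge0. Qed.

Lemma cdf_max_le1 t : cdf_max t <= 1.
Proof.
rewrite /cdf_max -lee_fin fineK ?fin_num_measure//; last exact: measurable_below.
by rewrite probability_le1//; exact: measurable_below.
Qed.

Lemma cdf_maxE t : (cdf_max t)%:E = Q (below t).
Proof. by rewrite /cdf_max fineK// fin_num_measure//; exact: measurable_below. Qed.

Lemma cdf_max_le t t' : t <= t' -> cdf_max t <= cdf_max t'.
Proof.
move=> tt'; rewrite -lee_fin !cdf_maxE le_measure ?inE//; try exact: measurable_below.
by move=> w H j; exact: le_trans (H j) tt'.
Qed.

Let linT (j : J) (x : n.-tuple R) := \sum_(i < n) a j i * tnth x i.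

Lemma linT_vec j w : linT j (vec (fun i => e i w)) = lin e (a j) w.
Proof. by apply: eq_bigr => i _; rewrite tnth_mktuple. Qed.

Lemma measurable_linT j : measurable_fun setT (linT j).
Proof.
by apply: measurable_sum => i; apply: measurable_funM => //; exact: measurable_tnth.
Qed.

(* [j] is the first index, for the enumeration of [J], realising the maximum. *)
Definition first_max (x : n.-tuple R) (j : J) : Prop := forall k,
  if (enum_rank k < enum_rank j)%N then linT k x < linT j x else linT k x <= linT j x.

Definition slab (u v : R) (j : J) : set (n.-tuple R) :=
  [set x | first_max x j /\ (u < linT j x <= v)].

Lemma measurable_slab u v j : measurable (slab u v j).
Proof.
rewrite (_ : slab u v j = (linT j @^-1` `]u, v]) `&` \bigcap_(k in setT)
   ((fun x => linT j x - linT k x) @^-1`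
     (if (enum_rank k < enum_rank j)%N then `]0, +oo[%classic else `[0, +oo[%classic))).
  apply: measurableI.
    by have := measurable_linT j measurableT (measurable_itv `]u, v]%R); rewrite setTI.
  apply: fin_bigcap_measurable => // k _.
  have mf := measurable_funB (measurable_linT j) (measurable_linT k).
  rewrite -[X in measurable X]setTI; apply: mf => //.
  by case: ifP => _; exact: measurable_itv.
apply/seteqP; split => x /=.
  move=> [fm uv]; split; first by rewrite in_itv.
  move=> k _; have := fm k => /=; case: ifP => _ /=; rewrite in_itv/= andbT.
    by rewrite subr_gt0.
  by rewrite subr_ge0.
move=> [+ H]; rewrite in_itv/= => uv; split=> // k; have := H k Logic.I => /=.
by case: ifP => _ /=; rewrite in_itv/= andbT ?subr_gt0 ?subr_ge0.
Qed.

Lemma first_max_exists x (j0 : J) : exists j, first_max x j.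
Proof.
pose m := [arg max_(j > j0) linT j x]%O.
have mP k : linT k x <= linT m x by rewrite /m; case: arg_maxP => // i _; exact.
case: (@arg_minnP _ m [pred j | linT j x == linT m x] (fun j => enum_rank j : nat)) => /=.
  by [].
move=> j /eqP jm jmin; exists j => k; case: ifP => kj; last by rewrite jm.
rewrite lt_neqAle jm mP andbT; apply/negP => /jmin.
by rewrite leqNgt kj.
Qed.

Lemma first_max_inj x j k : first_max x j -> first_max x k -> j = k.
Proof.
move=> /(_ k) + /(_ j); case: ltngtP => //.
- by move=> _ h1 h2; have := lt_le_trans h1 h2; rewrite ltxx.
- by move=> _ h1 h2; have := lt_le_trans h2 h1; rewrite ltxx.
- by move=> /val_inj/enum_rank_inj.
Qed.

(** Splitting by the first index that realises the maximum makes the pieces disjoint even when there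
    are ties. *)
Lemma cdf_max_slab u v : u <= v ->
  ((cdf_max v - cdf_max u)%:E =
   \sum_(j \in [set: J]) Q [set w | slab u v j (vec (fun i => e i w))])%E.
Proof.
move=> uv.
rewrite -measure_fin_bigcup//; last 3 first.
- exact: finite_finset.
- move=> j k _ _ [w [/= [h1 _] [h2 _]]]; exact: first_max_inj h1 h2.
- by move=> j _; apply: measurable_vec_preimage; exact: measurable_slab.
have mu := measurable_below u; have mv := measurable_below v.
transitivity (Q (below v `\` below u)).
  rewrite measureD//; last by rewrite (le_lt_trans (probability_le1 _ _))// ltry.
  rewrite setIidr; last by move=> w H j; exact: le_trans (H j) uv.
  by rewrite EFinB !cdf_maxE.
congr (Q _); apply/seteqP; split=> w /=.
  move=> [Hv /existsNP [j0 Hu]].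
  have [j fm] := first_max_exists (vec (fun i => e i w)) j0.
  exists j => //; split=> //; rewrite linT_vec Hv andbT.
  move/negP: Hu; rewrite -ltNge => /lt_le_trans; apply.
  by have := fm j0; rewrite !linT_vec; case: ifP => // _ /ltW.
move=> [j _ [fm]]; rewrite linT_vec => /andP[uj jv]; split.
  move=> k; apply: le_trans jv.
  by have := fm k; rewrite !linT_vec; case: ifP => // _ /ltW.
by move=> H; have := H j; rewrite leNgt uj.
Qed.

(** Expand the squared distance of two unit vectors. Translating along [a j] therefore raises no
    other form more than the [j]-th. *)
Lemma inner_le1 j k : \sum_(i < n) a j i * a k i <= 1.
Proof.
have : 0 <= \sum_(i < n) (a j i - a k i) ^+ 2 by apply: sumr_ge0 => i _; exact: sqr_ge0.
have -> : \sum_(i < n) (a j i - a k i) ^+ 2 =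
    \sum_(i < n) a j i ^+ 2 + \sum_(i < n) a k i ^+ 2 - 2 * \sum_(i < n) a j i * a k i.
  rewrite mulr_sumr -big_split/= -sumrB; apply: eq_bigr => i _; ring.
rewrite !a1; lra.
Qed.

(* Translating by [s * a j] the part of the slab where [j] realises the maximum
   keeps [j] as the maximiser, so the translates stay disjoint. *)
Lemma cdf_max_increment (u v s : R) : u <= v -> 0 <= v -> 0 <= s ->
  (cdf_max v - cdf_max u) * expR (- (s * v + s ^+ 2 / 2)) <=
  cdf_max (v + s) - cdf_max (u + s).
Proof.
move=> uv v0 s0; rewrite -lee_fin EFinM !cdf_max_slab ?lerD2r//.
rewrite ge0_mule_fsuml; last by move=> j; exact: measure_ge0.
apply: lee_fsum; first exact: finite_finset.
move=> j _.
(* The sign is negative because the event is a preimage: when [e + sh] has its [j]-th form between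
   [u] and [v], that of [e] lies between [u + s] and [v + s]. *)
pose sh := fun i => - s * a j i.
have sh2 : \sum_(i < n) sh i ^+ 2 = s ^+ 2.
  under eq_bigr do rewrite exprMn sqrrN.
  by rewrite -mulr_sumr a1 mulr1.
apply: (@le_trans _ _ (Q [set w | slab u v j (vec (fun i => e i w + sh i)%R)])).
  apply: (gaussian_shift_lb inde norme); first exact: measurable_slab.
  move=> w [_]; rewrite linT_vec => /andP[_ jv].
  rewrite sh2 linZ opprD lerD2r mulNr lerN2 ler_wpM2l//.
apply: le_measure; rewrite ?inE.
- by apply: measurable_vec_preimageD; exact: measurable_slab.
- by apply: measurable_vec_preimage; exact: measurable_slab.
have E k w : linT k (vec (fun i => e i w + sh i)) =
    lin e (a k) w - s * \sum_(i < n) a j i * a k i.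
  rewrite /linT mulr_sumr -sumrB; apply: eq_bigr => i _.
  by rewrite tnth_mktuple /sh; ring.
move=> w [fm]; rewrite E; under eq_bigr do rewrite -expr2.
rewrite a1 mulr1 => /andP[h1 h2]; split; last first.
  by rewrite linT_vec -ltrBrDr h1 -lerBlDr.
move=> k; have := fm k; rewrite !E !linT_vec.
under [X in lin e (a j) w - s * X]eq_bigr do rewrite -expr2.
rewrite a1; have := ler_wpM2l s0 (inner_le1 j k).
by case: ifP => _; lra.
Qed.

(** The translates of the window by [k * delta] are adjacent, so their masses telescope to at most
    1. Each shift [s = k * delta] satisfies [s * (t + 1) <= 1], hence [s * t + s ^+ 2 / 2 <= 2]:
    this is the loss [expR 2]. *)
Lemma cdf_max_anti_concentration (t delta : R) (K : nat) : 0 <= t -> 0 < delta ->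
  K%:R * delta * (t + 1) <= 1 ->
  K%:R * (cdf_max t - cdf_max (t - delta)) <= expR 2.
Proof.
move=> t0 d0 Kd.
have h (k : nat) : (k < K)%N -> (cdf_max t - cdf_max (t - delta)) * expR (- 2) <=
    cdf_max (t + k%:R * delta) - cdf_max (t - delta + k%:R * delta).
  move=> kK; have s0 : 0 <= k%:R * delta by rewrite mulr_ge0// ltW.
  apply: le_trans (cdf_max_increment _ t0 s0); last by rewrite lerBlDr lerDl ltW.
  rewrite ler_wpM2l// ?subr_ge0 ?cdf_max_le//; first by rewrite lerBlDr lerDl ltW.
  rewrite ler_expR lerN2.
  have sK : k%:R * delta * (t + 1) <= 1.
    apply: le_trans Kd; rewrite ler_wpM2r ?addr_ge0// ler_wpM2r ?(ltW d0)//.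
    by rewrite ler_nat ltnW.
  by move: (k%:R * delta) s0 sK => s s0 sK; nra.
have : \sum_(k < K) ((cdf_max t - cdf_max (t - delta)) * expR (- 2)) <= 1.
  apply: (@le_trans _ _ (\sum_(k < K) (cdf_max (t + k%:R * delta) - cdf_max (t - delta + k%:R * delta)))).
    by apply: ler_sum => k _; exact: h.
  apply: (@le_trans _ _ (cdf_max (t - delta + K%:R * delta) - cdf_max (t - delta + 0%:R * delta))).
    rewrite -(telescope_sumr (fun k => cdf_max (t - delta + k%:R * delta)))// big_mkord.
    rewrite le_eqVlt; apply/orP; left; apply/eqP; apply: eq_bigr => k _.
    by congr (cdf_max _ - _); rewrite -natr1; ring.
  have := cdf_max_le1 (t - delta + K%:R * delta).
  have := cdf_max_ge0 (t - delta + 0%:R * delta); lra.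
rewrite sumr_const card_ord -[_ *+ K]mulr_natl mulrA expRN => H.
by move: H; rewrite ler_pdivrMr ?expR_gt0// mul1r.
Qed.

(** The common bound [r] is left free because it is used twice: with the exponential tail of
    [lin_tail], and with the exact normal tail at the level [c_0]. *)
Lemma cdf_max_union_bound (t r : R) :
  (forall j, (Q [set w | (t < lin e (a j) w)%R] <= r%:E)%E) ->
  1 - #|J|%:R * r <= cdf_max t.
Proof.
move=> hr.
have mj j : measurable [set w | t < lin e (a j) w].
  have := measurable_lin e (a j) measurableT (measurable_itv `]t, +oo[%R).
  by rewrite setTI; congr measurable; apply/seteqP; split => w /=; rewrite in_itv/= andbT.
have h : (Q (~` below t) <= \sum_(j \in [set: J]) Q [set w | (t < lin e (a j) w)%R])%E.
  apply: content_sub_fsum => //; first exact: finite_finset.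
    by apply: measurableC; exact: measurable_below.
  by move=> w /existsNP [j /negP]; rewrite -ltNge => tj; exists j.
have h2 : (\sum_(j \in [set: J]) Q [set w | (t < lin e (a j) w)%R] <=
           \sum_(j \in [set: J]) r%:E)%E.
  by apply: lee_fsum => //; exact: finite_finset.
have := le_trans h h2; rewrite probability_setC; last exact: measurable_below.
rewrite -cdf_maxE.
rewrite (_ : [set: J] = [set` index_enum J]); last first.
  by apply/seteqP; split=> j //= _; exact: mem_index_enum.
rewrite -fsbig_seq ?index_enum_uniq// sumEFin sumr_const -[_ *+ _]mulr_natl -EFinB lee_fin.
lra.
Qed.

Lemma cdf_max_tail (t : R) : 0 <= t ->
  1 - #|J|%:R * expR (- (t ^+ 2 / 2)) <= cdf_max t.
Proof. by move=> t0; apply: cdf_max_union_bound => j; exact: lin_tail. Qed.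

End AntiConcentration.

(** * Lindeberg exchange *)

Section SoftStepMeasurable.
Context (R : realType) d (T : measurableType d) (J : finType).
Variables (L beta t0 : R) (W : T -> J -> R).
Hypothesis J0 : (0 < #|J|)%N.
Hypothesis mW : forall j, measurable_fun setT (fun w => W w j).

Lemma measurable_fun_sum_expR (f : J -> R) :
  measurable_fun setT (fun w => \sum_j f j * expR (beta * W w j)).
Proof.
apply: measurable_sum => j; apply: measurable_funM => //.
by apply: measurableT_comp => //; exact: measurable_funM.
Qed.

Lemma measurable_fun_inv_gt0 (f : T -> R) : (forall w, 0 < f w) ->
  measurable_fun setT f -> measurable_fun setT (fun w => (f w)^-1).
Proof.
move=> f0 mf; rewrite (_ : (fun w => _) = (fun w => expR (- ln (f w)))).
  apply: measurableT_comp => //; apply: measurableT_comp => //.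
  by apply: measurableT_comp => //; exact: measurable_ln.
by apply/funext => w; rewrite expRN lnK// posrE.
Qed.

Lemma measurable_gibbs_mean (f : J -> R) :
  measurable_fun setT (fun w => gibbs_mean beta (W w) f).
Proof.
apply: measurable_funM; first exact: measurable_fun_sum_expR.
apply: measurable_fun_inv_gt0; first by move=> w; exact: sum_expR_gt0.
have := measurable_fun_sum_expR (fun=> 1).
by congr measurable_fun; apply/funext => w; apply: eq_bigr => j _; rewrite mul1r.
Qed.

Lemma measurable_soft_step : measurable_fun setT (fun w => soft_step L beta t0 (W w)).
Proof.
apply: measurable_fun_inv_gt0; first by move=> w; rewrite addr_gt0// expR_gt0.
apply: measurable_funD => //; apply: measurableT_comp => //; apply: measurable_funM => //.
apply: measurable_funB => //; apply: measurable_funM => //.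
apply: measurableT_comp; first exact: measurable_ln.
have := measurable_fun_sum_expR (fun=> 1).
by congr measurable_fun; apply/funext => w; apply: eq_bigr => j _; rewrite mul1r.
Qed.

Lemma measurable_soft_step1 (f : J -> R) :
  measurable_fun setT (fun w => soft_step1 L beta t0 (W w) f).
Proof.
have h := measurable_soft_step; have g := measurable_gibbs_mean f.
apply: measurable_funM => //; apply: measurable_funM => //; apply: measurable_funM => //.
exact: measurable_funB.
Qed.

Lemma measurable_soft_step2 (f : J -> R) :
  measurable_fun setT (fun w => soft_step2 L beta t0 (W w) f).
Proof.
have h := measurable_soft_step; have g := measurable_gibbs_mean f.
have g2 := measurable_gibbs_mean (fun j => f j ^+ 2).
have h1 := measurable_soft_step1 f.
apply: measurable_funM => //; apply: measurable_funD => //.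
  apply: measurable_funM => //.
    by apply: measurable_funM => //; apply: measurable_funB => //; exact: measurable_funX.
  by apply: measurable_funM => //; exact: measurable_funB.
apply: measurable_funM => //; apply: measurable_funM => //.
by apply: measurable_funB => //; exact: measurable_funM.
Qed.

End SoftStepMeasurable.

(* Exchanging at each step the index with the smallest influence replaces the
   maximum over [J] of the sums of influences, which Lindeberg's fixed order
   would require, by a harmonic sum. *)
Lemma greedy_exchange (R : realType) (n : nat) (phi : {set 'I_n} -> R)
    (psi : 'I_n -> {set 'I_n} -> R) (A D : R) :
  0 <= A ->
  (forall (S : {set 'I_n}) i, i \notin S -> `|phi (i |: S)%SET - phi S| <= A * psi i S + D) ->
  (forall S i, 0 <= psi i S) -> (forall S, \sum_i psi i S <= 1) ->
  forall m (S : {set 'I_n}), #|(~: S)%SET| = m ->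
  `|phi [set: 'I_n]%SET - phi S| <= A * (\sum_(k < m) k.+1%:R^-1) + m%:R * D.
Proof.
move=> A0 step psi0 psi1; elim=> [|m IH] S Sm.
  have -> : S = [set: 'I_n]%SET.
    by apply/setP => i; rewrite inE -[S]finset.setCK inE; have /eqP := Sm; rewrite cards_eq0 => /eqP ->; rewrite inE.
  by rewrite subrr normr0 big_ord0 mulr0 mul0r addr0.
(* Averaging: [m.+1] indices remain and their influences sum to at most 1. *)
have [i iS ipsi] : exists2 i, i \notin S & psi i S <= m.+1%:R^-1.
  apply: contrapT => H.
  have H' i : i \in (~: S)%SET -> m.+1%:R^-1 < psi i S.
    rewrite inE => iS; rewrite ltNge; apply/negP => h; apply: H; by exists i.
  have /card_gt0P[i0 i0S] : (0 < #|(~: S)%SET|)%N by rewrite Sm.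
  have : 1 < \sum_(i in (~: S)%SET) psi i S.
    apply: (@le_lt_trans _ _ (\sum_(i in (~: S)%SET) m.+1%:R^-1)).
      by rewrite sumr_const Sm -[_ *+ _]mulr_natr mulVf// pnatr_eq0.
    rewrite (bigD1 i0)//= [ltRHS](bigD1 i0)//= ltr_leD ?H'//.
    by apply: ler_sum => i /andP[iS _]; exact/ltW/H'.
  rewrite ltNge => /negP; apply; apply: le_trans (psi1 S).
  rewrite [leRHS](bigID (mem (~: S)%SET))/= lerDl.
  by apply: sumr_ge0 => i _; exact: psi0.
have cS : #|(~: (i |: S))%SET| = m.
  have := cardsD1 i (~: S)%SET; rewrite Sm inE iS add1n => -[->].
  by apply: eq_card => k; rewrite !inE negb_or.
rewrite (_ : phi [set: 'I_n]%SET - phi S = (phi [set: 'I_n]%SET - phi (i |: S)%SET) + (phi (i |: S)%SET - phi S)); last by ring.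
apply: (le_trans (ler_normD _ _)).
have h1 := IH _ cS; have h2 := step S i iS.
have h3 := ler_wpM2l A0 ipsi.
have e : m.+1%:R * D = m%:R * D + D by rewrite -natr1 mulrDl mul1r.
rewrite big_ord_recr/= mulrDr e.
move: h1 h2 h3; set u := \sum_(k < m) _; set y := _^-1; move: u y => u y h1 h2 h3; lra.
Qed.

(** [ln (1 - x) <= - x] at [x = 1 / (m + 2)] bounds each new term by a difference of logarithms. *)
Lemma harmonic_le (R : realType) (m : nat) :
  \sum_(k < m.+1) (k.+1%:R : R)^-1 <= 1 + ln (m.+1%:R).
Proof.
elim: m => [|m IH]; first by rewrite big_ord_recr big_ord0/= add0r invr1 ln1 addr0.
rewrite big_ord_recr/=.
have h : (m.+2%:R : R)^-1 <= ln m.+2%:R - ln m.+1%:R.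
  have := @le_ln1Dx R (- (m.+2%:R)^-1).
  rewrite (_ : 1 - m.+2%:R^-1 = m.+1%:R / m.+2%:R); last first.
    have m0 : (m.+1%:R + 1 : R) != 0 by rewrite natr1 pnatr_eq0.
    by rewrite -[m.+2%:R]natr1; field.
  rewrite ln_div ?posrE ?ltr0n// => H.
  have m2 : (m.+2%:R : R)^-1 < 1 by rewrite invf_lt1 ?ltr0n// ltr1n.
  by rewrite ltrN2 in H; have := H m2; rewrite lerNr opprB.
move: IH h; set u := \sum_(k < _) _; set y := _^-1; set l1 := ln _; set l2 := ln _.
by move: u y l1 l2 => u y l1 l2; lra.
Qed.

Section Lindeberg.
Context (R : realType) d (T : measurableType d) (P : probability T R).
Variables (n : nat) (V : 'I_n * bool -> T -> R) (J : finType) (a : 'I_n -> J -> R).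
Variables (L beta t0 b m4 : R).
Hypothesis mV : forall k, measurable_fun setT (V k).
Hypothesis indV : indep_family P V.
Hypothesis iV4 : forall k, P.-integrable setT (EFin \o (fun w => V k w ^+ 4)).
Hypothesis EV1 : forall k, \int[P]_w V k w = 0.
Hypothesis EV2 : forall k, \int[P]_w (V k w ^+ 2) = 1.
Hypothesis EV4 : forall k, \int[P]_w (V k w ^+ 4) <= m4.
Hypothesis J0 : (0 < #|J|)%N.
Hypotheses (L0 : 0 < L) (beta0 : 0 < beta) (Lbeta : L <= beta) (b0 : 0 < b).
Hypothesis ab : forall i j, `|a i j| <= b.
Hypothesis a1 : forall j, \sum_(i < n) a i j ^+ 2 = 1.
Hypothesis m40 : 0 <= m4.
Hypothesis betab : 4 * beta * b <= 1.

Lemma pow_le_1D4 (x : R) (k : nat) : (k <= 4)%N -> `|x| ^+ k <= 1 + x ^+ 4.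
Proof.
move=> k4; have -> : x ^+ 4 = `|x| ^+ 4.
  by rewrite -[in RHS]normrX ger0_norm// exprn_even_ge0.
have [x1|x1] := lerP `|x| 1.
  have h : `|x| ^+ k <= 1 by rewrite exprn_ile1.
  by rewrite (le_trans h)// lerDl exprn_ge0.
by rewrite (le_trans (ler_weXn2l (ltW x1) k4))// lerDr.
Qed.

Lemma integrable_V k (p : nat) : (p <= 4)%N ->
  P.-integrable setT (EFin \o (fun w => `|V k w| ^+ p)).
Proof.
move=> p4; have i1 : P.-integrable setT (EFin \o (fun _ : T => 1 : R)).
  exact: finite_measure_integrable_cst.
apply: (integrable_dominated _ _ (integrable_EFinD i1 (iV4 k))).
  by apply: measurable_funX; apply: measurableT_comp.
by move=> w; rewrite ger0_norm ?exprn_ge0// pow_le_1D4.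
Qed.

Lemma EV_le k (p : nat) : (p <= 4)%N -> \int[P]_w (`|V k w| ^+ p) <= 1 + m4.
Proof.
move=> p4; have i1 : P.-integrable setT (EFin \o (fun _ : T => 1 : R)).
  exact: finite_measure_integrable_cst.
apply: (@le_trans _ _ (\int[P]_w (1 + V k w ^+ 4))).
  apply: le_Rintegral => //; first exact: integrable_V.
    exact: integrable_EFinD.
  by move=> w _; exact: pow_le_1D4.
by rewrite RintegralD// Rintegral_prob_cst lerD2l.
Qed.

(** [|x| <= (1 + x ^+ 2) / 2] and the variance is 1. *)
Lemma EV_abs_le1 k : \int[P]_w `|V k w| <= 1.
Proof.
have i1 : P.-integrable setT (EFin \o (fun _ : T => 2^-1 : R)).
  exact: finite_measure_integrable_cst.
have i2 : P.-integrable setT (EFin \o (fun w => V k w ^+ 2)).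
  by have := @integrable_V k 2 isT; congr integrable; apply/funext => w /=; rewrite real_normK ?num_real.
apply: (@le_trans _ _ (\int[P]_w (2^-1 + 2^-1 * V k w ^+ 2))).
  apply: le_Rintegral => //.
  - by have := @integrable_V k 1 isT.
  - by apply: integrable_EFinD => //; exact: integrable_EFinZ.
  - move=> w _; rewrite -(real_normK (num_real (V k w))).
    have := sqr_ge0 (`|V k w| - 1); rewrite sqrrB; lra.
rewrite RintegralD//; last exact: integrable_EFinZ.
by rewrite RintegralZl// Rintegral_prob_cst EV2; lra.
Qed.

(** The Boolean selects one of two candidate variables at index [k]; the indices in [S] use the
    [true] copy. *)
Definition mixed_sum (S : {set 'I_n}) (w : T) (j : J) : R :=
  \sum_(k < n) a k j * V (k, k \in S) w.

(** Free of both [V (i, true)] and [V (i, false)], hence independent of each, and unchanged when [i]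
    joins [S]. *)
Definition others (i : 'I_n) (S : {set 'I_n}) (w : T) (j : J) : R :=
  \sum_(k < n | k != i) a k j * V (k, k \in S) w.

Lemma mixed_sumE i S w : mixed_sum S w =
  (fun j => others i S w j + V (i, i \in S) w * a i j).
Proof. by apply/funext => j; rewrite /mixed_sum (bigD1 i)//= addrC [a i j * _]mulrC. Qed.

Lemma others_setU1 i S w : others i (i |: S)%SET w = others i S w.
Proof.
apply/funext => j; apply: eq_bigr => k ki.
by rewrite in_setU1 (negbTE ki).
Qed.

Let wrt (i : 'I_n) : {pred 'I_n * bool} := [pred k | k.1 != i].

Lemma measurable_wrt_others i S j : measurable_wrt V (wrt i) (fun w => others i S w j).
Proof.
rewrite /others; under eq_fun do rewrite big_mkcond/=.
apply: (@measurable_sum _ (g_sigma_algebraType (rect V (wrt i))) R setT _ (index_enum _)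
  (fun k w => if k != i then a k j * V (k, k \in S) w else 0)) => k.
have [ki|_] := boolP (k != i); last exact: measurable_cst.
apply: (@measurable_funM _ (g_sigma_algebraType (rect V (wrt i))) R setT (cst (a k j))) => //.
by apply: measurable_wrt_proj; rewrite inE.
Qed.

Lemma measurable_others i S j : measurable_fun setT (fun w => others i S w j).
Proof. exact: (measurable_wrtW mV (@measurable_wrt_others i S j)). Qed.

Lemma indep_others i S (c : bool) (F : (J -> R) -> R) (h : R -> R) :
  measurable_wrt V (wrt i) (fun w => F (others i S w)) -> measurable_fun setT h ->
  indep2 P (fun w => F (others i S w)) (fun w => h (V (i, c) w)).
Proof.
move=> mF mh; apply: (@indep2_comp _ _ _ P _ _ id h) => //.
by apply: indep_family_block mF => //; rewrite inE/= eqxx.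
Qed.

Let ss (w : J -> R) := soft_step L beta t0 w.
Let gm (w : J -> R) (i : 'I_n) := gibbs_mean beta w (fun j => a i j ^+ 2).

Definition phi (S : {set 'I_n}) : R := \int[P]_w ss (mixed_sum S w).
Definition psi (i : 'I_n) (S : {set 'I_n}) : R := \int[P]_w gm (mixed_sum S w) i.

Lemma gm_ge0 x i : 0 <= gm x i.
Proof.
by rewrite -[leLHS](gibbs_mean_cst beta J0 x); apply: gibbs_mean_le => // j; exact: sqr_ge0.
Qed.

Lemma gm_le x i : `|gm x i| <= b ^+ 2.
Proof.
rewrite ger0_norm ?gm_ge0// -[leRHS](gibbs_mean_cst beta J0 x); apply: gibbs_mean_le => // j.
by rewrite -(real_normK (num_real (a i j))) lerXn2r ?nnegrE// ltW.
Qed.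

Lemma ss_le x : `|ss x| <= 1.
Proof. by rewrite gtr0_norm ?soft_step_gt0// soft_step_le1. Qed.

Lemma measurable_mixed_sum S j : measurable_fun setT (fun w => mixed_sum S w j).
Proof. by apply: measurable_sum => k; exact: measurable_funM. Qed.

(** By independence the linear term integrates to 0 and the quadratic one to a quantity that does
    not see [c], both copies having mean 0 and variance 1. The expansions for the two values of [c]
    thus share their main part, and only remainders survive an exchange. *)
Lemma swap_expand i S (c : bool) :
  `|\int[P]_w ss (fun j => others i S w j + V (i, c) w * a i j) -
    \int[P]_w ss (others i S w) -
    \int[P]_w (soft_step2 L beta t0 (others i S w) (a i)) / 2| <=
  10 * expR 2 * L * beta ^+ 2 * b * (1 + m4) * \int[P]_w gm (others i S w) i
  + 3 * L * beta ^+ 3 * b ^+ 4 * (1 + m4).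
Proof.
have mo := @measurable_wrt_others i S.
have mo' := measurable_others i S.
pose U := others i S; pose X := V (i, c).
pose f w := ss (fun j => U w j + X w * a i j).
pose f1 w := soft_step1 L beta t0 (U w) (a i).
pose f2 w := soft_step2 L beta t0 (U w) (a i).
have mf : measurable_fun setT f.
  apply: measurable_soft_step => // j; apply: measurable_funD; first exact: mo'.
  by apply: measurable_funM => //; exact: mV.
have if_ : P.-integrable setT (EFin \o f) by apply: integrable_bounded mf _ => w; exact: ss_le.
have m0 : measurable_fun setT (fun w => ss (U w)) by exact: measurable_soft_step.
have i0 : P.-integrable setT (EFin \o (fun w => ss (U w))).
  by apply: integrable_bounded m0 _ => w; exact: ss_le.
have m1 : measurable_fun setT f1 by exact: measurable_soft_step1.
have m2 : measurable_fun setT f2 by exact: measurable_soft_step2.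
have iX : P.-integrable setT (EFin \o X).
  apply: (integrable_dominated _ _ (@integrable_V (i, c) 1 isT)) => [|w]; first exact: mV.
  by rewrite expr1.
have iX2 : P.-integrable setT (EFin \o (fun w => X w ^+ 2)).
  by have := @integrable_V (i, c) 2 isT; congr integrable; apply/funext => w /=; rewrite real_normK ?num_real.
have f1b w : `|f1 w| <= L * b by exact: soft_step1_le.
have f2b w : `|f2 w| <= 2 * L * beta * b ^+ 2 by exact: soft_step2_le.
have i1 := integrable_boundedM m1 f1b iX.
have i2 := integrable_boundedM m2 f2b iX2.
have E1 : \int[P]_w (f1 w * X w) = 0.
  rewrite (indep2_RintegralM m1 f1b iX) ?EV1 ?mulr0//.
  by apply: (@indep_others i S c (fun x => soft_step1 L beta t0 x (a i)) id) => //;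
    exact: measurable_soft_step1.
have E2 : \int[P]_w (f2 w * X w ^+ 2) = \int[P]_w f2 w.
  rewrite (indep2_RintegralM m2 f2b iX2) ?EV2 ?mulr1//.
  by apply: (@indep_others i S c (fun x => soft_step2 L beta t0 x (a i)) (fun x => x ^+ 2)) => //; exact: measurable_soft_step2.
have if2 := integrable_bounded P m2 f2b.
have mg : measurable_fun setT (fun w => gm (U w) i) by exact: measurable_gibbs_mean.
have iX3 := @integrable_V (i, c) 3 isT.
have ig := integrable_bounded P mg (fun w => gm_le (U w) i).
have ig3 := integrable_boundedM mg (fun w => gm_le (U w) i) iX3.
have E3 : \int[P]_w (gm (U w) i * `|X w| ^+ 3) = (\int[P]_w gm (U w) i) * (\int[P]_w (`|X w| ^+ 3)).
  apply: (indep2_RintegralM mg (fun w => gm_le (U w) i) iX3).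
  apply: (@indep_others i S c (fun x => gm x i) (fun x => `|x| ^+ 3)) => //.
    exact: measurable_gibbs_mean.
  by apply: measurable_funX; exact: normr_measurable.
have j1 := integrable_EFinB (integrable_EFinB if_ i0) i1.
have j2 := integrable_EFinB j1 (integrable_EFinZ 2^-1 i2).
set K1 := 10 * expR 2 * L * beta ^+ 2 * b; set K2 := 3 * L * beta ^+ 3 * b ^+ 4.
have K10 : 0 <= K1 by rewrite !mulr_ge0 ?expR_ge0 ?exprn_ge0// ltW.
have K20 : 0 <= K2 by rewrite !mulr_ge0 ?exprn_ge0// ltW.
have E0 : \int[P]_w (f w - ss (U w)) = \int[P]_w f w - \int[P]_w ss (U w).
  exact: (RintegralB measurableT if_ i0).
have E4 : \int[P]_w (2^-1 * (f2 w * X w ^+ 2)) = 2^-1 * \int[P]_w f2 w.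
  by rewrite -E2; exact: (RintegralZl 2^-1 measurableT i2).
have E5 : \int[P]_w (f w - ss (U w) - f1 w * X w) = \int[P]_w f w - \int[P]_w ss (U w).
  by rewrite -E0 -[RHS]subr0 -[in RHS]E1; exact: (RintegralB measurableT (integrable_EFinB if_ i0) i1).
have E6 : \int[P]_w f w - \int[P]_w ss (U w) - \int[P]_w f2 w / 2 =
   \int[P]_w (f w - ss (U w) - f1 w * X w - 2^-1 * (f2 w * X w ^+ 2)).
  rewrite -E5 [X in _ - X]mulrC -E4; apply/esym.
  exact: (RintegralB measurableT j1 (integrable_EFinZ 2^-1 i2)).
rewrite -/U -/X -/f2 in E6 *; rewrite E6.
apply: (le_trans (le_normr_Rintegral _ j2)) => //.
have k1 := integrable_EFinZ K1 ig3; have k2 := integrable_EFinZ K2 (iV4 (i, c)).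
apply: (@le_trans _ _ (\int[P]_w (K1 * (gm (U w) i * `|X w| ^+ 3) + K2 * X w ^+ 4))).
  apply: le_Rintegral => //.
  - by have := integrable_abse j2.
  - exact: integrable_EFinD.
  move=> w _; have := @soft_step_taylor R J L beta t0 J0 L0 beta0 Lbeta (U w) (a i) b b0 (ab i) (X w).
  by rewrite mulrA [f2 w / 2]mulrC mulrA.
have E7 : \int[P]_w (K1 * (gm (U w) i * `|X w| ^+ 3) + K2 * X w ^+ 4) =
    K1 * ((\int[P]_w gm (U w) i) * (\int[P]_w (`|X w| ^+ 3))) + K2 * \int[P]_w (X w ^+ 4).
  rewrite -E3 -(RintegralZl K1 measurableT ig3) -(RintegralZl K2 measurableT (iV4 (i, c))).
  exact: (RintegralD measurableT k1 k2).
rewrite E7 lerD//.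
  rewrite -mulrA ler_wpM2l// mulrC ler_wpM2r//.
    by apply: Rintegral_ge0 => w _; exact: gm_ge0.
  exact: EV_le.
by rewrite ler_wpM2l// (le_trans (EV4 _))// lerDr.
Qed.

Lemma betab2 : 2 * beta * b <= 2^-1.
Proof. have h := betab; move: beta b h => x y h; lra. Qed.

(** The expansion point depends on [i], while the influences sum to 1 only at the common point
    [mixed_sum S]. Putting the [i]-th term back costs the factor [1 - 2 * beta * b * |V|], of mean
    at least 1/2 because [4 * beta * b <= 1] and the mean of [|V|] is at most 1. *)
Lemma psi_others i S : \int[P]_w gm (others i S w) i <= 2 * psi i S.
Proof.
have mo' := measurable_others i S.
pose c := i \in S; pose X := V (i, c).
have mg : measurable_fun setT (fun w => gm (others i S w) i) by exact: measurable_gibbs_mean.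
have iX : P.-integrable setT (EFin \o (fun w => `|X w|)) := @integrable_V (i, c) 1 isT.
have gb w := gm_le (others i S w) i.
have ig := integrable_bounded P mg gb.
have igX := integrable_boundedM mg gb iX.
have E : \int[P]_w (gm (others i S w) i * `|X w|) =
    (\int[P]_w gm (others i S w) i) * (\int[P]_w (`|X w|)).
  apply: (indep2_RintegralM mg gb iX).
  apply: (@indep_others i S c (fun x => gm x i) (fun x => `|x|)) => //.
    by apply: measurable_gibbs_mean => // j; exact: measurable_wrt_others.
have g0 : 0 <= \int[P]_w gm (others i S w) i by apply: Rintegral_ge0 => w _; exact: gm_ge0.
have h : \int[P]_w (gm (others i S w) i - 2 * beta * b * (gm (others i S w) i * `|X w|)) <= psi i S.
  apply: le_Rintegral => //.
  - by apply: integrable_EFinB => //; exact: integrable_EFinZ.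
  - apply: (@integrable_bounded _ _ _ P _ (b ^+ 2)) => [|w]; last exact: gm_le.
    by apply: measurable_gibbs_mean => // j; exact: measurable_mixed_sum.
  move=> w _; rewrite (mixed_sumE i) -/c -/X.
  have := gibbs_mean_sqr_stable J0 beta0 (others i S w) (X w) (ab i).
  by apply: le_trans; rewrite le_eqVlt; apply/orP; left; apply/eqP; rewrite /gm; ring.
rewrite RintegralB// in h; last exact: integrable_EFinZ.
rewrite RintegralZl// E in h.
have eX : \int[P]_w (`|X w|) <= 1 by have := EV_abs_le1 (i, c).
have eX0 : 0 <= \int[P]_w (`|X w|) by apply: Rintegral_ge0 => w _; exact: normr_ge0.
move: h eX eX0 g0; set g := \int[P]_w gm _ i; set x := \int[P]_w `|_| => h eX eX0 g0.
have : 2 * beta * b * (g * x) <= 2^-1 * g.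
  have h1 : g * x <= g by rewrite ler_piMr.
  have bb : 0 <= 2 * beta * b by rewrite !mulr_ge0// ltW.
  apply: (@le_trans _ _ (2 * beta * b * g)); first by rewrite ler_wpM2l.
  by rewrite ler_wpM2r//; exact: betab2.
lra.
Qed.

Lemma psi_ge0 S i : 0 <= psi i S.
Proof. by apply: Rintegral_ge0 => w _; exact: gm_ge0. Qed.

(** Pointwise, the sum over [i] is the Gibbs mean of the column sums of squares, which are all 1. *)
Lemma sum_psi S : \sum_i psi i S <= 1.
Proof.
have ig i : P.-integrable setT (EFin \o (fun w => gm (mixed_sum S w) i)).
  apply: (@integrable_bounded _ _ _ P _ (b ^+ 2)) => [|w]; last exact: gm_le.
  by apply: measurable_gibbs_mean => // j; exact: measurable_mixed_sum.
rewrite /psi -(Rintegral_sum_seq (index_enum 'I_n) ig).2.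
rewrite (_ : (fun w => _) = (fun=> 1)) ?Rintegral_prob_cst//.
apply/funext => w; rewrite /gm -gibbs_mean_sum -[RHS](gibbs_mean_cst beta J0 (mixed_sum S w)).
by congr (gibbs_mean _ _ _); apply/funext => j; rewrite a1.
Qed.

Lemma common_expansion (x1 x2 x3 x4 x5 y K1 K2 : R) :
  `|x1 - x4 - x3| <= K1 * x5 + K2 -> `|x2 - x4 - x3| <= K1 * x5 + K2 ->
  K1 * x5 <= K1 * (2 * y) -> `|x1 - x2| <= 4 * K1 * y + 2 * K2.
Proof.
rewrite !ler_norml => /andP[z1 z2] /andP[y1 y2] h4.
by apply/andP; split; lra.
Qed.

(** Two expansions around the same point, with [psi_others] applied to the remainders:
    [40 = 2 * 2 * 10] and [6 = 2 * 3]. *)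
Lemma phi_swap (S : {set 'I_n}) i : i \notin S ->
  `|phi (i |: S)%SET - phi S| <=
  (40 * expR 2 * L * beta ^+ 2 * b * (1 + m4)) * psi i S + 6 * L * beta ^+ 3 * b ^+ 4 * (1 + m4).
Proof.
move=> iS.
have h1 := swap_expand i S true; have h2 := swap_expand i S false.
have p1 : phi (i |: S)%SET = \int[P]_w ss (fun j => others i S w j + V (i, true) w * a i j).
  by apply: eq_Rintegral => w _; rewrite (mixed_sumE i) others_setU1 in_setU1 eqxx.
have p2 : phi S = \int[P]_w ss (fun j => others i S w j + V (i, false) w * a i j).
  by apply: eq_Rintegral => w _; rewrite (mixed_sumE i) (negbTE iS).
rewrite p1 p2.
have h3 := psi_others i S.
have m40' : 0 <= 1 + m4 by rewrite addr_ge0.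
have L0' := ltW L0; have beta0' := ltW beta0; have b0' := ltW b0.
have K0 : 0 <= 10 * expR 2 * L * beta ^+ 2 * b * (1 + m4).
  by rewrite !mulr_ge0 ?expR_ge0 ?exprn_ge0.
have h4 := ler_wpM2l K0 h3.
apply: (le_trans (common_expansion h1 h2 h4)).
by rewrite le_eqVlt; apply/orP; left; apply/eqP; ring.
Qed.

Lemma lindeberg :
  `|phi [set: 'I_n]%SET - phi (finset.set0)| <=
  (40 * expR 2 * L * beta ^+ 2 * b * (1 + m4)) * (\sum_(k < n) k.+1%:R^-1) +
  n%:R * (6 * L * beta ^+ 3 * b ^+ 4 * (1 + m4)).
Proof.
apply: (greedy_exchange _ phi_swap psi_ge0 sum_psi).
  by rewrite !mulr_ge0 ?expR_ge0 ?exprn_ge0 ?addr_ge0// ltW.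
by rewrite finset.setC0 cardsT card_ord.
Qed.

End Lindeberg.

(** Meant for the two projections of the product space, whose image measures are [P] and [Q]. *)
Lemma Rintegral_preserving (R : realType) d d' (T : measurableType d)
    (T' : measurableType d') (P : probability T R) (P' : probability T' R)
    (f : T' -> T) (h : T -> R) :
  measurable_fun setT f -> (forall A, measurable A -> P' (f @^-1` A) = P A) ->
  P.-integrable setT (EFin \o h) ->
  P'.-integrable setT (EFin \o (fun x => h (f x))) /\
  \int[P']_x h (f x) = \int[P]_w h w.
Proof.
move=> mf fP ih.
have mh := integrable_EFin_measurable ih.
have [nu [nuE nuI]] := exists_pushforward P' mf.
have E (g : T -> \bar R) : measurable_fun setT g -> (forall x, 0 <= g x)%E ->
    (\int[P']_x g (f x) = \int[P]_w g w)%E.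
  move=> mg g0; rewrite -nuI//; apply: eq_measure_integral => A mA _.
  by rewrite nuE; exact: fP.
have ih' : P'.-integrable setT (EFin \o (fun x => h (f x))).
  apply/integrableP; split; first by apply/measurable_EFinP; exact: measurableT_comp.
  have mn : measurable_fun setT (fun w => `|(h w)%:E|%E).
    by apply: measurableT_comp => //; exact/measurable_EFinP.
  rewrite /= (E (fun w => `|(h w)%:E|%E) mn)//.
  by case/integrableP: ih.
split=> //; rewrite /Rintegral; congr fine.
have iH : P'.-integrable (f @^-1` setT) ((EFin \o h) \o f) by rewrite preimage_setT.
rewrite -[LHS](integral_pushforward mf _ iH)//; last exact/measurable_EFinP.
by apply: eq_measure_integral => A mA _; exact: fP.
Qed.

(** * Coupling on the product space and comparison of the smoothed probabilities *)

Section ProductSpace.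
Context (R : realType) d d' (T : measurableType d) (T' : measurableType d').
Variables (P : probability T R) (Q : probability T' R) (n : nat).
Variables (X : 'I_n -> {RV P >-> R}) (e : 'I_n -> {RV Q >-> R}).
Hypothesis indX : indep_family P X.
Hypothesis inde : indep_family Q e.

Definition product_family (k : 'I_n * bool) (z : T * T') : R :=
  if k.2 then X k.1 z.1 else e k.1 z.2.

Lemma measurable_product_family k : measurable_fun setT (product_family k).
Proof. by case: k => i [|]; apply: measurableT_comp. Qed.

Lemma probability_productX (A : set T) (B : set T') : measurable A -> measurable B ->
  (P \x Q)%E (A `*` B) = (P A * Q B)%E.
Proof. by move=> mA mB; exact: product_measure1E. Qed.

Lemma probability_fst A : measurable A -> (P \x Q)%E (fst @^-1` A) = P A.
Proof.
move=> mA; rewrite (_ : fst @^-1` A = A `*` setT).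
  by rewrite probability_productX// probability_setT mule1.
by apply/seteqP; split => z /=; [move=> ?; split|case].
Qed.

Lemma probability_snd A : measurable A -> (P \x Q)%E (snd @^-1` A) = Q A.
Proof.
move=> mA; rewrite (_ : snd @^-1` A = setT `*` A).
  by rewrite probability_productX// probability_setT mul1e.
by apply/seteqP; split => z /=; [move=> ?; split|case].
Qed.

Lemma indep_product_family : indep_family (P \x Q)%E product_family.
Proof.
move=> A mA.
rewrite (_ : [set z | _] = [set w | forall i, A (i, true) (X i w)] `*`
                          [set w | forall i, A (i, false) (e i w)]); last first.
  apply/seteqP; split => [[w w'] /= H|[w w'] /= [H1 H2] [i [|]]//].
    by split => i; [exact: (H (i, true))|exact: (H (i, false))].
have mX1 : measurable [set w | forall i, A (i, true) (X i w)].
  have := @measurable_forall _ _ R 'I_n X (fun i => measurable_funPT (X i)) predT _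
    (fun i => mA (i, true)).
  by congr measurable; apply/seteqP; split=> w H i => [|_]; exact: H.
have me1 : measurable [set w | forall i, A (i, false) (e i w)].
  have := @measurable_forall _ _ R 'I_n e (fun i => measurable_funPT (e i)) predT _
    (fun i => mA (i, false)).
  by congr measurable; apply/seteqP; split=> w H i => [|_]; exact: H.
rewrite [LHS](probability_productX mX1 me1).
have mXi i c : measurable (X i @^-1` A (i, c)).
  by rewrite -[X in measurable X]setTI; apply: measurable_funPT => //; exact: mA.
have mei i c : measurable (e i @^-1` A (i, c)).
  by rewrite -[X in measurable X]setTI; apply: measurable_funPT => //; exact: mA.
transitivity ((\prod_i P (X i @^-1` A (i, true))) * (\prod_i Q (e i @^-1` A (i, false))))%E.
  congr (_ * _)%E; first exact: (indX (fun i => mA (i, true))).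
  exact: (inde (fun i => mA (i, false))).
rewrite -big_split/=.
transitivity (\prod_i \prod_(c : bool) (P \x Q)%E (product_family (i, c) @^-1` A (i, c)))%E.
  apply: eq_bigr => i _; rewrite big_bool; congr (_ * _)%E.
    by rewrite -probability_fst.
  by rewrite -probability_snd.
rewrite pair_bigA/=; apply: eq_bigr => -[i c] _ //.
Qed.

Variables (J : finType) (a : J -> 'I_n -> R) (L beta t0 b m4 : R).
Hypothesis iX4 : forall i, P.-integrable setT (EFin \o (fun w => X i w ^+ 4)).
Hypothesis EX1 : forall i, \int[P]_w X i w = 0.
Hypothesis EX2 : forall i, \int[P]_w (X i w ^+ 2) = 1.
Hypothesis EX4 : forall i, \int[P]_w (X i w ^+ 4) <= m4.
Hypothesis norme : forall i, standard_normal (e i).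
Hypothesis Ee4 : forall i, \int[Q]_w (e i w ^+ 4) <= m4.
Hypothesis J0 : (0 < #|J|)%N.
Hypotheses (L0 : 0 < L) (beta0 : 0 < beta) (Lbeta : L <= beta) (b0 : 0 < b).
Hypothesis ab : forall j i, `|a j i| <= b.
Hypothesis a1 : forall j, \sum_(i < n) a j i ^+ 2 = 1.
Hypothesis m40 : 0 <= m4.
Hypothesis betab : 4 * beta * b <= 1.

Lemma integrable_soft_step d0 (T0 : measurableType d0) (P0 : probability T0 R)
    (W : T0 -> J -> R) : (forall j, measurable_fun setT (fun w => W w j)) ->
  P0.-integrable setT (EFin \o (fun w => soft_step L beta t0 (W w))).
Proof.
move=> mW; apply: (@integrable_bounded _ _ _ P0 _ 1) => [|w].
  exact: measurable_soft_step.
by rewrite gtr0_norm ?soft_step_gt0// soft_step_le1.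
Qed.

Lemma integrable_pow_le4 i (k : nat) : (k <= 4)%N ->
  P.-integrable setT (EFin \o (fun w => X i w ^+ k)).
Proof.
move=> k4; have i1 : P.-integrable setT (EFin \o (fun _ : T => 1 : R)).
  exact: finite_measure_integrable_cst.
apply: (integrable_dominated _ _ (integrable_EFinD i1 (iX4 i))); first exact: measurable_funX.
by move=> w; rewrite normrX pow_le_1D4.
Qed.

Lemma lindeberg_two_spaces :
  `|\int[P]_w soft_step L beta t0 (fun j => lin X (a j) w) -
    \int[Q]_w soft_step L beta t0 (fun j => lin e (a j) w)| <=
  (40 * expR 2 * L * beta ^+ 2 * b * (1 + m4)) * (\sum_(k < n) k.+1%:R^-1) +
  n%:R * (6 * L * beta ^+ 3 * b ^+ 4 * (1 + m4)).
Proof.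
pose PQ : probability (T * T')%type R := (P \x Q)%E.
have tfst (h : T -> R) : P.-integrable setT (EFin \o h) ->
    PQ.-integrable setT (EFin \o (fun x => h x.1)) /\ \int[PQ]_x h x.1 = \int[P]_w h w.
  by apply: Rintegral_preserving => // A mA; exact: probability_fst.
have tsnd (h : T' -> R) : Q.-integrable setT (EFin \o h) ->
    PQ.-integrable setT (EFin \o (fun x => h x.2)) /\ \int[PQ]_x h x.2 = \int[Q]_w h w.
  by apply: Rintegral_preserving => // A mA; exact: probability_snd.
have ie (k : nat) i : Q.-integrable setT (EFin \o (fun w => e i w ^+ k)).
  exact: integrable_normal_pow.
have iX := integrable_pow_le4.
have iss0 := @integrable_soft_step _ _ P _ (fun j => measurable_lin X (a j)).
have iss1 := @integrable_soft_step _ _ Q _ (fun j => measurable_lin e (a j)).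
rewrite -(tfst _ iss0).2 -(tsnd _ iss1).2.
have := @lindeberg _ _ _ PQ n product_family J (fun i j => a j i) L beta t0 b m4.
have -> : phi PQ product_family (fun i j => a j i) L beta t0 [set: 'I_n]%SET =
    \int[PQ]_x soft_step L beta t0 (fun j => lin X (a j) x.1).
  apply: eq_Rintegral => x _; congr soft_step; apply/funext => j.
  by apply: eq_bigr => k _; rewrite finset.in_setT.
have -> : phi PQ product_family (fun i j => a j i) L beta t0 finset.set0 =
    \int[PQ]_x soft_step L beta t0 (fun j => lin e (a j) x.2).
  apply: eq_Rintegral => x _; congr soft_step; apply/funext => j.
  by apply: eq_bigr => k _; rewrite finset.in_set0.
apply => //.
- exact: measurable_product_family.
- exact: indep_product_family.
- by case=> i [|]; [exact: (tfst _ (iX i 4%N isT)).1|exact: (tsnd _ (ie 4%N i)).1].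
- case=> i [|]; first by rewrite (tfst (X i) (iX i 1%N isT)).2.
  by rewrite (tsnd (e i) (ie 1%N i)).2 (normal_moments (norme i)).1.
- case=> i [|]; first by rewrite (tfst (fun w => X i w ^+ 2) (iX i 2%N isT)).2.
  by rewrite (tsnd (fun w => e i w ^+ 2) (ie 2%N i)).2 (normal_moments (norme i)).2.
- case=> i [|]; first by rewrite (tfst (fun w => X i w ^+ 4) (iX i 4%N isT)).2.
  by rewrite (tsnd (fun w => e i w ^+ 4) (ie 4%N i)).2.
Qed.

(* One third of the window [t - 3 * delta, t] absorbs the bias [ln #|J| / beta] of
   the soft maximum, and the other two thirds the logistic tails around [t0]. *)
Lemma kolmogorov_soft (t delta : R) : 0 < delta -> ln #|J|%:R <= beta * delta ->
  t0 = t - delta ->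
  cdf_max e a (t - 3 * delta) - 2 * expR (- (L * delta)) -
  ((40 * expR 2 * L * beta ^+ 2 * b * (1 + m4)) * (\sum_(k < n) k.+1%:R^-1) +
   n%:R * (6 * L * beta ^+ 3 * b ^+ 4 * (1 + m4))) <= cdf_max X a t.
Proof.
move=> d0 lnJ t0E.
have iss0 := @integrable_soft_step _ _ P _ (fun j => measurable_lin X (a j)).
have iss1 := @integrable_soft_step _ _ Q _ (fun j => measurable_lin e (a j)).
set E := expR (- (L * delta)).
have E0 : 0 < E by exact: expR_gt0.
have E1 : E <= 1 by rewrite -expR0 ler_expR oppr_le0 mulr_ge0// ltW.
have mP := measurable_below X a t.
have mQ := measurable_below e a (t - 3 * delta).
have iP : P.-integrable setT (EFin \o (fun w => \1_(below X a t) w + E)).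
  apply: integrable_EFinD; last exact: finite_measure_integrable_cst.
  by apply: (@integrable_bounded _ _ _ P _ 1) => [|w];
    [exact: measurable_indic|rewrite ger0_norm ?indic_ge0// indic_le1].
have iQ : Q.-integrable setT (EFin \o (fun w => \1_(below e a (t - 3 * delta)) w - E)).
  apply: integrable_EFinB; last exact: finite_measure_integrable_cst.
  by apply: (@integrable_bounded _ _ _ Q _ 1) => [|w];
    [exact: measurable_indic|rewrite ger0_norm ?indic_ge0// indic_le1].
have h1 : \int[P]_w soft_step L beta t0 (fun j => lin X (a j) w) <= cdf_max X a t + E.
  have <- : \int[P]_w (\1_(below X a t) w + E) = cdf_max X a t + E.
    rewrite RintegralD//.
    - by rewrite Rintegral_indicator// Rintegral_prob_cst.
    - by apply: (@integrable_bounded _ _ _ P _ 1) => [|w];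
        [exact: measurable_indic|rewrite ger0_norm ?indic_ge0// indic_le1].
    - exact: finite_measure_integrable_cst.
  apply: (le_Rintegral measurableT iss0 iP) => w _; rewrite /= indicE.
  have [wt|] := boolP (w \in below X a t).
    by rewrite (le_trans (soft_step_le1 _ _ _ _))// lerDl ltW.
  rewrite notin_setE => /existsNP [j /negP]; rewrite -ltNge add0r => jt.
  by apply: (@soft_step_small _ _ _ _ _ J0 L0 beta0 _ j); rewrite t0E subrK; exact: ltW jt.
have h2 : cdf_max e a (t - 3 * delta) - E <= \int[Q]_w soft_step L beta t0 (fun j => lin e (a j) w).
  have <- : \int[Q]_w (\1_(below e a (t - 3 * delta)) w - E) = cdf_max e a (t - 3 * delta) - E.
    rewrite RintegralB//.
    - by rewrite Rintegral_indicator// Rintegral_prob_cst.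
    - by apply: (@integrable_bounded _ _ _ Q _ 1) => [|w];
        [exact: measurable_indic|rewrite ger0_norm ?indic_ge0// indic_le1].
    - exact: finite_measure_integrable_cst.
  apply: (le_Rintegral measurableT iQ iss1) => w _; rewrite /= indicE.
  have [wt|_] := boolP (w \in below e a (t - 3 * delta)); last first.
    by rewrite (@le_trans _ _ 0) ?ltW ?soft_step_gt0// add0r oppr_lt0.
  rewrite inE in wt.
  apply: (@soft_step_large _ _ _ _ _ J0 L0 beta0 _ (t - 3 * delta)) => //.
  have : ln #|J|%:R / beta <= delta by rewrite ler_pdivrMr// mulrC.
  by rewrite t0E; move: (ln _ / _) => x; lra.
have := lindeberg_two_spaces; rewrite ler_norml => /andP[+ _].
by move: h1 h2; rewrite /E; lra.
Qed.
End ProductSpace.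

(** * Comparison of maxima *)

Section Comparison.
Context (R : realType) d d' (T : measurableType d) (T' : measurableType d').
Variables (P : probability T R) (Q : probability T' R) (n : nat).
Variables (X : 'I_n -> {RV P >-> R}) (e : 'I_n -> {RV Q >-> R}).
Hypothesis indX : indep_family P X.
Hypothesis inde : indep_family Q e.
Variables (J : finType) (a : J -> 'I_n -> R) (b m4 : R).
Hypothesis iX4 : forall i, P.-integrable setT (EFin \o (fun w => X i w ^+ 4)).
Hypothesis EX1 : forall i, \int[P]_w X i w = 0.
Hypothesis EX2 : forall i, \int[P]_w (X i w ^+ 2) = 1.
Hypothesis EX4 : forall i, \int[P]_w (X i w ^+ 4) <= m4.
Hypothesis norme : forall i, standard_normal (e i).
Hypothesis Ee4 : forall i, \int[Q]_w (e i w ^+ 4) <= m4.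
Hypothesis J0 : (0 < #|J|)%N.
Hypothesis b0 : 0 < b.
Hypothesis ab : forall j i, `|a j i| <= b.
Hypothesis a1 : forall j, \sum_(i < n) a j i ^+ 2 = 1.
Hypothesis m40 : 0 <= m4.
Variables (N q D K : R).
Hypotheses (N18 : 18 <= N) (ND : 8 * D <= N) (q1 : 1 <= q) (D1 : 1 <= D).
Hypothesis bqN : b * q ^+ 7 * N ^+ 8 <= D.
Hypothesis nbqN : n%:R * b ^+ 4 * q ^+ 14 * N ^+ 16 <= D.
Hypothesis lnJ : ln #|J|%:R <= 2 * q ^+ 2.
Hypothesis harmonicK : \sum_(k < n) k.+1%:R^-1 <= K * N.

Let N0 : 0 < N. Proof. by rewrite (lt_le_trans _ N18). Qed.
Let q0 : 0 < q. Proof. by rewrite (lt_le_trans _ q1). Qed.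
Let D0 : 0 < D. Proof. by rewrite (lt_le_trans _ D1). Qed.
Let N1 : 1 <= N. Proof. by rewrite (le_trans _ N18)// ler1n. Qed.

(* With [q = Num.sqrt (ln (p * n))] and [N] a small power of [n], this choice makes
   the anti-concentration and smoothing errors both O(1 / N). *)
Let delta := (N * q)^-1.
Let L := N ^+ 2 * q.
Let beta := 2 * N ^+ 2 * q ^+ 3.

Let delta0 : 0 < delta. Proof. by rewrite invr_gt0 mulr_gt0. Qed.
Let L0 : 0 < L. Proof. by rewrite mulr_gt0 ?exprn_gt0. Qed.
Let beta0 : 0 < beta. Proof. by rewrite !mulr_gt0 ?exprn_gt0. Qed.

Let Lbeta : L <= beta.
Proof.
rewrite /L /beta -mulrA mulrCA ler_wpM2l ?exprn_ge0 ?(ltW N0)//.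
have : q <= q ^+ 3 by rewrite ler_eXnr.
move=> h; rewrite (le_trans h)// ler_peMl ?exprn_ge0 ?(ltW q0)//.
by rewrite ler1n.
Qed.

Lemma mulrDl3 (x y z u : R) : (x + y + z) * u = x * u + (y * u + z * u).
Proof. by rewrite !mulrDl addrA. Qed.

Lemma mul_le_of_ge1 (x y z : R) : 0 <= x -> 1 <= y -> x * y <= z -> x <= z.
Proof. by move=> x0 y1; apply: le_trans; rewrite ler_peMr. Qed.

Let betab : 4 * beta * b <= 1.
Proof.
have h : 8 * (b * q ^+ 7 * N ^+ 8) <= N by rewrite (le_trans _ ND)// ler_pM2l.
have h2 : (4 * beta * b) * N * (q ^+ 4 * N ^+ 5) <= N.
  by apply: le_trans h; rewrite le_eqVlt; apply/orP; left; apply/eqP; rewrite /beta; ring.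
have h3 : 4 * beta * b * N <= N.
  apply: mul_le_of_ge1 h2; first by rewrite !mulr_ge0// ltW.
  by rewrite mulr_ege1// exprn_ege1.
by move: h3; rewrite -[leRHS]mul1r ler_pM2r.
Qed.

(** Three errors in units of [1 / N]: 2 from the logistic tails, [160 = 40 * 4] since
    [L * beta ^+ 2 = 4 * N ^+ 6 * q ^+ 7], and [48 = 6 * 8] since
    [L * beta ^+ 3 = 8 * N ^+ 8 * q ^+ 10]. *)
Definition comparison_cst : R :=
  2 + 160 * expR 2 * (1 + m4) * D * K + 48 * (1 + m4) * D.

(** As [L * delta = N], the logistic tails are [expR (- N) <= 1 / N]. In the third order term [bqN]
    leaves [D / N ^+ 2], of which the harmonic sum gives back one factor [N]. *)
Lemma smoothing_error : 2 * expR (- (L * delta)) +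
  ((40 * expR 2 * L * beta ^+ 2 * b * (1 + m4)) * (\sum_(k < n) k.+1%:R^-1) +
   n%:R * (6 * L * beta ^+ 3 * b ^+ 4 * (1 + m4))) <= comparison_cst / N.
Proof.
have m4' : 0 <= 1 + m4 by rewrite addr_ge0.
have LdN : L * delta = N.
  by rewrite /L /delta; field; rewrite !gt_eqF.
have h1 : expR (- (L * delta)) <= N^-1.
  rewrite LdN expRN lef_pV2 ?posrE ?expR_gt0// (le_trans _ (expR_ge1Dx _))//.
  by rewrite lerDr.
have H0 : 0 <= \sum_(k < n) (k.+1%:R^-1 : R) by apply: sumr_ge0 => k _; rewrite invr_ge0.
have h2 : (40 * expR 2 * L * beta ^+ 2 * b * (1 + m4)) * (\sum_(k < n) k.+1%:R^-1) <=
    160 * expR 2 * (1 + m4) * D * K / N.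
  have -> : 40 * expR 2 * L * beta ^+ 2 * b * (1 + m4) =
      160 * expR 2 * (1 + m4) * (b * q ^+ 7 * N ^+ 6) by rewrite /L /beta; ring.
  have -> : 160 * expR 2 * (1 + m4) * D * K / N =
      160 * expR 2 * (1 + m4) * (D / N ^+ 2) * (K * N) by field; rewrite gt_eqF.
  apply: ler_pM => //.
    by rewrite !mulr_ge0 ?expR_ge0 ?exprn_ge0 ?(ltW b0) ?(ltW q0) ?(ltW N0).
  rewrite ler_wpM2l ?mulr_ge0 ?expR_ge0// ler_pdivlMr ?exprn_gt0//.
  by apply: le_trans bqN; rewrite le_eqVlt; apply/orP; left; apply/eqP; ring.
have h3 : n%:R * (6 * L * beta ^+ 3 * b ^+ 4 * (1 + m4)) <= 48 * (1 + m4) * D / N.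
  have -> : n%:R * (6 * L * beta ^+ 3 * b ^+ 4 * (1 + m4)) =
      48 * (1 + m4) * (n%:R * b ^+ 4 * q ^+ 10 * N ^+ 8) by rewrite /L /beta; ring.
  rewrite -[leRHS]mulrA ler_wpM2l ?mulr_ge0// ler_pdivlMr//.
  apply: (@mul_le_of_ge1 _ (q ^+ 4 * N ^+ 7)).
  - by rewrite !mulr_ge0 ?exprn_ge0 ?(ltW b0) ?(ltW q0) ?(ltW N0).
  - by rewrite mulr_ege1// exprn_ege1.
  - by apply: le_trans nbqN; rewrite le_eqVlt; apply/orP; left; apply/eqP; ring.
rewrite /comparison_cst mulrDl3.
by apply: lerD; [rewrite ler_pM2l|exact: lerD].
Qed.

Lemma comparison_mid (t : R) : 0 <= t -> t <= 2 * q ->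
  cdf_max e a t - (18 * expR 2 + comparison_cst) / N <= cdf_max X a t.
Proof.
move=> t0 tq.
have lnJ' : ln #|J|%:R <= beta * delta.
  apply: le_trans lnJ _.
  have -> : beta * delta = 2 * q ^+ 2 * N by rewrite /beta /delta; field; rewrite !gt_eqF.
  by rewrite ler_peMr// mulr_ge0// exprn_ge0// ltW.
have h := kolmogorov_soft indX inde iX4 EX1 EX2 EX4 norme Ee4 J0 L0 beta0 Lbeta b0 ab a1 m40
  betab delta0 lnJ' erefl.
have /= h2 := smoothing_error; have {h} := h t => /= h.
(* This many windows of width [3 * delta] fit, because [t + 1 <= 3 * q] and
   [N / 9 * (3 * delta) * (3 * q) = 1]. With [18 <= N] the truncation loses at most a factor 2,
   whence the 18 in the bound. *)
have [K1 K2] : N / 18 <= (Num.truncn (N / 9))%:R /\ (Num.truncn (N / 9))%:R <= N / 9 :> R.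
  have N9 : 0 <= N / 9 by rewrite divr_ge0// ltW.
  have /andP[] := truncn_itv N9; rewrite -(natr1 (Num.truncn _)) => t1 t2; split=> //.
  have : N / 9 < (Num.truncn (N / 9))%:R + 1 := t2.
  move: N18; move: (Num.truncn (N / 9)) => k; set x : R := k%:R; lra.
have K3 : (Num.truncn (N / 9))%:R * (3 * delta) * (t + 1) <= 1 :> R.
  apply: (@le_trans _ _ (N / 9 * (3 * delta) * (3 * q))).
    apply: ler_pM => //; first by rewrite !mulr_ge0// ltW.
    - by rewrite addr_ge0.
    - by rewrite ler_wpM2r// mulr_ge0// ltW.
    - by move: tq q1; lra.
  by rewrite le_eqVlt; apply/orP; left; apply/eqP; rewrite /delta; field; rewrite !gt_eqF.
have d3 : 0 < 3 * delta by rewrite mulr_gt0.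
have := cdf_max_anti_concentration inde norme a1 t0 d3 K3.
set c0 := cdf_max e a t; set cd := cdf_max e a (t - 3 * delta) => h3.
have c0d : 0 <= c0 - cd by rewrite subr_ge0 cdf_max_le// lerBlDr lerDl ltW.
have h4 : c0 - cd <= 18 * expR 2 / N.
  rewrite ler_pdivlMr//.
  have : N / 18 * (c0 - cd) <= expR 2 by apply: le_trans h3; rewrite ler_wpM2r.
  by move: (c0 - cd) => x; lra.
rewrite mulrDl opprD addrA; apply: le_trans h.
rewrite -[leRHS]addrA -[X in _ <= _ + X]opprD.
by apply: lerB => //; rewrite lerBlDr -lerBlDl.
Qed.

(** Anti-concentration degrades as [t] grows. Beyond [2 * q], monotonicity returns to the level
    [2 * q], where the Gaussian probability is already close to 1. *)
Lemma comparison_ge0 (t : R) : 0 <= t ->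
  cdf_max e a t - (18 * expR 2 + comparison_cst) / N - #|J|%:R * expR (- (2 * q ^+ 2)) <=
  cdf_max X a t.
Proof.
move=> t0.
have J0' : 0 <= #|J|%:R * expR (- (2 * q ^+ 2)) by rewrite mulr_ge0// expR_ge0.
have [tq|qt] := lerP t (2 * q).
  by have := comparison_mid t0 tq; move: J0'; set u := _ * expR _; lra.
have q20 : 0 <= 2 * q by rewrite mulr_ge0// ltW.
have := comparison_mid q20 (lexx _).
have := cdf_max_tail inde norme a1 q20.
have -> : (2 * q) ^+ 2 / 2 = 2 * q ^+ 2 by field.
have := cdf_max_le1 e a t; have := cdf_max_le X a (ltW qt).
set u := _ * expR _; set v := _ / N; lra.
Qed.

End Comparison.

(** The forms come in opposite pairs, so their maximum is never negative. *)
Lemma cdf_max_lt0 (R : realType) d (T : measurableType d) (P : probability T R) (n : nat)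
    (X : 'I_n -> {RV P >-> R}) (J : finType) (a : J -> 'I_n -> R) (t : R) :
  (0 < #|J|)%N -> (forall j, exists k, forall i, a k i = - a j i) -> t < 0 ->
  cdf_max X a t = 0.
Proof.
move=> /card_gt0P [j _] sym t0; rewrite /cdf_max (_ : below X a t = set0) ?measure0//.
apply/seteqP; split=> // w H; have [k kj] := sym j.
have := H k; have := H j.
have -> : lin X (a k) w = - lin X (a j) w.
  by rewrite /lin -sumrN; apply: eq_bigr => i _; rewrite kj mulNr.
lra.
Qed.

(** [expR (-1) >= (1 - 1/6) ^+ 6 > 1/3]. This serves to get [1 <= ln (p n)] from [3 <= p]. *)
Lemma expR1_le3 (R : realType) : expR 1 <= 3 :> R.
Proof.
have h : (3^-1 : R) <= expR (-1).
  have x6 : 6^-1 <= 1 :> R by rewrite invf_le1// ler1n.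
  have -> : expR (-1) = expR (- (6^-1 : R)) ^+ 6.
    by rewrite -expRM_natl; congr expR; rewrite mulrN mulfV.
  apply: (@le_trans _ _ ((1 - 6^-1) ^+ 6)); last first.
    by rewrite lerXn2r ?nnegrE ?expR_ge0 ?subr_ge0// expR_ge1Dx.
  by lra.
rewrite -[X in expR X]opprK expRN -[leRHS]invrK lef_pV2 ?posrE ?expR_gt0//.
Qed.

Lemma ln_ge1 (R : realType) (x : R) : 3 <= x -> 1 <= ln x.
Proof.
move=> x3; rewrite -[1]expRK ler_ln ?posrE ?expR_gt0//; last by rewrite (lt_le_trans _ x3).
exact: le_trans (expR1_le3 R) x3.
Qed.

Lemma gaussian_comparison (R : realType) (c1 C1 m4 : R) : 0 < c1 -> 0 < C1 -> 0 <= m4 ->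
  exists c C : R, 0 < c /\ 0 < C /\
  forall (B : R) (n p : nat), 1 <= B -> (1 <= n)%N -> (3 <= p)%N ->
  B ^+ 4 * ln ((p * n)%N%:R : R) ^+ 7 / n%:R <= C1 * n%:R `^ (- c1) ->
  forall d d' (T : measurableType d) (T' : measurableType d')
    (P : probability T R) (Q : probability T' R)
    (X : 'I_n -> {RV P >-> R}) (e : 'I_n -> {RV Q >-> R}),
  indep_family P X -> indep_family Q e ->
  (forall i, P.-integrable setT (EFin \o (fun w => X i w ^+ 4))) ->
  (forall i, \int[P]_w X i w = 0) ->
  (forall i, \int[P]_w (X i w ^+ 2) = 1) ->
  (forall i, \int[P]_w (X i w ^+ 4) <= m4) ->
  (forall i, standard_normal (e i)) ->
  (forall i, \int[Q]_w (e i w ^+ 4) <= m4) ->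
  forall (J : finType) (a : J -> 'I_n -> R), #|J| = (2 * p)%N ->
  (forall j i, `|a j i| <= B / Num.sqrt n%:R) ->
  (forall j, \sum_(i < n) a j i ^+ 2 = 1) ->
  (forall j, exists k, forall i, a k i = - a j i) ->
  forall t, cdf_max e a t - C * n%:R `^ (- c) <= cdf_max X a t.
Proof.
move=> c10 C10 m40.
(* The 16 lets the power [N ^+ 16] of [N = n^c] be absorbed by [n^(- c1)]; the minimum with 1
   ensures [N <= n]. *)
pose c := Num.min c1 1 / 16.
have c0 : 0 < c by rewrite divr_gt0// lt_min c10/=.
have c16 : c * 16 = Num.min c1 1 by rewrite /c divfK.
have cc1 : c * 16 <= c1 by rewrite c16 ge_min lexx.
have c_le1 : c <= 1.
  have : c * 16 <= 1 by rewrite c16 ge_min lexx orbT.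
  by move: c0; lra.
(* [1 <= D] will allow [D <= D ^+ 2]; [1 / c] enters [K] because [ln n = ln N / c] in the harmonic
   sum. *)
pose D := 1 + C1; pose K := 1 + c^-1.
have D1 : 1 <= D by rewrite lerDl ltW.
have K0 : 0 <= K by rewrite addr_ge0// invr_ge0 ltW.
pose C0 := 18 * expR 2 + comparison_cst m4 D K.
have D0 : 0 <= D by rewrite (le_trans _ D1).
have C00 : 0 <= C0.
  have m40' : 0 <= 1 + m4 by apply: addr_ge0.
  rewrite /C0 /comparison_cst; apply: addr_ge0; first by rewrite mulr_ge0// expR_ge0.
  apply: addr_ge0; last by rewrite !mulr_ge0.
  by apply: addr_ge0 => //; rewrite !mulr_ge0// expR_ge0.
(* The first summand makes the claim trivial when [N < 18 + 8 * D]; in the second, [C0] pays for the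
   comparison error and 1 for the Gaussian tail beyond [2 * q]. *)
pose C := (18 + 8 * D) + (C0 + 1).
have CD : 18 + 8 * D <= C by rewrite /C lerDl addr_ge0.
have CC0 : C0 + 1 <= C by rewrite /C lerDr addr_ge0// mulr_ge0.
have Cp : 0 < C by rewrite (lt_le_trans _ CC0)// ltr_pwDr.
exists c, C; split=> //; split=> //.
move=> B n p B1 n1 p3 hyp d d' T T' P Q X e indX inde iX4 EX1 EX2 EX4 norme Ee4 J a Jp ab a1 sym t.
have J0 : (0 < #|J|)%N by rewrite Jp muln_gt0/= (leq_trans _ p3).
pose N := n%:R `^ c : R.
have n0 : 0 < n%:R :> R by rewrite ltr0n.
have n1' : 1 <= n%:R :> R by rewrite ler1n.
have N1 : 1 <= N by rewrite -(powRr0 n%:R) ler_powR// ltW.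
have N0 : 0 < N by rewrite (lt_le_trans _ N1).
have -> : n%:R `^ (- c) = N^-1 by rewrite powRN.
have small : N < 18 + 8 * D -> cdf_max e a t - C * N^-1 <= cdf_max X a t.
  move=> Ns; have := cdf_max_le1 e a t; have := cdf_max_ge0 X a t.
  have : 1 <= C * N^-1.
    by rewrite ler_pdivlMr// mul1r (le_trans (ltW Ns)).
  by move: (_ * N^-1) => x; lra.
have [/small//|Nbig] := ltrP N (18 + 8 * D).
have [t0|t0] := ltrP t 0.
  rewrite (cdf_max_lt0 e J0 sym t0) sub0r (le_trans _ (cdf_max_ge0 _ _ _))// oppr_le0.
  by rewrite mulr_ge0 ?invr_ge0 ?ltW.
have pnN : (0 < p * n)%N by rewrite muln_gt0 n1 (leq_trans _ p3).
have pn0 : 0 < (p * n)%N%:R :> R by rewrite ltr0n.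
pose l := ln ((p * n)%N%:R : R).
have l1 : 1 <= l by apply: ln_ge1; rewrite ler_nat (leq_trans p3)// leq_pmulr.
pose q : R := Num.sqrt l; pose b := B / Num.sqrt n%:R.
have q2 : q ^+ 2 = l by rewrite sqr_sqrtr// (le_trans _ l1).
have q1 : 1 <= q by rewrite -(@ler_pXn2r _ 2) ?nnegrE ?sqrtr_ge0// q2 expr1n.
have s0 : 0 < Num.sqrt n%:R :> R by rewrite sqrtr_gt0.
have s2 : Num.sqrt n%:R ^+ 2 = n%:R :> R by rewrite sqr_sqrtr// ltW.
have B0 : 0 < B by rewrite (lt_le_trans _ B1).
have b0 : 0 < b by rewrite divr_gt0.
have q0 : 0 < q by rewrite (lt_le_trans _ q1).
(* The growth condition multiplied by [N ^+ 16], with [q ^+ 14 = ln (p n) ^+ 7]. *)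
have main : B ^+ 4 * q ^+ 14 * N ^+ 16 <= D * n%:R.
  have N16 : N ^+ 16 * n%:R `^ (- c1) <= 1.
    rewrite -powR_mulrn ?(ltW N0)// /N -powRrM -powRD; last by rewrite (gt_eqF n0) implybT.
    by rewrite -[leRHS](powRr0 n%:R) ler_powR// subr_le0.
  have h : B ^+ 4 * l ^+ 7 <= C1 * n%:R `^ (- c1) * n%:R by rewrite -ler_pdivrMr.
  have -> : B ^+ 4 * q ^+ 14 * N ^+ 16 = B ^+ 4 * l ^+ 7 * N ^+ 16 by rewrite -q2; ring.
  apply: le_trans (ler_wpM2r (exprn_ge0 16 (ltW N0)) h) _.
  have -> : C1 * n%:R `^ (- c1) * n%:R * N ^+ 16 = C1 * n%:R * (N ^+ 16 * n%:R `^ (- c1)) by ring.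
  apply: (@le_trans _ _ (C1 * n%:R)).
    by rewrite ler_piMr// mulr_ge0// ltW.
  by rewrite ler_pM2r// lerDr.
have h4 : n%:R * b ^+ 4 * q ^+ 14 * N ^+ 16 <= D.
  have -> : n%:R * b ^+ 4 * q ^+ 14 * N ^+ 16 = B ^+ 4 * q ^+ 14 * N ^+ 16 / n%:R.
    by rewrite /b; move: (Num.sqrt _) s0 s2 => s s0 <-; field; rewrite gt_eqF.
  by rewrite ler_pdivrMr.
(* Proved after squaring: [B ^+ 2 <= B ^+ 4] and [D <= D ^+ 2] reduce it to [main]. *)
have h2 : b * q ^+ 7 * N ^+ 8 <= D.
  have e1 : (b * q ^+ 7 * N ^+ 8) ^+ 2 <= D ^+ 2.
    have -> : (b * q ^+ 7 * N ^+ 8) ^+ 2 = B ^+ 2 * q ^+ 14 * N ^+ 16 / n%:R.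
      by rewrite /b; move: (Num.sqrt _) s0 s2 => s s0 <-; field; rewrite gt_eqF.
    rewrite ler_pdivrMr//; apply: (@le_trans _ _ (D * n%:R)).
      apply: le_trans main; rewrite ler_wpM2r ?exprn_ge0 ?(ltW N0)//.
      by rewrite ler_wpM2r ?exprn_ge0 ?(ltW q0)// ler_weXn2l.
    by rewrite ler_pM2r// ler_eXnr.
  rewrite -(@ler_pXn2r _ 2) ?nnegrE//.
  exact: mulr_ge0 (mulr_ge0 (ltW b0) (exprn_ge0 7 (ltW q0))) (exprn_ge0 8 (ltW N0)).
have lnJ : ln #|J|%:R <= 2 * q ^+ 2.
  rewrite q2 /l mulr_natl -lnXn//.
  rewrite ler_ln ?posrE ?exprn_gt0 ?ltr0n// -natrX ler_nat Jp.
  rewrite expnMn; apply: (@leq_trans (p ^ 2)); last by rewrite leq_pmulr// expn_gt0 n1.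
  by rewrite expnS expn1 leq_mul2r (ltnW p3) orbT.
have hK : \sum_(k < n) k.+1%:R^-1 <= K * N.
  have lnN : ln n%:R = c^-1 * ln N by rewrite /N ln_powR mulKf// gt_eqF.
  case: (n) n1 lnN => // m _ lnN.
  apply: le_trans (harmonic_le _ _) _; rewrite lnN /K mulrDl mul1r lerD//.
  rewrite ler_wpM2l ?invr_ge0 ?(ltW c0)//.
  by rewrite (le_trans _ (_ : expR (ln N) <= N)) ?lnK ?posrE// -[leRHS](lnK N0) (le_trans _ (expR_ge1Dx _))// lerDr.
have [N18 N8] : 18 <= N /\ 8 * D <= N.
  by split; apply: le_trans Nbig; [rewrite lerDl mulr_ge0|rewrite lerDr].
have := comparison_ge0 indX inde iX4 EX1 EX2 EX4 norme Ee4 J0 b0 ab a1 m40 N18 N8 q1 h2 h4 lnJ hK t0.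
have -> : 18 * expR 2 + comparison_cst m4 D K = C0 by [].
apply: le_trans.
(* Since [q ^+ 2 = ln (p n)], the left side is [2 p / (p n)^2], at most [1 / n]. *)
have tail : #|J|%:R * expR (- (2 * q ^+ 2)) <= N^-1.
  have -> : 2 * q ^+ 2 = ln ((p * n)%N%:R ^+ 2) by rewrite q2 lnXn// mulr_natl.
  rewrite expRN lnK ?posrE ?exprn_gt0//.
  have Nn : N <= n%:R by rewrite -[leRHS](powRr1 (ltW n0)) ler_powR.
  apply: (@le_trans _ _ n%:R^-1); last by rewrite lef_pV2.
  rewrite ler_pdivrMr ?exprn_gt0// mulrC ler_pdivlMr// -natrX -natrM ler_nat Jp.
  rewrite -mulnA -mulnn leq_mul2r; apply/orP; right.
  by apply: leq_trans (leq_pmulr p n1); exact: leq_trans p3.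
move: tail; set u := #|J|%:R * _ => tail.
have : (C0 + 1) / N <= C / N by rewrite ler_pM2r ?invr_gt0.
by rewrite [X in X <= _]mulrDl mul1r; move: tail; set x := C0 / N; set y := C / N; lra.
Qed.

(** * Quantiles *)

Section Quantile.
Context (R : realType) d (T : measurableType d) (P : probability T R).

Lemma cdf_setE (X : {RV P >-> R}) t : cdf X t = P [set w | X w <= t].
Proof. by congr (P _); apply/seteqP; split => w /=; rewrite in_itv. Qed.

Lemma has_inf_quantile (X : {RV P >-> R}) (u : R) : 0 < u -> u < 1 ->
  has_inf [set t : R | (u%:E <= P [set w | (X w <= t)%R])%E].
Proof.
move=> u0 u1; split.
  have u1' : (u%:E < 1%:E)%E by rewrite lte_fin.
  have H : \forall t \near +oo, (u%:E < cdf X t)%E.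
    exact: cvg_cdfy1 (open_nbhs_nbhs (conj (@open_ereal_gt_ereal R u%:E) u1')).
  by have [t /ltW ut] := filter_ex H; exists t; rewrite /= -cdf_setE.
have u0' : (0%:E < u%:E)%E by rewrite lte_fin.
have H : \forall t \near -oo, (cdf X t < u%:E)%E.
  exact: cvg_cdfNy0 (open_nbhs_nbhs (conj (@open_ereal_lt_ereal R u%:E) u0')).
have [t ut] := filter_ex H; exists t => s /=; rewrite -cdf_setE => us.
rewrite leNgt; apply/negP => /ltW st; have := cdf_nondecreasing X st.
by rewrite leNgt (lt_le_trans ut us).
Qed.

(** Right continuity: were the distribution function below [u] at the infimum, it would stay below
    [u] just to the right, where the set defining the quantile has elements. *)
Lemma quantile_attained (X : {RV P >-> R}) (u : R) : 0 < u -> u < 1 ->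
  (u%:E <= P [set w | (X w <= quantile P X u)%R])%E.
Proof.
move=> u0 u1; have hi := has_inf_quantile X u0 u1.
rewrite -cdf_setE leNgt; apply/negP => xu.
set x := quantile P X u in xu *.
have H : \forall t \near x^'+, (cdf X t < u%:E)%E.
  exact: cdf_right_continuous (open_nbhs_nbhs (conj (@open_ereal_lt_ereal R u%:E) xu)).
near x^'+ => t.
have tu : (cdf X t < u%:E)%E by near: t.
have xt : x < t by near: t; exact: nbhs_right_gt.
have t0 : 0 < t - x by rewrite subr_gt0.
have [s] := inf_adherent t0 hi; rewrite -/(quantile P X u) -/x /= -cdf_setE addrC subrK.
move=> us /ltW st; have := cdf_nondecreasing X st.
by rewrite leNgt (lt_le_trans tu us).
Unshelve. all: end_near.
Qed.

Lemma quantile_le (X : {RV P >-> R}) (u t : R) : 0 < u -> u < 1 ->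
  (u%:E <= P [set w | (X w <= t)%R])%E -> quantile P X u <= t.
Proof.
by move=> u0 u1 ut; have [_ hl] := has_inf_quantile X u0 u1; exact: ge_inf ut.
Qed.

(** The partial inverse can be cancelled once [u] is known to be a value of [Phi]; it is the value
    at the [u]-quantile of [X]. There [Phi] is at least [u], and at most [u] because the normal law
    has no atom and every level strictly below the quantile has probability below [u]. *)
Lemma PhiK (X : {RV P >-> R}) (u : R) : standard_normal X -> 0 < u -> u < 1 ->
  Phi (Phi_inv u) = u.
Proof.
move=> nX u0 u1; rewrite /Phi_inv pinvK// inE.
pose x := quantile P X u; exists x => //.
have PhiE t : (Phi t)%:E = P [set w | X w <= t].
  rewrite /Phi -nX//.
  by rewrite -cdf_setE /cdf fineK// fin_num_measure.
have mle t : measurable [set w | X w <= t].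
  rewrite (_ : [set w | _] = X @^-1` `]-oo, t]); last first.
    by apply/seteqP; split => w /=; rewrite in_itv.
  by rewrite -[Y in measurable Y]setTI; exact: measurable_funPT.
have mlt : measurable [set w | X w < x].
  rewrite (_ : [set w | _] = X @^-1` `]-oo, x[); last first.
    by apply/seteqP; split => w /=; rewrite in_itv.
  by rewrite -[Y in measurable Y]setTI; exact: measurable_funPT.
apply/eqP; rewrite eq_le; apply/andP; split; last first.
  by rewrite -lee_fin PhiE; exact: quantile_attained.
rewrite -lee_fin PhiE.
have -> : [set w | X w <= x] = [set w | X w < x] `|` X @^-1` [set x].
  apply/seteqP; split => w /=; first by rewrite le_eqVlt => /orP[/eqP|]; [right|left].
  by move=> [/ltW//|->].
have mx : measurable (X @^-1` [set x]).
  by rewrite -[Y in measurable Y]setTI; apply: measurable_funPT => //; exact: measurable_set1.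
rewrite measureU0//; last first.
  transitivity (normal_prob 0 1 [set x] : \bar R); first exact: nX.
  by rewrite /normal_prob (@integral_Sset1 _ _ _ x).
pose F (k : nat) := [set w | X w <= x - k.+1%:R^-1].
have FU : \bigcup_k F k = [set w | X w < x].
  apply/seteqP; split => w /=.
    by move=> [k _ /= /le_lt_trans]; apply; rewrite ltrBlDr ltrDl invr_gt0.
  move=> wx; exists (Num.truncn (x - X w)^-1) => //=.
  have d0 : 0 < x - X w by rewrite subr_gt0.
  rewrite /F /= lerBrDr -lerBrDl -[leRHS]invrK lef_pV2 ?posrE ?invr_gt0//.
  by rewrite ltW// truncnS_gt.
have Fnd : {homo F : n m / (n <= m)%N >-> (n <= m)%O}.
  move=> k m km; apply/subsetPset => w /= /le_trans; apply.
  by rewrite lerD2l lerN2 lef_pV2 ?posrE// ler_nat ltnS.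
have := nondecreasing_cvg_mu (mu := P) (fun k => mle _) _ Fnd.
rewrite FU => /(_ mlt) cvF.
rewrite -(cvg_lim _ cvF)//; apply: lime_le; first by apply/cvg_ex; eexists; exact: cvF.
apply: nearW => k /=; rewrite leNgt; apply/negP => /ltW /quantile_le.
move=> /(_ u0 u1); rewrite -/x leNgt => /negP; apply.
by rewrite ltrBlDr ltrDl invr_gt0.
Qed.
End Quantile.

(** * The Dantzig selector *)

(** [x ^+ 4 <= 4 ^+ 4 * expR |x|], then the generating function at 1 and -1. A crude constant
    suffices, as it only enters [m4]. *)
Lemma normal_fourth_moment (R : realType) d (T : measurableType d) (Q : probability T R)
    (X : {RV Q >-> R}) : standard_normal X -> \int[Q]_w (X w ^+ 4) <= 4 ^+ 4 * (2 * expR (2^-1)).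
Proof.
move=> nX; have [i1 e1] := normal_mgf nX 1; have [i2 e2] := normal_mgf nX (-1).
have i3 : Q.-integrable setT (EFin \o (fun w => expR (1 * X w) + expR (-1 * X w))).
  exact: integrable_EFinD.
apply: (@le_trans _ _ (\int[Q]_w (4 ^+ 4 * (expR (1 * X w) + expR (-1 * X w))))).
  apply: (le_Rintegral measurableT (integrable_normal_pow nX 4) (integrable_EFinZ (4 ^+ 4) i3)).
  move=> w _; have -> : X w ^+ 4 = `|X w| ^+ 4.
    by rewrite -[in RHS]normrX ger0_norm// exprn_even_ge0.
  apply: le_trans (pow_le_expR 3 (normr_ge0 _)) _.
  rewrite ler_pM2l ?exprn_gt0// mul1r mulN1r.
  by have [h|h] := lerP 0 (X w); [rewrite ger0_norm|rewrite ltr0_norm]; rewrite ?lerDl ?lerDr ?expR_ge0.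
rewrite RintegralZl// RintegralD// e1 e2 sqrrN expr1n mul1r.
by rewrite mulr_natl mulr2n.
Qed.

Lemma indep_of_mutually_independent (R : realType) d (T : measurableType d)
    (P : probability T R) n (X : 'I_n -> {RV P >-> R}) :
  mutually_independent X -> indep_family P X.
Proof.
move=> ind A mA; have := ind [set: 'I_n]%SET A mA.
under [X in _ = X]eq_bigl do rewrite finset.in_setT.
move=> <-; congr (P _); apply/seteqP; split => w /= H i; last by apply: H; rewrite /= finset.in_setT.
by move=> _; exact: H.
Qed.

Section Deterministic.
Context {R : realType}.

Lemma seminorm_ge0 p (N : 'cV[R]_p -> R) x : seminorm N -> 0 <= N x.
Proof.
move=> [ND NZ]; have := ND x (-1 *: x); rewrite scaleN1r subrr.
have := NZ 0 0; rewrite scale0r normr0 mul0r => ->.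
have := NZ (-1) x; rewrite scaleN1r normrN1 mul1r => ->; lra.
Qed.

Lemma score_le n p (z : 'M[R]_(n, p)) (r : 'I_n -> R) j :
  `|En (fun i => z i j * r i)| <= max_score z r.
Proof. exact: (le_bigmax 0 (fun j => `|En (fun i => z i j * r i)|)). Qed.

Lemma kappa_ge0 n p (z : 'M[R]_(n, p)) (N : 'cV[R]_p -> R) beta : seminorm N ->
  (0 <= kappa z N beta)%E.
Proof.
move=> sN; apply: le_ereal_inf_tmp => _ [delta [_ _] <-]; rewrite lee_fin.
exact: bigmax_ge_id.
Qed.

Lemma dantzig_error n p (z : 'M[R]_(n, p)) (beta bhat : 'cV[R]_p) (eps y : 'I_n -> R)
    (lambda : R) (N : 'cV[R]_p -> R) : (0 < n)%N -> seminorm N ->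
  (forall i, y i = (z *m beta) i 0 + eps i) ->
  dantzig_selector z y lambda bhat -> Num.sqrt n%:R * max_score z eps <= lambda ->
  ((N (bhat - beta))%:E <= error_bound n lambda (kappa z N beta))%E.
Proof.
move=> n0 sN yE [feas opt] score.
have s0 : 0 < Num.sqrt n%:R :> R by rewrite sqrtr_gt0 ltr0n.
have betaE : (fun i => y i - (z *m beta) i 0) = eps.
  by apply/funext => i; rewrite yE addrAC subrr add0r.
have lb : l1norm bhat <= l1norm beta by apply: opt; rewrite /dantzig_feasible betaE.
set delta := bhat - beta.
have restr : restricted_set beta delta by rewrite /restricted_set/= addrC subrK.
have ms0 : 0 <= max_score z eps by exact: bigmax_ge_id.
have l0 : 0 <= lambda by apply: le_trans score; rewrite mulr_ge0// ltW.
have gram j : `|En (fun i => z i j * (z *m delta) i 0)| <= 2 * lambda / Num.sqrt n%:R.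
  have -> : En (fun i => z i j * (z *m delta) i 0) = En (fun i => z i j * eps i) -
      En (fun i => z i j * (y i - (z *m bhat) i 0)).
    rewrite /En -mulrBr -sumrB; congr (_ * _); apply: eq_bigr => i _.
    by rewrite /delta mulmxBr !mxE yE !mxE; ring.
  apply: le_trans (ler_normB _ _) _.
  have b1 : `|En (fun i => z i j * eps i)| <= lambda / Num.sqrt n%:R.
    by apply: le_trans (score_le z eps j) _; rewrite ler_pdivlMr// mulrC.
  have b2 : `|En (fun i => z i j * (y i - (z *m bhat) i 0))| <= lambda / Num.sqrt n%:R.
    apply: le_trans (score_le z (fun i => y i - (z *m bhat) i 0) j) _.
    by rewrite ler_pdivlMr// mulrC.
  by rewrite -mulrA mulr_natl mulr2n lerD.
rewrite /error_bound; case: ifPn => [_|k0]; first exact: leey.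
have kge := kappa_ge0 z beta sN.
(* When the seminorm vanishes, [delta] is excluded from the infimum in [kappa]; the bound then only
   has to be nonnegative. *)
have [N0|N0] := eqVneq (N delta) 0.
  rewrite N0 mule_ge0 ?lee_fin ?mulr_ge0// inve_ge0 mule_ge0// lee_fin ltW//.
have Np : 0 < N delta by rewrite lt_neqAle eq_sym N0 seminorm_ge0.
have kle : (kappa z N beta <= (2 * lambda / Num.sqrt n%:R / N delta)%:E)%E.
  apply: le_trans (ereal_inf_lbound _) _; first by exists delta.
  rewrite lee_fin; apply/bigmax_leP; split.
    by rewrite !divr_ge0 ?mulr_ge0// ltW.
  by move=> j _; rewrite ler_pM2r ?invr_gt0.
(* [kle] rules out [+oo] and [kge] rules out [-oo], so [kappa] is a real number here. *)
case: (kappa z N beta) k0 kge kle => [k|//|//].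
rewrite eqe !lee_fin => k0 kge kle.
have kp : 0 < k by rewrite lt_neqAle eq_sym k0.
rewrite -EFinM inver gt_eqF ?mulr_gt0// -EFinM lee_fin ler_pdivlMr ?mulr_gt0//.
by move: kle; rewrite ler_pdivlMr// ler_pdivlMr//; apply: le_trans;
  rewrite le_eqVlt; apply/orP; left; apply/eqP; ring.
Qed.

(* The weights of the [2 p] linear forms whose maximum is the rescaled score. *)
Definition score_weight n p (z : 'M[R]_(n, p)) (j : 'I_p * bool) (i : 'I_n) : R :=
  (-1) ^+ j.2 * (z i j.1 / Num.sqrt n%:R).

(** The factor [sqrt n / n] is [1 / sqrt n], and the two signs of each column stand for the absolute
    value. *)
Lemma max_score_leP n p (z : 'M[R]_(n, p)) (r : 'I_n -> R) (t : R) :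
  (0 < n)%N -> (0 < p)%N ->
  Num.sqrt n%:R * max_score z r <= t <->
  forall j, \sum_(i < n) score_weight z j i * r i <= t.
Proof.
move=> n0 p0; have s0 : 0 < Num.sqrt n%:R :> R by rewrite sqrtr_gt0 ltr0n.
have E j : `|En (fun i => z i j * r i)| * Num.sqrt n%:R = `|\sum_(i < n) z i j / Num.sqrt n%:R * r i|.
  rewrite -[X in _ * X]gtr0_norm// -normrM; congr (`|_|).
  rewrite /En mulrAC mulr_sumr; apply: eq_bigr => i _.
  have -> : n%:R^-1 * Num.sqrt n%:R = (Num.sqrt n%:R)^-1 :> R.
    rewrite -[X in X^-1 * _](@sqr_sqrtr _ n%:R)// expr2 invfM -mulrA mulVf ?mulr1// gt_eqF//.
  by rewrite mulrCA mulrA.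
have S j (b : bool) : \sum_(i < n) score_weight z (j, b) i * r i =
    (-1) ^+ b * \sum_(i < n) z i j / Num.sqrt n%:R * r i.
  by rewrite mulr_sumr; apply: eq_bigr => i _; rewrite /score_weight /= [RHS]mulrA.

rewrite mulrC -ler_pdivlMr//; split.
  move=> /bigmax_leP [_ H] [j b]; rewrite S.
  have := H j isT; rewrite ler_pdivlMr// E; apply: le_trans.
  by apply: le_trans (ler_norm _) _; rewrite normrM normr_sign mul1r.
move=> H.
have H' j : `|\sum_(i < n) z i j / Num.sqrt n%:R * r i| <= t.
  have := H (j, true); have := H (j, false); rewrite !S expr0 expr1 mul1r mulN1r.
  by rewrite ler_norml => h1 h2; rewrite h1 lerNl h2.
(* The maximum starts from 0, so [0 <= t] is also required; any one column provides it, hence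
   [0 < p]. *)
apply/bigmax_leP; split; last by move=> j _; rewrite ler_pdivlMr// E.
by rewrite divr_ge0 ?(ltW s0)// (le_trans (normr_ge0 _) (H' (Ordinal p0))).
Qed.

Lemma score_weight_bound n p (z : 'M[R]_(n, p)) (B : R) :
  (forall i j, `|z i j| <= B) -> forall j i, `|score_weight z j i| <= B / Num.sqrt n%:R.
Proof.
move=> zB j i; rewrite normrM normr_sign mul1r normrM [X in _ * X]ger0_norm ?invr_ge0 ?sqrtr_ge0//.
by rewrite ler_wpM2r// invr_ge0 sqrtr_ge0.
Qed.

Lemma score_weight_norm n p (z : 'M[R]_(n, p)) : (0 < n)%N ->
  (forall j, En (fun i => z i j ^+ 2) = 1) ->
  forall j, \sum_(i < n) score_weight z j i ^+ 2 = 1.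
Proof.
move=> n0 z1 j; rewrite -(z1 j.1) /En mulr_sumr; apply: eq_bigr => i _.
by rewrite exprMn sqrr_sign mul1r exprMn exprVn sqr_sqrtr// mulrC.
Qed.

Lemma score_weight_opp n p (z : 'M[R]_(n, p)) j :
  exists k, forall i, score_weight z k i = - score_weight z j i.
Proof.
by exists (j.1, ~~ j.2) => i; rewrite /score_weight signrN mulNr.
Qed.

End Deterministic.

(** * Gaussian coverage of the two penalty levels *)

Section Coverage.
Context (R : realType) d (T : measurableType d) (P : probability T R) (n p : nat).
Variables (z : 'M[R]_(n, p)) (e : 'I_n -> {RV P >-> R}).
Hypotheses (n0 : (0 < n)%N) (p0 : (0 < p)%N).
Hypothesis inde : indep_family P e.
Hypothesis norme : forall i, standard_normal (e i).
Hypothesis z1 : forall j, En (fun i => z i j ^+ 2) = 1.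
Variables (sigma alpha : R).
Hypotheses (sigma0 : 0 < sigma) (alpha0 : 0 < alpha) (alpha1 : alpha < 1).

Lemma measurable_max_score (X : 'I_n -> T -> R) : (forall i, measurable_fun setT (X i)) ->
  measurable_fun setT (fun w => max_score z (fun i => X i w)).
Proof.
move=> mX; rewrite /max_score; elim: (index_enum _) => [|j s IH].
  by under eq_fun do rewrite big_nil; exact: measurable_cst.
under eq_fun do rewrite big_cons.
apply: measurable_maxr => //; apply: measurableT_comp => //.
apply: measurable_funM => //; apply: measurable_sum => i; exact: measurable_funM.
Qed.

(** Each of the [2 p] forms is exactly standard normal and exceeds the level with probability
    [alpha / (2 p)]; the union bound adds these up to [alpha]. *)
Lemma coverage_c_0 : 1 - alpha <= cdf_max e (score_weight z) (c_0 p sigma alpha / sigma).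
Proof.
have p0' : 0 < p%:R :> R by rewrite ltr0n.
have p2 : 0 < 2 * p%:R :> R by rewrite mulr_gt0.
rewrite /c_0 mulrAC divff ?gt_eqF// mul1r.
pose u := 1 - alpha / (2 * p%:R); rewrite -/u; set x := Phi_inv u.
have a2 : alpha / (2 * p%:R) < 1.
  by rewrite ltr_pdivrMr// mul1r (lt_le_trans alpha1)// -natrM ler1n muln_gt0.
have Px : Phi x = u.
  apply: (PhiK (norme (Ordinal n0))); first by rewrite /u subr_gt0.
  by rewrite /u ltrBlDr ltrDl divr_gt0.
have -> : 1 - alpha = 1 - #|{: 'I_p * bool}|%:R * (alpha / (2 * p%:R)).
  by rewrite card_prod card_ord card_bool natrM; field; rewrite gt_eqF.
apply: cdf_max_union_bound => j.
have mB := measurable_itv `]-oo, x]%R.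
have lj := lin_standard_normal inde norme (score_weight_norm n0 z1 j) mB.
have -> : [set w | x < lin e (score_weight z j) w] =
    ~` (lin e (score_weight z j) @^-1` `]-oo, x]).
  by apply/seteqP; split => w /=; rewrite in_itv/= ltNge => /negP.
rewrite probability_setC ?lj; last first.
  by have := measurable_lin e (score_weight z j) measurableT mB; rewrite setTI.
have -> : normal_prob 0 1 `]-oo, x] = (Phi x)%:E :> \bar R.
  by rewrite /Phi fineK// fin_num_measure.
by rewrite Px -EFinB lee_fin /u opprB addrC subrK.
Qed.

Lemma coverage_c_Z0 :
  1 - alpha <= cdf_max e (score_weight z) (c_Z0 z sigma e (1 - alpha) / sigma).
Proof.
pose f w := Z0 z sigma (fun i => e i w).
have mf : measurable_fun setT f by apply: measurable_funM => //; exact: measurable_max_score.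
pose Z : {RV P >-> R} := mfun_Sub (mem_set mf).
have ZE : c_Z0 z sigma e (1 - alpha) = quantile P Z (1 - alpha) by [].
have a0 : 0 < 1 - alpha by rewrite subr_gt0.
have a1 : 1 - alpha < 1 by rewrite ltrBlDr ltrDl.
rewrite -lee_fin cdf_maxE ZE.
apply: le_trans (quantile_attained Z a0 a1) _; rewrite le_eqVlt; apply/orP; left; apply/eqP.
congr (P _); apply/seteqP.
have E w : Z w <= quantile P Z (1 - alpha) <->
    Num.sqrt n%:R * max_score z (fun i => e i w) <= quantile P Z (1 - alpha) / sigma.
  by rewrite ler_pdivlMr// mulrC mulrA.
split=> w /=; first by move=> /E /max_score_leP H j; exact: H.
by move=> H; apply/E/max_score_leP.
Qed.
End Coverage.

(** * Errors rescaled to unit variance *)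

Section Standardized.
Context (R : realType) d (T : measurableType d) (P : probability T R) (n : nat).
Variables (eps : 'I_n -> {RV P >-> R}) (sigma2 C1 : R).
Hypothesis sigma20 : 0 < sigma2.
Hypothesis ind : mutually_independent eps.
Hypothesis E1 : (forall i, 'E_P[eps i] = 0)%E.
Hypothesis E2 : (forall i, 'E_P[fun w => (eps i w ^+ 2)%R] = sigma2%:E)%E.
Hypothesis E4 : (forall i, ('E_P[fun w => (eps i w ^+ 4)%R] <= C1%:E)%E).

Let sigma := Num.sqrt sigma2.

Definition standardized (i : 'I_n) : {RV P >-> R} := scale_mfun sigma^-1 (eps i).

Let sigma2E : sigma ^+ 2 = sigma2. Proof. by rewrite sqr_sqrtr// ltW. Qed.

Lemma indep_standardized : indep_family P standardized.
Proof.
move=> A mA.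
have mB i : measurable [set x : R | A i (x * sigma^-1)].
  have mf : measurable_fun setT (fun x : R => x * sigma^-1) by exact: measurable_funM.
  by have := mf measurableT (A i) (mA i); rewrite setTI.
exact: (indep_of_mutually_independent ind (A := fun i => [set x | A i (x * sigma^-1)]) mB).
Qed.

(** The fourth power is nonnegative, so its finite expectation is integrability; lower powers then
    follow by domination. *)
Lemma integrable_eps4 i : P.-integrable setT (EFin \o (fun w => eps i w ^+ 4)).
Proof.
apply/integrableP; split.
  by apply/measurable_EFinP; apply: measurable_funX.
rewrite (le_lt_trans _ (ltry C1))// (le_trans _ (E4 i))// unlock.
rewrite le_eqVlt; apply/orP; left; apply/eqP; apply: eq_integral => w _ /=.
by rewrite ger0_norm// exprn_even_ge0.
Qed.

Let iX := integrable_pow_le4 integrable_eps4.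

Lemma standardized_pow i k : (k <= 4)%N ->
  \int[P]_w (standardized i w ^+ k) = (\int[P]_w (eps i w ^+ k)) * sigma^-1 ^+ k.
Proof.
move=> k4; rewrite -RintegralZr//; last exact: iX.
by apply: eq_Rintegral => w _; rewrite /= exprMn.
Qed.

Lemma integrable_standardized4 i :
  P.-integrable setT (EFin \o (fun w => standardized i w ^+ 4)).
Proof.
have := integrable_EFinZ (sigma^-1 ^+ 4) (integrable_eps4 i).
by congr integrable; apply/funext => w /=; rewrite exprMn mulrC.
Qed.

Lemma standardized_mean i : \int[P]_w standardized i w = 0.
Proof.
have := @standardized_pow i 1 isT; rewrite expr1 => ->.
have /= -> : \int[P]_w (eps i w ^+ 1) = 0; last by rewrite mul0r.
by have := E1 i; rewrite unlock /Rintegral => ->.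
Qed.

Lemma standardized_variance i : \int[P]_w (standardized i w ^+ 2) = 1.
Proof.
rewrite standardized_pow//; have -> : \int[P]_w (eps i w ^+ 2) = sigma2.
  by have := E2 i; rewrite unlock /Rintegral => ->.
by rewrite exprVn sigma2E mulfV// gt_eqF.
Qed.

Lemma standardized_fourth i : \int[P]_w (standardized i w ^+ 4) <= C1 / sigma2 ^+ 2.
Proof.
rewrite standardized_pow// -sigma2E -exprM exprVn ler_wpM2r ?invr_ge0 ?exprn_ge0 ?sqrtr_ge0//.
have := E4 i; rewrite unlock -[X in (X <= _)%E -> _]fineK ?lee_fin//.
exact: integrable_fin_num (integrable_eps4 i).
Qed.

(** Turns the event on which [dantzig_error] applies into one measured by [cdf_max]. *)
Lemma score_event p (z : 'M[R]_(n, p)) (t : R) : (0 < n)%N -> (0 < p)%N ->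
  [set w | Num.sqrt n%:R * max_score z (fun i => eps i w) <= t] =
  below standardized (score_weight z) (t / sigma).
Proof.
move=> n0 p0; have s0 : 0 < sigma by rewrite sqrtr_gt0.
have E w j : lin standardized (score_weight z j) w <= t / sigma <->
    \sum_(i < n) score_weight z j i * eps i w <= t.
  rewrite ler_pdivlMr// /lin mulr_suml.
  by under eq_bigr do rewrite /= -mulrA mulfVK ?gt_eqF//.
apply/seteqP; split=> w /=; first by move=> /max_score_leP H j; apply/E; exact: H.
by move=> H; apply/max_score_leP => // j; apply/E; exact: H.
Qed.

End Standardized.

Theorem theorem4p1 (R : realType) (c1 C1 sigma2 : R)
    (c1_gt0 : 0 < c1) (C1_gt0 : 0 < C1) (sigma2_gt0 : 0 < sigma2) :
  exists c C : R, 0 < c /\ 0 < C /\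
  forall (B : nat -> R), (forall m, 1 <= B m) ->
  forall (n p : nat), (1 <= n)%N -> (3 <= p)%N ->
  forall (z : 'M[R]_(n, p)) (beta : 'cV[R]_p)
    (d : measure_display) (T : measurableType d) (P : probability T R)
    (eps : 'I_n -> {RV P >-> R}) (y : 'I_n -> T -> R),
  (forall i w, y i w = (z *m beta) i 0 + eps i w) ->
  mutually_independent eps ->
  (forall i, 'E_P[eps i] = 0)%E ->
  (forall i j, `|z i j| <= B n) ->
  (forall j, En (fun i => z i j ^+ 2) = 1) ->
  (forall i, 'E_P[fun w => (eps i w ^+ 2)%R] = sigma2%:E)%E ->
  (forall i, ('E_P[fun w => (eps i w ^+ 4)%R] <= C1%:E)%E) ->
  B n ^+ 4 * ln ((p * n)%N%:R : R) ^+ 7 / n%:R <= C1 * n%:R `^ (- c1) ->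
  forall (d' : measure_display) (T' : measurableType d')
    (Q : probability T' R) (e : 'I_n -> {RV Q >-> R}),
  mutually_independent e ->
  (forall i, standard_normal (e i)) ->
  forall (alpha : R), 0 < alpha -> alpha < 1 ->
  forall (lambda0 lambda1 : R),
  lambda0 = c_0 p (Num.sqrt sigma2) alpha ->
  lambda1 = c_Z0 z (Num.sqrt sigma2) e (1 - alpha) ->
  forall (bhat0 bhat1 : T -> 'cV[R]_p),
  (forall w, dantzig_selector z (fun i => y i w) lambda0 (bhat0 w)) ->
  (forall w, dantzig_selector z (fun i => y i w) lambda1 (bhat1 w)) ->
  forall (N : 'cV[R]_p -> R), seminorm N ->
  probability_at_least P (1 - alpha - C * n%:R `^ (- c))
    [set w | ((N (bhat0 w - beta))%:E
              <= error_bound n lambda0 (kappa z N beta))%E] /\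
  probability_at_least P (1 - alpha - C * n%:R `^ (- c))
    [set w | ((N (bhat1 w - beta))%:E
              <= error_bound n lambda1 (kappa z N beta))%E].
Proof.
(* A common bound for the fourth moments of the standardized errors and of the Gaussian
   variables. *)
pose m4 : R := C1 / sigma2 ^+ 2 + 4 ^+ 4 * (2 * expR (2^-1)).
have m40 : 0 <= m4.
  by rewrite addr_ge0 ?divr_ge0 ?exprn_ge0 ?(ltW C1_gt0) ?(ltW sigma2_gt0)// !mulr_ge0 ?expR_ge0.
have [c [C [c0 [C0 comparison]]]] := gaussian_comparison c1_gt0 C1_gt0 m40.
exists c, C; split=> //; split=> //.
move=> B B1 n p n1 p3 z beta d T P eps y yE indeps E1 zB z1 E2 E4 growth d' T' Q e inde norme.
move=> alpha alpha0 alpha1 lambda0 lambda1 l0E l1E bhat0 bhat1 sel0 sel1 N sN.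
have p0 : (0 < p)%N by rewrite (leq_trans _ p3).
have inde' := indep_of_mutually_independent inde.
set sigma := Num.sqrt sigma2 in l0E l1E.
have sigma0 : 0 < sigma by rewrite sqrtr_gt0.
have cdf_le t : cdf_max e (score_weight z) t - C * n%:R `^ (- c) <=
    cdf_max (standardized eps sigma2) (score_weight z) t.
  apply: (comparison (B n) n p) => //.
  - exact: indep_standardized.
  - by move=> i; exact: integrable_standardized4.
  - by move=> i; exact: standardized_mean.
  - by move=> i; exact: standardized_variance.
  - by move=> i; rewrite (le_trans (standardized_fourth sigma2_gt0 E4 i))// lerDl !mulr_ge0 ?exprn_ge0 ?expR_ge0.
  - move=> i; rewrite (le_trans (normal_fourth_moment (norme i)))// lerDr.
    by rewrite divr_ge0 ?exprn_ge0 ?(ltW C1_gt0) ?(ltW sigma2_gt0).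
  - by rewrite card_prod card_ord card_bool mulnC.
  - exact: score_weight_bound.
  - exact: score_weight_norm.
  - exact: score_weight_opp.
have bound lambda bhat : 1 - alpha <= cdf_max e (score_weight z) (lambda / sigma) ->
    (forall w, dantzig_selector z (fun i => y i w) lambda (bhat w)) ->
    probability_at_least P (1 - alpha - C * n%:R `^ (- c))
      [set w | ((N (bhat w - beta))%:E <= error_bound n lambda (kappa z N beta))%E].
  (* The error event may fail to be measurable, [bhat] being any choice of minimisers; the score
     event is a measurable set inside it. *)
  move=> cov sel; exists [set w | Num.sqrt n%:R * max_score z (fun i => eps i w) <= lambda].
  rewrite (score_event eps sigma2_gt0)//; split; first exact: measurable_below.
    rewrite -(score_event eps sigma2_gt0)// => w /= score.
    exact: (@dantzig_error _ _ _ _ _ _ (fun i => eps i w) (fun i => y i w)).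
  by rewrite -cdf_maxE lee_fin (le_trans _ (cdf_le _))// lerD2r.
split; apply: bound => //; rewrite ?l0E ?l1E.
  exact: coverage_c_0.
exact: coverage_c_Z0.
Qed.
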